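(* Let $F$ be a global field with $\mathrm{char}\,F\neq 2$. Suppose $A$ is a central division $F$-algebra of degree $8$ containing a biquadratic extension $K=F(\sqrt{a},\sqrt{b})$ of $F$, where $a,b\in F^\times$ are independent modulo $F^{\times 2}$ and such that the quadratic form $\langle a,b,ab\rangle$ is not isometric to $\langle 1,1,1\rangle$ over $F$. Moreover, assume $v_1,v_2$ are two nondyadic valuations of $F$ such that: (1) $v_1,v_2$ extend to valuations of $A$; (2) the inertia fields of $v_1$ and $v_2$ for $K/F$ are two distinct quadratic extensions of $F$; (3) $|\overline{F}_{v_1}|\not\equiv 1\bmod 4$; (4) $|\overline{F}_{v_2}|\not\equiv 1\bmod 4$. Then there is no Galois extension $M/F$ of degree $8$ such that $K\subseteq M\subseteq A$. Consequently, the Mal'cev-Neumann division algebra $\mathcal{D}=C_A(K)((\Gamma))$ with $\Gamma=\mathbb{Z}\times\mathbb{Z}$, built from the homomorphism $\varepsilon:\mathbb{Z}\times\mathbb{Z}\to\mathrm{Gal}[K/F]$, $\varepsilon(r,s)=\sigma^r\tau^s$, is not a crossed product.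
   Context: $\overline{F}_v$ denotes the residue field of $F$ for the valuation $v$; a valuation is nondyadic if its residue characteristic is not $2$. The degree of a central division $F$-algebra $A$ is $\sqrt{[A:F]}$. A valuation on a division algebra $A$ is a map $w$ from $A$ to a totally ordered abelian group with $\infty$ adjoined such that $w(x)=\infty\iff x=0$, $w(x+y)\ge\min\{w(x),w(y)\}$, $w(xy)=w(x)+w(y)$. The inertia field of $v$ for the Galois extension $K/F$ is the fixed field of the inertia group of the extension of $v$ to $K$ (unique under (1)). $\langle a_1,\dots,a_n\rangle$ denotes the diagonal quadratic form $a_1x_1^2+\dots+a_nx_n^2$. The automorphisms $\sigma,\tau$ generating $G=\mathrm{Gal}[K/F]$ are defined by $\sigma(\sqrt a)=-\sqrt a$, $\sigma(\sqrt b)=\sqrt b$, $\tau(\sqrt a)=\sqrt a$, $\tau(\sqrt b)=-\sqrt b$. The group $\Gamma=\mathbb{Z}\times\mathbb{Z}$ is viewed as a totally ordered abelian group (with a fixed total order compatible with addition). $C_A(K)$ is the centralizer of $K$ in $A$. Construction of the Mal'cev-Neumann ring $C_A(K)((\Gamma))$: by the Skolem-Noether theorem, for each $\rho\in G$ choose $u_\rho\in A^\times$ with $x^\rho=u_\rho^{-1}xu_\rho$ for all $x\in K$, with $u_{\mathrm{Id}}=1$. The elements of $C_A(K)((\Gamma))$ are formal series $\sum_{\gamma\in\Gamma}a_\gamma r_\gamma$ in indeterminates $a_\gamma$, with $r_\gamma\in C_A(K)$, whose support $\{\gamma\in\Gamma\mid r_\gamma\ne 0\}$ is well-ordered. Addition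 is componentwise; multiplication is determined by the rules $r a_\gamma=a_\gamma\,(u_{\varepsilon(\gamma)}^{-1}ru_{\varepsilon(\gamma)})$ for $r\in C_A(K)$, $\gamma\in\Gamma$, and $a_\gamma a_\delta=a_{\gamma+\delta}\,u_{\varepsilon(\gamma)\varepsilon(\delta)}^{-1}u_{\varepsilon(\gamma)}u_{\varepsilon(\delta)}$ for $\gamma,\delta\in\Gamma$. This is a well-defined associative ring, and it is a division algebra since $A$ is. A finite-dimensional central simple algebra over a field $E$ is a crossed product if it contains a maximal commutative subalgebra that is a Galois field extension of $E$; for $\mathcal{D}$, $E$ is the center of $\mathcal{D}$. *)

(* Defs.v *)
From HB Require Import structures.
From mathcomp Require Import all_boot all_order all_algebra all_fingroup.
From mathcomp Require Import all_solvable all_field ring_quotient.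
From mathcomp Require Import boolp classical_sets functions cardinality fsbigop.

Set Implicit Arguments.
Unset Strict Implicit.
Unset Printing Implicit Defensive.

Import Order.TTheory GRing.Theory.
Local Open Scope classical_set_scope.
Local Open Scope ring_scope.

Definition global_field (F : fieldType) : Prop :=
  (exists (L : fieldExtType rat) (f : {rmorphism L -> F}), bijective f) \/
  (exists (k : finFieldType) (L : fieldExtType {fraction {poly k}})
          (f : {rmorphism L -> F}), bijective f).

Definition diag_form (F : fieldType) (n : nat) (c : n.-tuple F)
  (x : 'rV[F]_n) : F := \sum_(i < n) tnth c i * x 0 i ^+ 2.

Definition isometric (F : fieldType) (n : nat) (q q' : 'rV[F]_n -> F) : Prop :=
  exists2 P : 'M[F]_n, P \in unitmx & forall x, q' (x *m P) = q x.

(* Linear independence over the field of two elements in the group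
   F^* / F^*2, written multiplicatively. *)
Definition indep_mod_squares (F : fieldType) (a b : F) : Prop :=
  forall i j : bool, (exists c : F, a ^+ i * b ^+ j = c ^+ 2) ->
    i = false /\ j = false.

Record group_order (V : zmodType) (le : rel V) : Prop := GroupOrder {
  go_anti : antisymmetric le;
  go_trans : transitive le;
  go_total : total le;
  go_add : forall z x y, le x y -> le (x + z) (y + z)
}.

Record oag := Oag {
  oag_sort :> zmodType;
  oag_le : rel oag_sort;
  oag_leP : group_order oag_le
}.

Section OagTheory.
Variable V : oag.
Implicit Types x y z : V.
Local Notation le := (@oag_le V).

Lemma oag_refl x : le x x.
Proof. by have /orP[] := go_total (oag_leP V) x x. Qed.

Lemma oag_trans y x z : le x y -> le y z -> le x z.
Proof. exact: (go_trans (oag_leP V)). Qed.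

Lemma oag_anti x y : le x y -> le y x -> x = y.
Proof. by move=> h1 h2; apply: (go_anti (oag_leP V)); rewrite h1. Qed.

Lemma oag_leNgt x y : ~~ le x y -> le y x.
Proof. by have /orP[->|//] := go_total (oag_leP V) x y. Qed.

Lemma oag_add x1 y1 x2 y2 : le x1 y1 -> le x2 y2 -> le (x1 + x2) (y1 + y2).
Proof.
move=> h1 h2; apply: (@oag_trans (y1 + x2)).
  exact: (go_add (oag_leP V)).
by rewrite ![y1 + _]addrC; apply: (go_add (oag_leP V)).
Qed.

Lemma oag_cancel z x y : le (x + z) (y + z) -> le x y.
Proof. by move/(go_add (oag_leP V) (- z)); rewrite !addrK. Qed.

Lemma oag_ltD x1 y1 x2 y2 :
  le x1 y1 -> ~~ le y2 x2 -> ~~ le (y1 + y2) (x1 + x2).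
Proof.
move=> h1; apply: contra => h2; apply: (@oag_cancel y1).
rewrite ![_ + y1]addrC; apply: (oag_trans h2).
exact: oag_add h1 (oag_refl _).
Qed.

End OagTheory.

(* The group V with a top element [None] standing for infinity. *)
Definition vle (V : oag) (g h : option V) : bool :=
  match g, h with
  | _, None => true
  | None, Some _ => false
  | Some x, Some y => oag_le x y
  end.

Definition vlt (V : oag) (g h : option V) : bool := ~~ vle h g.

Definition vmin (V : oag) (g h : option V) : option V :=
  if vle g h then g else h.

Definition vadd (V : oag) (g h : option V) : option V :=
  match g, h with Some x, Some y => Some (x + y) | _, _ => None end.

Record valuation (R : pzRingType) (V : oag) := Valuation {
  val_fun :> R -> option V;
  val_inf : forall x, val_fun x = None <-> x = 0;
  val_add : forall x y, vle (vmin (val_fun x) (val_fun y)) (val_fun (x + y));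
  val_mul : forall x y, val_fun (x * y) = vadd (val_fun x) (val_fun y)
}.

(* [w] extends [v] along [f]: the value group of [w] may be larger. *)
Definition val_extends (R S : pzRingType) (V W : oag) (f : R -> S)
    (v : valuation R V) (w : valuation S W) : Prop :=
  exists phi : {additive V -> W},
    (forall x y, oag_le (phi x) (phi y) = oag_le x y) /\
    (forall x, w (f x) = omap phi (v x)).

Definition extends_to (F : fieldType) (A : falgType F) (V : oag)
    (v : valuation F V) : Prop :=
  exists (W : oag) (w : valuation A W), val_extends (in_alg A) v w.

Section ValuationRing.
Variables (F : fieldType) (V : oag) (v : valuation F V).

Lemma vle_trans (W : oag) (h g k : option W) : vle g h -> vle h k -> vle g k.
Proof. by case: g h k => [x|] [y|] [z|] //=; apply: oag_trans. Qed.

Lemma val1 (R : nzRingType) (W : oag) (w : valuation R W) : w 1 = Some 0.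
Proof.
have := val_mul w 1 1; have := val_inf w 1; rewrite mulr1.
case: (w 1) => [x _ [/eqP]|[/(_ erefl)/eqP]]; last by rewrite oner_eq0.
by rewrite -subr_eq0 opprD addNKr oppr_eq0 => /eqP->.
Qed.

Lemma val0 (R : pzRingType) (W : oag) (w : valuation R W) : w 0 = None.
Proof. exact/val_inf. Qed.

Lemma valN1 (R : nzRingType) (W : oag) (w : valuation R W) : w (-1) = Some 0.
Proof.
have := val_mul w (-1) (-1); rewrite mulrNN mulr1 val1.
case: (w (-1)) => [x /=[/esym xx]|//]; congr Some.
have /orP[h|h] := go_total (oag_leP W) 0 x; apply: oag_anti => //.
  by have := oag_add h (oag_refl x); rewrite add0r xx.
by have := oag_add h (oag_refl x); rewrite add0r xx.
Qed.

Lemma valN (R : nzRingType) (W : oag) (w : valuation R W) x : w (- x) = w x.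
Proof. by rewrite -mulN1r val_mul valN1; case: (w x) => //= y; rewrite add0r. Qed.

Lemma vle_min (g h k : option V) : vle k g -> vle k h -> vle k (vmin g h).
Proof. by rewrite /vmin; case: ifP. Qed.

Lemma vlt_min (g h k : option V) : vlt k g -> vlt k h -> vlt k (vmin g h).
Proof. by rewrite /vmin; case: ifP. Qed.

Definition val_ring_pred : {pred F} := [pred x | vle (Some 0) (v x)].

Lemma val_ring_closed : subring_closed val_ring_pred.
Proof.
have vrE x : (x \in val_ring_pred) = vle (Some 0) (v x) by [].
split=> [|x y|x y]; rewrite !vrE ?val1; [exact: oag_refl| |] => hx hy.
  have := val_add v x (- y); apply: vle_trans.
  by rewrite vle_min ?valN.
rewrite val_mul; case: (v x) (v y) hx hy => [g|] [h|] //= hg hh.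
by rewrite -[0]addr0 oag_add.
Qed.

HB.instance Definition _ :=
  GRing.isSubringClosed.Build F val_ring_pred val_ring_closed.

Record val_ring := ValRing {vr_val : F; vr_valP : vr_val \in val_ring_pred}.

HB.instance Definition _ := [isSub for vr_val].
HB.instance Definition _ := [Choice of val_ring by <:].
HB.instance Definition _ := [SubChoice_isSubComNzRing of val_ring by <:].

Definition val_max : {pred val_ring} :=
  [pred x : val_ring | vlt (Some 0) (v (\val x))].

Lemma val_max_closed : idealr_closed val_max.
Proof.
split; rewrite ?inE ?rmorph0 ?rmorph1 ?val0 ?val1 /vlt //= ?oag_refl //.
move=> a x y; rewrite !inE rmorphD rmorphM /= => hx hy.
have hax : vlt (Some 0) (v (\val a * \val x)).
  have := vr_valP a; rewrite !inE val_mul -/(\val a).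
  case: (v _) (v (\val x)) hx => [g|] [h|] //=.
  rewrite /vlt /= => hh hg; rewrite -[0]addr0; exact: oag_ltD.
have := vlt_min hax hy; apply: contra => h; exact: vle_trans (val_add v _ _) h.
Qed.

HB.instance Definition _ := isIdealr.Build val_ring val_max val_max_closed.

Definition residue_field := {ideal_quot val_max}.

HB.instance Definition _ := GRing.ComNzRing.on residue_field.

End ValuationRing.

Definition nondyadic (F : fieldType) (V : oag) (v : valuation F V) : Prop :=
  2%N \notin [pchar (residue_field v)].

Definition residue_card (F : fieldType) (V : oag) (v : valuation F V)
  (q : nat) : Prop := ([set: residue_field v] #= `I_q)%card.

Definition well_ordered (V : oag) (S : set V) : Prop :=
  forall B : set V, B `<=` S -> B !=set0 ->
    exists2 m, B m & forall x, B x -> oag_le m x.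

Section WellOrdered.
Variable V : oag.
Implicit Types (S T : set V).
Local Notation le := (@oag_le V).

Lemma well_ordered_sub S T : S `<=` T -> well_ordered T -> well_ordered S.
Proof. by move=> ST woT B BS; apply: woT; apply: subset_trans ST. Qed.

Lemma well_ordered1 (x : V) : well_ordered [set x].
Proof.
move=> B Bx [b Bb]; exists b => // y By.
by rewrite (Bx _ By) (Bx _ Bb); exact: oag_refl.
Qed.

Lemma well_orderedU S T :
  well_ordered S -> well_ordered T -> well_ordered (S `|` T).
Proof.
move=> woS woT B BST [b Bb].
have [[s BSs]|nS] := pselect ((B `&` S) !=set0); last first.
  apply: woT; last by exists b.
  move=> x Bx; have [Sx|//] := BST _ Bx.
  by case: nS; exists x.
have [[t BTt]|nT] := pselect ((B `&` T) !=set0); last first.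
  apply: woS; last by exists b.
  move=> x Bx; have [//|Tx] := BST _ Bx.
  by case: nT; exists x.
have [|m1 [Bm1 _] m1P] := woS (B `&` S) (@subIsetr _ _ _); first by exists s.
have [|m2 [Bm2 _] m2P] := woT (B `&` T) (@subIsetr _ _ _); first by exists t.
have [h|/oag_leNgt h] := boolP (le m1 m2).
  exists m1 => // x Bx; have [Sx|Tx] := BST _ Bx; first exact: m1P.
  by apply: oag_trans h _; apply: m2P.
exists m2 => // x Bx; have [Sx|Tx] := BST _ Bx; last exact: m2P.
by apply: oag_trans h _; apply: m1P.
Qed.

Lemma minmax_finite S : well_ordered S ->
    (forall B, B `<=` S -> B !=set0 -> exists2 m, B m & forall x, B x -> le x m) ->
  finite_set S.
Proof.
move=> minS maxS.
have [S0|nS] := pselect (S !=set0); last first.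
  by rewrite (_ : S = set0)//; apply/eqP/negPn/negP => /set0P.
pose I x := [set y | S y /\ le y x].
pose B := [set x | S x /\ finite_set (I x)].
have [m0 Sm0 m0P] := minS S (@subset_refl _ _) S0.
have Bm0 : B m0.
  split=> //; apply: sub_finite_set (finite_set1 m0) => y [Sy ym0] /=.
  by apply: oag_anti => //; apply: m0P.
have [|m [Sm finm] mP] := maxS B _ (ex_intro _ _ Bm0); first by move=> x [].
have [D0|nD] := pselect ([set y | S y /\ ~~ le y m] !=set0); last first.
  apply: sub_finite_set finm => y Sy; split=> //.
  by apply: contrapT => /negP nym; apply: nD; exists y.
have [|m' [Sm' nm'm] m'P] := minS _ _ D0; first by move=> x [].
suff Bm' : B m' by rewrite mP in nm'm.
split=> //; apply: (@sub_finite_set _ _ (I m `|` [set m'])); last first.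
  by rewrite finite_setU; split.
move=> y [Sy ym']; have [ym|nym] := boolP (le y m); first by left.
by right; apply: oag_anti => //; apply: m'P.
Qed.

Lemma argmin_seq (s : seq V) (g : V -> V) (x0 : V) : x0 \in s ->
  exists2 m, m \in s & forall x, x \in s -> le (g m) (g x).
Proof.
elim: s x0 => // a s IHs x0 _.
case: s IHs => [_|b s /(_ b)].
  exists a; rewrite ?mem_head// => x.
  by rewrite inE => /eqP->; exact: oag_refl.
rewrite mem_head => /(_ isT)[m ms mP].
have [h|/oag_leNgt h] := boolP (le (g m) (g a)).
  exists m; first by rewrite inE ms orbT.
  by move=> x; rewrite inE => /predU1P[->|/mP].
exists a; first by rewrite mem_head.
move=> x; rewrite inE => /predU1P[->|/mP]; first exact: oag_refl.
exact: oag_trans.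
Qed.

Definition sumset S T : set V :=
  [set x | exists s t, [/\ S s, T t & x = s + t]].

Lemma well_ordered_sumset S T :
  well_ordered S -> well_ordered T -> well_ordered (sumset S T).
Proof.
move=> woS woT B BST [b Bb].
pose T' s := [set t | T t /\ B (s + t)].
pose S0 := [set s | S s /\ T' s !=set0].
have SS0 : S0 `<=` S by move=> x [].
have /choice[f fP] : forall s, exists t,
    S0 s -> T' s t /\ forall x, T' s x -> le t x.
  move=> s; have [[Ss T's]|nS] := pselect (S0 s); last by exists 0 => /nS.
  by have [|t T't tP] := woT (T' s) _ T's; [move=> x []|exists t].
pose P := [set s | S0 s /\ forall s', S0 s' -> ~~ le s s' -> ~~ le (f s') (f s)].
have PP s : S0 s -> exists p, [/\ P p, le p s & le (f p) (f s)].
  move=> S0s; pose Q := [set s' | S0 s' /\ le s' s].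
  have Qs : Q s by split=> //; exact: oag_refl.
  have [||t0 [q Qq qt0] t0P] := woT (f @` Q).
  - by move=> _ [x [S0x _] <-]; have [[]] := fP _ S0x.
  - by exists (f s), s.
  have [||p [[S0p ps] fp] pP] := woS [set s' | Q s' /\ f s' = t0].
  - by move=> x [[/SS0]].
  - by exists q.
  exists p; split=> //; last by rewrite fp; apply: t0P; exists s.
  split=> // s' S0s' nps'; apply/negP; rewrite fp => h.
  have Qs' : Q s'.
    by split=> //; apply: oag_trans ps; apply: oag_leNgt.
  have fs' : f s' = t0 by apply: oag_anti => //; apply: t0P; exists s'.
  by rewrite pP in nps'.
have finP : finite_set P.
  apply: minmax_finite => [|C CP C0].
    by apply: well_ordered_sub woS => x [/SS0].
  have [||_ [q Cq <-] qP] := woT (f @` C).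
  - by move=> _ [x /CP[S0x _] <-]; have [[]] := fP _ S0x.
  - by case: C0 => c Cc; exists (f c), c.
  exists q => // x Cx; apply: contrapT => /negP nxq.
  have [_ /(_ q)] := CP _ Cx; have [S0q _] := CP _ Cq.
  by move=> /(_ S0q nxq); rewrite qP//; exists x.
have S0B c s t : B c -> S s -> T t -> c = s + t -> S0 s /\ le (f s) t.
  move=> Bc Ss Tt cE; have T't : T' s t by split=> //; rewrite -cE.
  have S0s : S0 s by split=> //; exists t.
  by split=> //; have [_] := fP _ S0s; apply.
have [X PX] := (finite_seqP _).1 finP.
have inX p : P p -> p \in X by rewrite PX.
have [s [t [Ss Tt bE]]] := BST _ Bb.
have [S0s _] := S0B _ _ _ Bb Ss Tt bE.
have [p [/inX pX _ _]] := PP _ S0s.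
have [m mX mP] := argmin_seq (fun x => x + f x) pX.
have [S0m _] : P m by rewrite PX.
exists (m + f m); first by have [[]] := fP _ S0m.
move=> c Bc; have [s1 [t1 [Ss1 Tt1 cE]]] := BST _ Bc.
have [S0s1 fs1] := S0B _ _ _ Bc Ss1 Tt1 cE.
have [p1 [/inX/mP h ps fps]] := PP _ S0s1.
apply: oag_trans h _; apply: (@oag_trans _ (s1 + f s1)); first exact: oag_add.
by rewrite cE; apply: oag_add fs1; exact: oag_refl.
Qed.

Lemma finite_fiber S T (c : V) : well_ordered S -> well_ordered T ->
  finite_set [set x | S x /\ T (c - x)].
Proof.
move=> woS woT; apply: minmax_finite => [|B BP B0].
  by apply: well_ordered_sub woS => x [].
have [||_ [q Bq <-] qP] := woT ((fun x => c - x) @` B).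
- by move=> _ [x /BP[_ Tx] <-].
- by case: B0 => b Bb; exists (c - b), b.
exists q => // x Bx; have := qP (c - x) (ex_intro2 _ _ _ Bx erefl).
move=> /(go_add (oag_leP V) (x + q - c)).
have E y z : c - y + (z + y - c) = z.
  by rewrite addrC -addrA [_ + (c - y)]addrA addNr add0r addrK.
by rewrite [x + q]addrC E [q + x]addrC E.
Qed.

End WellOrdered.

Section Convolution.
Variables (V : oag) (A : nzRingType).
Implicit Types (f g h : V -> A) (c : V).

Definition fsupp f : set V := [set x | f x != 0].

Definition conv f g c : A := \sum_(x \in [set: V]) f x * g (c - x).

Lemma convE f g c (s : seq V) : uniq s ->
    (forall x, f x * g (c - x) != 0 -> x \in s) ->
  conv f g c = \sum_(x <- s) f x * g (c - x).
Proof.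
move=> us sP; rewrite fsbig_seq//; apply/esym/fsbig_widen => // x [_ /= xs].
by apply/eqP/negPn/negP => /sP.
Qed.

Lemma conv_neq0 f g c :
  conv f g c != 0 -> exists x, f x * g (c - x) != 0.
Proof.
move=> h; apply: contrapT => /forallNP nE; case/eqP: h.
by apply: fsbig1 => x _; apply/eqP/negPn/negP/nE.
Qed.

Lemma mul_neq0 (a b : A) : a * b != 0 -> a != 0 /\ b != 0.
Proof.
move=> ab; split; apply: contra ab => /eqP->; by rewrite ?mul0r ?mulr0.
Qed.

Lemma fsupp_conv f g : fsupp (conv f g) `<=` sumset (fsupp f) (fsupp g).
Proof.
by move=> c /conv_neq0[x /mul_neq0[fx gx]]; exists x, (c - x); rewrite subrKC.
Qed.

Lemma well_ordered_conv f g : well_ordered (fsupp f) ->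
  well_ordered (fsupp g) -> well_ordered (fsupp (conv f g)).
Proof.
move=> wf wg; apply: well_ordered_sub (@fsupp_conv f g) _.
exact: well_ordered_sumset.
Qed.

Lemma finite_uniq_seq (S : set V) : finite_set S ->
  exists s : seq V, uniq s /\ forall x, S x -> x \in s.
Proof.
move=> /finite_seqP[s ->]; exists (undup s); split; first exact: undup_uniq.
by move=> x /=; rewrite mem_undup.
Qed.

Lemma conv_seq f g c : well_ordered (fsupp f) -> well_ordered (fsupp g) ->
  exists s : seq V, uniq s /\ forall x, f x != 0 -> g (c - x) != 0 -> x \in s.
Proof.
move=> wf wg; have [s [us sP]] := finite_uniq_seq (finite_fiber c wf wg).
by exists s; split=> // x fx gx; apply: sP.
Qed.

Lemma convA f g h : well_ordered (fsupp f) -> well_ordered (fsupp g) ->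
  well_ordered (fsupp h) -> conv f (conv g h) =1 conv (conv f g) h.
Proof.
move=> wf wg wh c.
have [s [us sP]] := finite_uniq_seq
  (finite_fiber c wf (well_ordered_sumset wg wh)).
have [d [ud dP]] := finite_uniq_seq
  (finite_fiber c (well_ordered_sumset wf wg) wh).
rewrite (convE us); last first.
  by move=> x /mul_neq0[fx /fsupp_conv ghx]; apply: sP.
rewrite (convE ud); last first.
  by move=> x /mul_neq0[/fsupp_conv fgx hx]; apply: dP.
transitivity (\sum_(x <- s) \sum_(y <- d) f x * g (y - x) * h (c - y)).
  apply: eq_bigr => x _.
  have [fx0|fx0] := eqVneq (f x) 0.
    by rewrite fx0 mul0r big1// => y _; rewrite !mul0r.
  rewrite (@convE _ _ _ [seq y - x | y <- d]).
  - rewrite big_map mulr_sumr; apply: eq_bigr => y _; rewrite mulrA.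
    by congr (_ * h _); rewrite opprB addrA subrK.
  - by rewrite map_inj_uniq//; apply: addIr.
  - move=> z /mul_neq0[gz hz]; apply/mapP; exists (z + x); last by rewrite addrK.
    apply: dP; split; first by exists x, z; rewrite [RHS]addrC.
    by rewrite /fsupp /= opprD addrA addrAC.
rewrite exchange_big /=; apply: eq_bigr => y _.
have [hy0|hy0] := eqVneq (h (c - y)) 0.
  by rewrite hy0 mulr0 big1// => x _; rewrite mulr0.
rewrite -mulr_suml (convE us)// => x /mul_neq0[fx gx].
apply: sP; split=> //; exists (y - x), (c - y); split=> //.
by rewrite [RHS]addrC addrA subrK.
Qed.

End Convolution.

Section ConvolutionD.
Variables (V : oag) (A : nzRingType).
Implicit Types (f g h : V -> A) (c : V).

Lemma convDl f g h : well_ordered (fsupp f) -> well_ordered (fsupp g) ->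
  well_ordered (fsupp h) ->
  conv (fun x => f x + g x) h =1 (fun c => conv f h c + conv g h c).
Proof.
move=> wf wg wh c.
have [s [us sP]] := finite_uniq_seq (finite_fiber c (well_orderedU wf wg) wh).
rewrite !(convE us) -?big_split /=; first by apply: eq_bigr => x _; rewrite mulrDl.
- by move=> x /mul_neq0[gx hx]; apply: sP; split=> //; right.
- by move=> x /mul_neq0[fx hx]; apply: sP; split=> //; left.
move=> x /mul_neq0[fgx hx]; apply: sP; split=> //.
have [fx|fx] := eqVneq (f x) 0; last by left.
by right; move: fgx; rewrite fx add0r.
Qed.

Lemma convDr f g h : well_ordered (fsupp f) -> well_ordered (fsupp g) ->
  well_ordered (fsupp h) ->
  conv h (fun x => f x + g x) =1 (fun c => conv h f c + conv h g c).
Proof.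
move=> wf wg wh c.
have [s [us sP]] := finite_uniq_seq (finite_fiber c wh (well_orderedU wf wg)).
rewrite !(convE us) -?big_split /=; first by apply: eq_bigr => x _; rewrite mulrDr.
- by move=> x /mul_neq0[hx gx]; apply: sP; split=> //; right.
- by move=> x /mul_neq0[hx fx]; apply: sP; split=> //; left.
move=> x /mul_neq0[hx fgx]; apply: sP; split=> //.
have [fx|fx] := eqVneq (f (c - x)) 0; last by left.
by right; move: fgx; rewrite fx add0r.
Qed.

Lemma conv1l f : conv (fun x => (x == 0)%:R) f =1 f.
Proof.
move=> c; rewrite (@convE _ _ _ _ _ [:: 0])// => [|x].
  by rewrite big_seq1 eqxx mul1r subr0.
by rewrite inE => /mul_neq0[]; case: (x =P 0) => // _; rewrite eqxx.
Qed.

Lemma conv1r f : conv f (fun x => (x == 0)%:R) =1 f.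
Proof.
move=> c; rewrite (@convE _ _ _ _ _ [:: c])// => [|x].
  by rewrite big_seq1 subrr eqxx mulr1.
rewrite inE => /mul_neq0[_]; rewrite subr_eq0 [c == x]eq_sym.
by case: (x =P c) => // _; rewrite eqxx.
Qed.

End ConvolutionD.

Section Inertia.
Variables (F : fieldType) (K : splittingFieldType F).

Definition inertia_group (W : oag) (w : valuation K W) : {set gal_of {:K}} :=
  [set rho : gal_of {:K} |
    `[< forall x : K, vle (Some 0) (w x) -> vlt (Some 0) (w (rho x - x)) >]]%SET.

(* If v extends to a division algebra containing K, then w is unique up to
   equivalence of valuations. *)
Definition is_inertia_field (V : oag) (v : valuation F V) (E : {vspace K}) :=
  exists (W : oag) (w : valuation K W),
    val_extends (in_alg K) v w /\ E = fixedField (inertia_group w).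

End Inertia.

Section MalcevNeumann.
Variables (F : fieldType) (A : falgType F) (K : splittingFieldType F).
Variables (iota : {lrmorphism K -> A}) (G : oag).

Definition centralizer : {vspace A} := 'C(limg (linfun iota))%VS.

(* A homomorphism G -> Gal(K/F) and a choice of Skolem-Noether elements.  In
   gal_of the product rho * rho' is "rho, then rho'" (galM), which matches the
   exponent notation x^rho. *)
Record mn_data := MNData {
  mn_eps : G -> gal_of {:K};
  mn_epsD : forall c d, mn_eps (c + d) = (mn_eps c * mn_eps d)%g;
  mn_u : gal_of {:K} -> A;
  mn_u_unit : forall rho, mn_u rho \is a GRing.unit;
  mn_u1 : mn_u 1%g = 1;
  mn_u_conj : forall (rho : gal_of {:K}) x,
    iota (rho x) = (mn_u rho)^-1 * iota x * mn_u rho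
}.

(* [mn_coef x c] is the coefficient r_c of the series x = sum_c a_c r_c. *)
Record mn_ring (D : mn_data) := MNRing {
  mn_coef : G -> A;
  mn_coefP : forall c, mn_coef c \in centralizer;
  mn_supp : well_ordered (fsupp mn_coef)
}.

Arguments mn_supp {D} m _ _ _.

Variable D : mn_data.
Local Notation eps := (mn_eps D).
Local Notation u := (mn_u D).

HB.instance Definition _ := gen_eqMixin (mn_ring D).
HB.instance Definition _ := gen_choiceMixin (mn_ring D).

Lemma mn_ringP (x y : mn_ring D) : mn_coef x =1 mn_coef y -> x = y.
Proof.
case: x y => [f fC fS] [g gC gS] /= /funext fg.
by case: _ / fg in gC gS *; congr MNRing; exact: Prop_irrelevance.
Qed.

Lemma centralizerP (r : A) :
  reflect (forall x, r * iota x = iota x * r) (r \in centralizer).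
Proof.
apply: (iffP centvP) => [h x|h _ /memv_imgP[x _ ->]].
  by rewrite -(lfunE iota) h// memv_img// memvf.
by rewrite lfunE h.
Qed.

Definition mn_zero : mn_ring D.
Proof.
refine (@MNRing D (fun _ => 0) (fun _ => mem0v _) _).
by move=> B B0 [b /B0]; rewrite /fsupp /= eqxx.
Defined.

Definition mn_opp (x : mn_ring D) : mn_ring D.
Proof.
refine (@MNRing D (fun c => - mn_coef x c) _ _) => [c|].
  by rewrite memvN mn_coefP.
apply: (well_ordered_sub _ (mn_supp x)) => c.
by rewrite /fsupp /= oppr_eq0.
Defined.

Definition mn_add (x y : mn_ring D) : mn_ring D.
Proof.
refine (@MNRing D (fun c => mn_coef x c + mn_coef y c) _ _) => [c|].
  by rewrite memvD ?mn_coefP.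
apply: (well_ordered_sub _ (well_orderedU (mn_supp x) (mn_supp y))) => c.
rewrite /fsupp /=; have [->|] := eqVneq (mn_coef x c) 0; last by left.
by rewrite add0r; right.
Defined.

Lemma mn_addA : associative mn_add.
Proof. by move=> x y z; apply: mn_ringP => c /=; rewrite addrA. Qed.

Lemma mn_addC : commutative mn_add.
Proof. by move=> x y; apply: mn_ringP => c /=; rewrite addrC. Qed.

Lemma mn_add0 : left_id mn_zero mn_add.
Proof. by move=> x; apply: mn_ringP => c /=; rewrite add0r. Qed.

Lemma mn_addN : left_inverse mn_zero mn_opp mn_add.
Proof. by move=> x; apply: mn_ringP => c /=; rewrite addNr. Qed.

HB.instance Definition _ :=
  GRing.isZmodule.Build (mn_ring D) mn_addA mn_addC mn_add0 mn_addN.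

(* r a_d = a_d (mn_conj d r)  and  a_c a_d = a_(c + d) (mn_cocycle c d) *)
Definition mn_conj (d : G) (r : A) : A := (u (eps d))^-1 * r * u (eps d).

Definition mn_cocycle (c d : G) : A :=
  (u (eps c * eps d)%g)^-1 * u (eps c) * u (eps d).

(* The coefficient of a_c in the product of sum_p a_p (x p) and
   sum_q a_q (y q), as a_p (x p) a_q (y q)
   = a_(p + q) (mn_cocycle p q) (mn_conj q (x p)) (y q).  When x and y have
   well-ordered supports, only finitely many terms of the sum are nonzero
   (finite_fiber). *)
Definition mn_mul_coef (x y : G -> A) (c : G) : A :=
  \sum_(p \in [set: G])
     mn_cocycle p (c - p) * mn_conj (c - p) (x p) * y (c - p).

Lemma u_intertwine (rho : gal_of {:K}) x : u rho * iota (rho x) = iota x * u rho.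
Proof. by rewrite (mn_u_conj D) !mulrA divrr ?mn_u_unit// mul1r. Qed.

Lemma uV_intertwine (rho : gal_of {:K}) x :
  (u rho)^-1 * iota x = iota (rho x) * (u rho)^-1.
Proof. by rewrite (mn_u_conj D) mulrK ?mn_u_unit. Qed.

Lemma gal_surj (rho : gal_of {:K}) x : exists y, x = rho y.
Proof. by exists ((rho^-1)%g x); rewrite -galM ?memvf// mulVg gal_id. Qed.

Lemma mn_conj_cent d r : r \in centralizer -> mn_conj d r \in centralizer.
Proof.
move=> /centralizerP rC; apply/centralizerP => x.
have [y ->] := gal_surj (eps d) x.
rewrite /mn_conj -[LHS]mulrA u_intertwine !mulrA -uV_intertwine.
by rewrite -[_ * r * iota _]mulrA rC !mulrA.
Qed.

Lemma mn_cocycle_cent c d : mn_cocycle c d \in centralizer.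
Proof.
apply/centralizerP => x.
have [y ->] := gal_surj (eps c * eps d)%g x.
rewrite /mn_cocycle !mulrA -uV_intertwine galM ?memvf//.
rewrite -[LHS]mulrA u_intertwine !mulrA; congr (_ * _).
by rewrite -[LHS]mulrA u_intertwine mulrA.
Qed.

Lemma centralizerM r s :
  r \in centralizer -> s \in centralizer -> r * s \in centralizer.
Proof.
move=> /centralizerP rC /centralizerP sC; apply/centralizerP => x.
by rewrite -mulrA sC mulrA rC mulrA.
Qed.

Definition mn_twist (x : G -> A) (c : G) : A := u (eps c) * x c.

Lemma u_mul_eq0 rho (r : A) : (u rho * r == 0) = (r == 0).
Proof.
apply/eqP/eqP => [h|->]; last by rewrite mulr0.
by rewrite -[r](mulKr (mn_u_unit D rho)) h mulr0.
Qed.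

Lemma fsupp_twist x : fsupp (mn_twist x) = fsupp x.
Proof. by apply/seteqP; split=> c; rewrite /fsupp /= u_mul_eq0. Qed.

Lemma mn_mul_coefE x y : well_ordered (fsupp x) -> well_ordered (fsupp y) ->
  mn_mul_coef x y
    =1 (fun c => (u (eps c))^-1 * conv (mn_twist x) (mn_twist y) c).
Proof.
move=> wx wy c.
have [s [us sP]] := finite_uniq_seq (finite_fiber c wx wy).
have E p : mn_cocycle p (c - p) * mn_conj (c - p) (x p) * y (c - p)
   = (u (eps c))^-1 * (mn_twist x p * mn_twist y (c - p)).
  rewrite /mn_cocycle /mn_conj /mn_twist -mn_epsD subrKC !mulrA.
  by rewrite (mulrK (mn_u_unit D _)).
rewrite (@convE _ _ _ _ _ s)//; last first.
  move=> p /mul_neq0[]; rewrite !u_mul_eq0 => xp yp; exact: sP.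
rewrite mulr_sumr -(eq_bigr _ (fun p _ => E p)) fsbig_seq//.
apply/esym/fsbig_widen => // p [_ /= ps].
apply/eqP/negPn/negP; rewrite E => /mul_neq0[_ /mul_neq0[]].
by rewrite !u_mul_eq0 => xp yp; apply: ps; exact: sP.
Qed.

Lemma twist_mul x y : well_ordered (fsupp x) -> well_ordered (fsupp y) ->
  mn_twist (mn_mul_coef x y) = conv (mn_twist x) (mn_twist y).
Proof.
move=> wx wy; apply/funext => c.
by rewrite /mn_twist mn_mul_coefE// mulVKr ?mn_u_unit.
Qed.

Lemma twist_inj x y : mn_twist x = mn_twist y -> x =1 y.
Proof.
move=> h c; have := congr1 (fun f => f c) h.
exact: (mulrI (mn_u_unit D _)).
Qed.

Definition mn_mul (x y : mn_ring D) : mn_ring D.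
Proof.
refine (@MNRing D (mn_mul_coef (mn_coef x) (mn_coef y)) _ _) => [c|].
  rewrite /mn_mul_coef; apply: memv_suml => p _.
  apply: centralizerM (mn_coefP _ _).
  by apply: centralizerM (mn_cocycle_cent _ _) (mn_conj_cent _ (mn_coefP _ _)).
rewrite -fsupp_twist twist_mul; try exact: mn_supp.
by apply: well_ordered_conv; rewrite fsupp_twist; exact: mn_supp.
Defined.

Definition mn_one : mn_ring D.
Proof.
refine (@MNRing D (fun c => (c == 0)%:R) _ _) => [c|].
  apply/centralizerP => x.
  by case: (c == 0); rewrite ?mul1r ?mulr1 ?mul0r ?mulr0.
apply: (well_ordered_sub _ (@well_ordered1 G 0)) => c; rewrite /fsupp /=.
by case: (c =P 0) => // _; rewrite eqxx.
Defined.

Let tw (x : mn_ring D) := mn_twist (mn_coef x).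

Let wo_tw x : well_ordered (fsupp (tw x)).
Proof. by rewrite fsupp_twist; exact: mn_supp. Qed.

Let tw_mul x y : tw (mn_mul x y) = conv (tw x) (tw y).
Proof. by rewrite /tw twist_mul//; exact: mn_supp. Qed.

Let tw_add x y : tw (mn_add x y) = fun c => tw x c + tw y c.
Proof. by apply/funext => c; rewrite /tw /mn_twist /= mulrDr. Qed.

Let tw_one : tw mn_one = fun c => (c == 0)%:R.
Proof.
apply/funext => c; rewrite /tw /mn_twist /=; case: eqP => [->|]; last by rewrite mulr0.
have -> : eps 0 = 1%g.
  by apply: (mulgI (eps 0)); rewrite -mn_epsD addr0 mulg1.
by rewrite mn_u1 mulr1.
Qed.

Let tw_inj x y : tw x = tw y -> x = y.
Proof. by move=> h; apply/mn_ringP/twist_inj. Qed.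

Lemma mn_mulA : associative mn_mul.
Proof.
move=> x y z; apply: tw_inj; rewrite !tw_mul; apply/funext => c.
by apply: convA.
Qed.

Lemma mn_mul1l : left_id mn_one mn_mul.
Proof.
by move=> x; apply: tw_inj; rewrite tw_mul tw_one; apply/funext/conv1l.
Qed.

Lemma mn_mul1r : right_id mn_one mn_mul.
Proof.
by move=> x; apply: tw_inj; rewrite tw_mul tw_one; apply/funext/conv1r.
Qed.

Lemma mn_mulDl : left_distributive mn_mul mn_add.
Proof.
move=> x y z; apply: tw_inj; rewrite tw_add !tw_mul tw_add.
by apply/funext/convDl.
Qed.

Lemma mn_mulDr : right_distributive mn_mul mn_add.
Proof.
move=> x y z; apply: tw_inj; rewrite tw_add !tw_mul tw_add.
by apply/funext/convDr.
Qed.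

Lemma mn_one_neq0 : mn_one != 0.
Proof.
apply/eqP => /(congr1 (fun x => mn_coef x 0)) /= /eqP.
by rewrite eqxx oner_eq0.
Qed.

HB.instance Definition _ := GRing.Zmodule_isNzRing.Build (mn_ring D)
  mn_mulA mn_mul1l mn_mul1r mn_mulDl mn_mulDr mn_one_neq0.

End MalcevNeumann.

Definition expgz (gT : finGroupType) (x : gT) (n : int) : gT :=
  match n with
  | Posz m => (x ^+ m)%g
  | Negz m => (x ^- m.+1)%g
  end.

Definition central_division_algebra (F : fieldType) (A : falgType F) : Prop :=
  (forall x : A, x != 0 -> x \is a GRing.unit) /\ 'Z({:A})%VS = 1%VS.

Definition has_degree (F : fieldType) (A : falgType F) (n : nat) : Prop :=
  \dim {:A} = (n ^ 2)%N.

Section CrossedProduct.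
Variable D : nzRingType.
Implicit Types (N : set D).

Definition ring_center : set D := [set z | forall x, z * x = x * z].

(* Subalgebras of D over its center. *)
Definition subalgebra N : Prop :=
  [/\ ring_center `<=` N,
      forall x y, N x -> N y -> N (x - y) &
      forall x y, N x -> N y -> N (x * y)].

Definition commutative_subalgebra N : Prop :=
  subalgebra N /\ forall x y, N x -> N y -> x * y = y * x.

Definition maximal_commutative_subalgebra N : Prop :=
  commutative_subalgebra N /\
  forall N', commutative_subalgebra N' -> N `<=` N' -> N' = N.

(* The center of D is the image of the field E, and the maximal commutative
   subalgebra is the image of the finite Galois extension L / E. *)
Definition crossed_product : Prop :=
  exists (E : fieldType) (L : splittingFieldType E) (j : {rmorphism L -> D}),
    [/\ range (fun c : E => j c%:A) = ring_center,
        galois 1%VS {:L} &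
        maximal_commutative_subalgebra (range j)].

End CrossedProduct.

(* Main.v *)
(* Let M/F be Galois of degree 8 with K <= M <= A, and let v be v_1 or v_2.  The
   extension of v to A is invariant under conjugation, so by Skolem-Noether it
   restricts to a Gal(M/F)-invariant valuation of M.  The inertia group I embeds
   in the units of the residue field, a Frobenius element raises I to the power
   q = 3 mod 4, and together they generate Gal(M/F).  As the two inertia fields
   of K differ, every element of Gal(M/F) outside Gal(M/K) squares to the
   nontrivial element of Gal(M/K): the group is quaternion.  By Witt, <a,b,ab>
   is then isometric to <1,1,1>.

   If D is a crossed product with maximal Galois subfield L, then [L : Z(D)] = 8,
   because D has dimension 64 over its center.  The least exponent of a series is
   a valuation on D and the residues of elements of L form a commutative
   subalgebra S of A, centralizing K and closed under conjugates over F.  If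
   S <= K, the absence of wild inertia in L / Z(D) makes the homomorphisms
   x |-> res (g x / x), for g in Gal(L / Z(D)), too numerous; otherwise the
   compositum SK is a Galois extension of F of degree 8 inside A containing K,
   which is excluded. *)

Require Import Defs.
From HB Require Import structures.
From mathcomp Require Import all_boot all_order all_algebra all_fingroup.
From mathcomp Require Import all_solvable all_field ring_quotient.
From mathcomp Require Import ring zify.
From mathcomp Require Import boolp classical_sets cardinality.

Set Implicit Arguments.
Unset Strict Implicit.
Unset Printing Implicit Defensive.

Import GRing.Theory Num.Theory.
Local Open Scope ring_scope.

(** * Ordered groups and valuations *)

(** Valuations take values in arbitrary ordered groups, so no uniformizer is given. The global
    hypothesis supplies one: value groups of valuations of Q and k(X) are cyclic by a Euclidean
    argument, and finite extensions keep them cyclic. With [x0] of generating value, inertia embeds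
    by s |-> res(s x0 / x0); the map is injective because 8 is a unit at a nondyadic valuation,
    which excludes wild inertia. The inertia field of K is given through some extension of v to K,
    perhaps not the one restricted from A; Galois invariance of the latter allows the two to be
    compared. The center of the Mal'cev-Neumann ring is an abstract field E, seen only through a
    ring morphism. Hence Skolem-Noether, linear algebra and dimension counts are set up for bare
    division rings, with A as another instance. If all residues lay in K, the image of the value
    group in Gal(K/F) would fix them, so its order times the dimension of the residue field would be
    at most [K : F] = 4. This leaves at most four coordinates for eight independent
    homomorphisms. *)

Section Oag.
Variable V : oag.
Implicit Types (x y : V) (g h k : option V).

Lemma vle_refl g : vle g g.
Proof. by case: g => //= x; apply: oag_refl. Qed.

Lemma vle_None g : vle g None.
Proof. by case: g. Qed.

Lemma vle_anti g h : vle g h -> vle h g -> g = h.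
Proof. by case: g h => [x|] [y|] //= h1 h2; rewrite (oag_anti h1 h2). Qed.

Lemma vle_total g h : vle g h || vle h g.
Proof. by case: g h => [x|] [y|] //=; apply: (go_total (oag_leP V)). Qed.

Lemma vltW g h : vlt g h -> vle g h.
Proof. by rewrite /vlt; have /orP[->|->] := vle_total g h. Qed.

Lemma vlt_irr g : vlt g g = false.
Proof. by rewrite /vlt vle_refl. Qed.

Lemma vlt_le_trans h g k : vlt g h -> vle h k -> vlt g k.
Proof. by move=> gh hk; apply: contra gh => kg; apply: vle_trans hk kg. Qed.

Lemma vleNlt g h : ~~ vle g h = vlt h g.
Proof. by []. Qed.

Lemma vleVlt g h : vle g h -> g = h \/ vlt g h.
Proof.
by rewrite /vlt => gh; have [hg|] := boolP (vle h g); [left; apply: vle_anti|right].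
Qed.

Lemma vaddA : associative (@vadd V).
Proof. by case=> [x|] [y|] [z|] //=; rewrite addrA. Qed.

Lemma vaddC : commutative (@vadd V).
Proof. by case=> [x|] [y|] //=; rewrite addrC. Qed.

Lemma vadd0 : left_id (Some 0) (@vadd V).
Proof. by case=> [x|] //=; rewrite add0r. Qed.

Lemma vadd_le g h g' h' : vle g h -> vle g' h' -> vle (vadd g g') (vadd h h').
Proof. by case: g h g' h' => [?|] [?|] [?|] [?|] //=; apply: oag_add. Qed.

Lemma vadd_lt x h g' h' :
  vle (Some x) h -> vlt g' h' -> vlt (vadd (Some x) g') (vadd h h').
Proof. by case: h g' h' => [?|] [?|] [?|] //=; rewrite /vlt /=; apply: oag_ltD. Qed.

Lemma oag_mulrn_ge0 x n : oag_le 0 x -> oag_le 0 (x *+ n).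
Proof.
move=> x0; elim: n => [|n IHn]; first exact: oag_refl.
by rewrite mulrS -[0]addr0; apply: oag_add.
Qed.

Lemma oag_mulrn_le x y n : oag_le x y -> oag_le (x *+ n) (y *+ n).
Proof.
move=> xy; elim: n => [|n IHn]; first exact: oag_refl.
by rewrite !mulrS; apply: oag_add.
Qed.

(** Up to sign [y >= 0], and then [y] is at most its own multiple [y *+ n.+1], which is 0. *)
Lemma oag_mulrn_eq0 x n : x *+ n.+1 = 0 -> x = 0.
Proof.
suff pos y : oag_le 0 y -> y *+ n.+1 = 0 -> y = 0.
  have /orP[/pos//|x0 xn] := go_total (oag_leP V) 0 x.
  apply: oppr_inj; rewrite oppr0; apply: pos; last by rewrite mulNrn xn oppr0.
  by apply: (@oag_cancel V x); rewrite addNr add0r.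
move=> y0; rewrite mulrS => yn; apply: oag_anti => //.
have := oag_add (oag_refl y) (oag_mulrn_ge0 n y0).
by rewrite yn addr0.
Qed.

Lemma oag_mulrz_inj (n : int) x y : n != 0 -> x *~ n = y *~ n -> x = y.
Proof.
move=> n0 /eqP; rewrite -subr_eq0 -mulrzBl => /eqP xy.
apply/eqP; rewrite -subr_eq0; apply/eqP.
case: n n0 xy => [[|n]|n] //= _.
  exact: oag_mulrn_eq0.
by rewrite NegzE mulrNz => /eqP; rewrite oppr_eq0 => /eqP/oag_mulrn_eq0.
Qed.

End Oag.

Section ValuationTheory.
Variables (R : nzRingType) (V : oag) (w : valuation R V).
Implicit Types (x y : R).

Lemma val_neq0 x : x != 0 -> exists g, w x = Some g.
Proof.
move=> x0; case wx: (w x) => [g|]; first by exists g.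
by have [/(_ wx)/eqP] := val_inf w x; rewrite (negPf x0).
Qed.

Lemma val_neq0E x g : w x = Some g -> x != 0.
Proof. by move=> wx; apply/eqP => x0; rewrite x0 val0 in wx. Qed.

Lemma vle_add (g : option V) x y : vle g (w x) -> vle g (w y) -> vle g (w (x + y)).
Proof. by move=> gx gy; apply: vle_trans (val_add w x y); apply: vle_min. Qed.

Lemma vlt_add (g : option V) x y : vlt g (w x) -> vlt g (w y) -> vlt g (w (x + y)).
Proof.
by move=> gx gy; apply: vlt_le_trans (val_add w x y); apply: vlt_min.
Qed.

Lemma vle_sub (g : option V) x y : vle g (w x) -> vle g (w y) -> vle g (w (x - y)).
Proof. by move=> gx gy; apply: vle_add => //; rewrite valN. Qed.

Lemma vlt_sub (g : option V) x y : vlt g (w x) -> vlt g (w y) -> vlt g (w (x - y)).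
Proof. by move=> gx gy; apply: vlt_add => //; rewrite valN. Qed.

Lemma vle_sum (I : Type) (r : seq I) (P : pred I) (F : I -> R) g :
  (forall i, P i -> vle g (w (F i))) -> vle g (w (\sum_(i <- r | P i) F i)).
Proof.
move=> gF; apply: (big_ind (fun x => vle g (w x))) => //.
  by rewrite val0 vle_None.
by move=> x y; apply: vle_add.
Qed.

Lemma vlt_sum (I : Type) (r : seq I) (P : pred I) (F : I -> R) (g : V) :
  (forall i, P i -> vlt (Some g) (w (F i))) ->
  vlt (Some g) (w (\sum_(i <- r | P i) F i)).
Proof.
move=> gF; apply: (big_ind (fun x => vlt (Some g) (w x))) => //.
  by rewrite val0.
by move=> x y; apply: vlt_add.
Qed.

Lemma val_near x y : vlt (w x) (w (y - x)) -> w y = w x.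
Proof.
move=> h; apply: vle_anti; last first.
  by rewrite -[y](subrK x); apply: vle_add (vltW h) (vle_refl _).
case: (boolP (vle (w y) (w x))) => // /(fun k => vlt_sub k h).
by rewrite opprB subrKC vlt_irr.
Qed.

Lemma valX_some x n g : w x = Some g -> w (x ^+ n) = Some (g *+ n).
Proof.
move=> wx; elim: n => [|n IHn]; first by rewrite expr0 Defs.val1.
by rewrite exprS val_mul IHn wx /= mulrS.
Qed.

Lemma val_nat n : vle (Some 0) (w n%:R).
Proof.
elim: n => [|n IHn]; first by rewrite val0.
by rewrite mulrS; apply: vle_add => //; rewrite Defs.val1 vle_refl.
Qed.

Lemma val_mulr_inj x y z : w z != None -> w (x * z) = w (y * z) -> w x = w y.
Proof.
rewrite !val_mul; case: (w z) => // c _.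
by case: (w x) (w y) => [a|] [b|] //= [/addIr->].
Qed.

(** Naturals have nonnegative value, so the factors of a unit are units. This carries the unit
    condition from the order of a group to the orders of its elements. *)
Lemma val_dvdn m n : (m %| n)%N -> w n%:R = Some 0 -> w m%:R = Some 0.
Proof.
move=> /dvdnP[k ->]; rewrite natrM val_mul => h.
have := val_nat k; have := val_nat m.
case: (w m%:R) (w k%:R) h => [a|] [b|] //= [ba0] a0 b0.
congr Some; apply: oag_anti => //.
by have := oag_add b0 (oag_refl a); rewrite ba0 add0r.
Qed.

End ValuationTheory.

Definition val_comp (R S : nzRingType) (V : oag) (f : {rmorphism R -> S})
    (f_inj : injective f) (w : valuation S V) : valuation R V.
Proof.
refine (@Valuation R V (fun x => w (f x)) _ _ _).
- move=> x; rewrite val_inf; split=> [|->]; last exact: rmorph0.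
  by rewrite -(rmorph0 f) => /f_inj.
- by move=> x y; rewrite rmorphD; apply: val_add.
- by move=> x y; rewrite rmorphM; apply: val_mul.
Defined.

Section FieldValuation.
Variables (F : fieldType) (V : oag) (w : valuation F V).
Implicit Types (x y : F).

Lemma valV x g : w x = Some g -> w x^-1 = Some (- g).
Proof.
move=> wx; have x0 := val_neq0E wx.
have := Defs.val1 w; rewrite -(mulVf x0) val_mul wx.
case: (w x^-1) => //= h [hg]; congr Some.
by apply/eqP; rewrite -subr_eq0 opprK hg.
Qed.

Lemma val_div x y g : w x = Some g -> w y = Some g -> w (x / y) = Some 0.
Proof. by move=> wx wy; rewrite val_mul wx (valV wy) /= subrr. Qed.

Lemma valXz x g (k : int) : w x = Some g -> w (x ^ k) = Some (g *~ k).
Proof.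
move=> wx; case: k => n /=; first by rewrite -exprnP (valX_some _ wx) pmulrn.
by rewrite NegzE -exprnN (valV (valX_some _ wx)) mulrNz.
Qed.

Lemma val_gt0V x : vlt (w x) (Some 0) -> vlt (Some 0) (w x^-1).
Proof.
case wx: (w x) => [g|] //; rewrite (valV wx) /vlt /= => h; apply: contra h => h.
by have := oag_add (oag_refl g) h; rewrite subrr addr0.
Qed.

End FieldValuation.

(** * Galois subfields of division rings *)

Section GaloisGroup.
Variables (E : fieldType) (L : splittingFieldType E).
Hypothesis galL : galois 1%VS {:L}.
Implicit Types (g h : gal_of {:L}) (x y : L).

Lemma galfT : 'Gal({:L} / 1%VS)%g = [set: gal_of {:L}]%g.
Proof. by apply/setP=> g; rewrite !inE gal_kHom ?sub1v// k1AHom. Qed.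

Lemma card_galf : #|{: gal_of {:L}}| = \dim {:L}.
Proof. by rewrite -cardsT -galfT -(galois_dim galL) dimv1 divn1. Qed.

Lemma galMf g h x : (g * h)%g x = h (g x).
Proof. by rewrite galM// memvf. Qed.

Lemma galfB g x y : g (x - y) = g x - g y.
Proof. exact: rmorphB. Qed.

Lemma galf_mul g x y : g (x * y) = g x * g y.
Proof. exact: rmorphM. Qed.

Lemma galf_inv g x : g x^-1 = (g x)^-1.
Proof. exact: fmorphV. Qed.

Lemma gal_scale g (c : E) : g c%:A = c%:A.
Proof. by rewrite linearZ rmorph1. Qed.

Lemma gal_invariant x : (forall g, g x = x) -> exists c : E, x = c%:A.
Proof.
move=> gx; suff /vlineP[c ->] : x \in 1%VS by exists c.
by rewrite -[1%VS](galois_fixedField galL); apply/fixedFieldP; rewrite ?memvf.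
Qed.

Definition galTr x := \sum_(g : gal_of {:L}) g x.

Lemma galTr_in x : exists c : E, galTr x = c%:A.
Proof.
apply: gal_invariant => g; rewrite /galTr raddf_sum /=.
rewrite [RHS](reindex_inj (@mulIg _ g)) /=.
by apply: eq_bigr => h _; rewrite galMf.
Qed.

Lemma galTr_neq0 : exists x, galTr x != 0.
Proof.
have [x _ x0] := @gal_independent_contra E L {:L} predT (fun=> 1) 1%g isT
  (oner_neq0 _).
exists x; apply: contra x0; rewrite (eq_bigr (fun g : gal_of {:L} => g x)) // => g _.
by rewrite mul1r.
Qed.

(* [a] and [b] are dual bases for the trace form. *)
Lemma galois_dual_bases : exists a b : 'I_(\dim {:L}) -> L,
  [/\ forall x, exists c : 'I_(\dim {:L}) -> E, x = \sum_i c i *: a i,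
      forall c : 'I_(\dim {:L}) -> E, \sum_i c i *: a i = 0 -> forall i, c i = 0,
      forall g h, \sum_i g (a i) * h (b i) = (g == h)%:R &
      forall x, exists c : 'I_(\dim {:L}) -> 'I_(\dim {:L}) -> E,
        (forall i, x * a i = \sum_k c i k *: a k) /\
        (forall k, x * b k = \sum_i c i k *: b i)].
Proof.
set n := \dim {:L}.
pose a (i : 'I_n) : L := tnth (vbasis {:L}) i.
have aS x : exists c : 'I_n -> E, x = \sum_i c i *: a i.
  exists (fun i => coord (vbasis {:L}) i x).
  rewrite [LHS](coord_vbasis (memvf x)). apply: eq_bigr => i _.
  by rewrite /a (tnth_nth 0).
have aF (c : 'I_n -> E) : \sum_i c i *: a i = 0 -> forall i, c i = 0.
  move=> c0; apply/freeP; first exact: basis_free (vbasisP _).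
  by rewrite -[RHS]c0; apply: eq_bigr => i _; rewrite /a (tnth_nth 0).
pose t x : E := sval (cid (galTr_in x)).
have tE x : galTr x = (t x)%:A by rewrite /t; case: cid.
have trD x y : galTr (x + y) = galTr x + galTr y.
  by rewrite -big_split; apply: eq_bigr => g _; rewrite rmorphD.
have trZ (c : E) x : galTr (c *: x) = c *: galTr x.
  by rewrite scaler_sumr; apply: eq_bigr => g _; rewrite linearZ.
have scI (c d : E) : c%:A = d%:A :> L -> c = d by apply: (fmorph_inj (in_alg L)).
have tsum (I : finType) (c : I -> E) (z : I -> L) :
    t (\sum_i c i *: z i) = \sum_i c i * t (z i).
  apply: scI; rewrite -tE scaler_suml.
  elim/big_rec2: _ => [|i u v _ IH].
    by rewrite /galTr big1// => g _; rewrite rmorph0.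
  by rewrite trD trZ tE IH scalerA.
pose T := \matrix_(i < n, k < n) t (a i * a k).
(* Nondegeneracy of the trace form: a kernel vector gives [y] with [t (y * z) = 0] for all [z], and
   for [y != 0] the products [y * z] include an element of nonzero trace. *)
have Tu : T \in unitmx.
  rewrite -row_free_unit; apply/row_freeP; apply: contrapT => nT.
  have : ~~ row_free T by apply/negP => /row_freeP.
  rewrite -kermx_eq0 => /rowV0Pn[v /sub_kermxP vT v0].
  pose y := \sum_i v 0 i *: a i.
  have ty k : t (y * a k) = 0.
    rewrite mulr_suml; under eq_bigr do rewrite -scalerAl.
    rewrite tsum; have := congr1 (fun M : 'M_(_, _) => M 0 k) vT.
    rewrite !mxE => vTk; by rewrite -[RHS]vTk; apply: eq_bigr => i _; rewrite mxE.
  have ty0 z : t (y * z) = 0.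
    have [c ->] := aS z; rewrite mulr_sumr.
    under eq_bigr do rewrite -scalerAr.
    by rewrite tsum big1// => l _; rewrite ty mulr0.
  have [y0|y0] := eqVneq y 0.
    case/negP: v0; apply/eqP/rowP => i; rewrite mxE; exact: aF y0 i.
  have [z] := galTr_neq0; rewrite tE -(mulVKf y0 z).
  by rewrite ty0 scale0r eqxx.
pose b (i : 'I_n) := \sum_k invmx T i k *: a k.
have tba i k : t (b i * a k) = (i == k)%:R.
  rewrite mulr_suml; under eq_bigr do rewrite -scalerAl.
  rewrite tsum; have := congr1 (fun M : 'M_(_, _) => M i k) (mulVmx Tu).
  by rewrite !mxE => Tik; rewrite -[RHS]Tik; apply: eq_bigr => l _; rewrite mxE.
have expa y : y = \sum_i t (y * b i) *: a i.
  have [c yE] := aS y; rewrite [LHS]yE; apply: eq_bigr => i _; congr (_ *: _).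
  rewrite yE mulr_suml; under eq_bigr do rewrite -scalerAl.
  rewrite tsum (bigD1 i)//=.
  rewrite [a i * _]mulrC tba eqxx mulr1 big1 ?addr0// => k ki.
  by rewrite [a k * _]mulrC tba eq_sym (negPf ki) mulr0.
(* Independence of automorphisms reduces the identity to its sum against [h y] over all [h], which
   is the expansion of [y] in the basis [a]. *)
have e1 h : \sum_i a i * h (b i) = (h == 1%g)%:R.
  apply/eqP; rewrite -subr_eq0; apply/eqP; move: h.
  suff H : forall x : gal_of {:L}, predT x ->
      (\sum_i a i * x (b i) - (x == 1%g)%:R) = 0 by move=> h; apply: H.
  apply: gal_independent => y _.
  under eq_bigr do rewrite mulrBl; rewrite sumrB.
  rewrite [X in _ - X](bigD1 1%g)//= eqxx mul1r gal_id [X in _ - (_ + X)]big1 ?addr0; last first.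
    by move=> g g1; rewrite (negPf g1) mul0r.
  apply/eqP; rewrite subr_eq0; apply/eqP; rewrite [RHS]expa.
  under eq_bigr do rewrite mulr_suml.
  rewrite exchange_big /=; apply: eq_bigr => i _.
  rewrite -[_ *: a i]mulr_algl -tE mulr_suml; apply: eq_bigr => g _.
  by rewrite rmorphM /=; ring.
have egh g h : \sum_i g (a i) * h (b i) = (g == h)%:R.
  have := e1 (h * g^-1)%g; move=> /(congr1 g); rewrite raddf_sum /=.
  rewrite rmorph_nat -eq_mulgV1 eq_sym => <-.
  apply: eq_bigr => i _; rewrite rmorphM /=; congr (_ * _).
  by have := galMf (h * g^-1)%g g (b i); rewrite -mulgA mulVg mulg1 => ->.
exists a, b; split=> // x.
exists (fun i k => t (x * a i * b k)); split=> [i|k]; first exact: expa.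
under eq_bigr do rewrite -[_ *: b _]mulr_algl -tE mulr_suml.
rewrite exchange_big /= (bigD1 1%g)//= [X in _ + X]big1 ?addr0; last first.
  move=> g g1; transitivity (g (x * b k) * \sum_i g (a i) * (1%g : gal_of {:L}) (b i)).
    by rewrite mulr_sumr; apply: eq_bigr => i _; rewrite gal_id !rmorphM; ring.
  by rewrite egh (negPf g1) mulr0.
transitivity (x * b k * \sum_i (1%g : gal_of {:L}) (a i) * (1%g : gal_of {:L}) (b i)).
  by rewrite egh eqxx mulr1.
by rewrite mulr_sumr; apply: eq_bigr => i _; rewrite !gal_id; ring.
Qed.

End GaloisGroup.

Definition division_ring (D : nzRingType) :=
  forall x : D, x != 0 -> exists y, x * y = 1 /\ y * x = 1.

Lemma division_mul_eq0 (D : nzRingType) (x y : D) :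
  division_ring D -> x * y = 0 -> x = 0 \/ y = 0.
Proof.
move=> Ddiv xy; have [->|/Ddiv[z [_ zx]]] := eqVneq x 0; first by left.
by right; rewrite -[y]mul1r -zx -mulrA xy mulr0.
Qed.

(* The tensor product of a central division ring D and its opposite acts
   faithfully on D. *)
Lemma central_mul_indep (D : nzRingType) (E : fieldType)
    (f : {rmorphism E -> D}) (n : nat) (a d : 'I_n -> D) :
  division_ring D ->
  (forall z : D, (forall x, z * x = x * z) -> exists c, z = f c) ->
  (forall c : 'I_n -> E, \sum_i a i * f (c i) = 0 -> forall i, c i = 0) ->
  (forall c, \sum_i a i * c * d i = 0) -> forall i, d i = 0.
Proof.
move=> Ddiv Dcen aF.
have [m] := ubnP #|[pred i | d i != 0]|; elim: m d => // m IHm d dm dE i.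
apply/eqP/negPn/negP => di0.
have [v [div vdi]] := Ddiv _ di0.
have dvE c : \sum_i a i * c * (d i * v) = 0.
  by under eq_bigr do rewrite mulrA; rewrite -mulr_suml dE mul0r.
(* After [d i] is scaled to 1, the commutators with [e] satisfy the same identity but vanish at [i],
   so induction on the support kills them. All [d k * v] are then central, and the identity at
   [c = 1] contradicts the independence of [a]. *)
have cen e k : d k * v * e - e * (d k * v) = 0.
  move: k; apply: IHm => [|c].
    rewrite -ltnS (leq_trans _ dm)// ltnS; apply/proper_card/properP; split.
      apply/fintype.subsetP => k; rewrite !inE; apply: contra => /eqP->.
      by rewrite !(mul0r, mulr0) subrr.
    by exists i; rewrite !inE ?di0// div mul1r mulr1 subrr eqxx.
  under eq_bigr do rewrite mulrBr.
  rewrite sumrB; under eq_bigr do rewrite mulrA.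
  rewrite -mulr_suml dvE mul0r sub0r; apply/eqP; rewrite oppr_eq0; apply/eqP.
  by rewrite -[RHS](dvE (c * e)); apply: eq_bigr => k _; rewrite !mulrA.
have /choice[c cE] : forall k, exists ck, d k * v = f ck.
  by move=> k; apply: Dcen => x; apply/eqP; rewrite -subr_eq0 cen.
have c0 := aF c _ i; have {c0} : c i = 0.
  by apply: c0; rewrite -[RHS](dvE 1); apply: eq_bigr => k _; rewrite cE mulr1.
move=> ci; have := cE i; rewrite div ci rmorph0 => /eqP.
by rewrite oner_eq0.
Qed.

Section RingDecomposition.
Variables (E : fieldType) (L : splittingFieldType E).
Hypothesis galL : galois 1%VS {:L}.
Variables (D : nzRingType) (j : {rmorphism L -> D}).
Hypothesis jE : forall (c : E) d, j c%:A * d = d * j c%:A.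
Implicit Types (g h : gal_of {:L}) (x y : L) (d : D).

(** For invertible [d], conjugation by [d] induces [g] on the image of [L]. Written without
    inverses, the condition defines an additive subgroup for each [g], and [D] decomposes into
    these. *)
Definition eigen g d := forall x, j x * d = d * j (g x).

(* With dual bases a, b, the projections are d |-> sum_i a_i d g(b_i). *)
Lemma galois_eigenprojections : exists (a : 'I_(\dim {:L}) -> L)
    (P : gal_of {:L} -> D -> D),
  [/\ forall g d, eigen g (P g d),
      forall d, d = \sum_g P g d,
      forall g h d, eigen h d -> P g d = if g == h then d else 0,
      forall g, {morph P g : d d' / d + d'} &
      forall g, division_ring D ->
        (forall z : D, (forall d, z * d = d * z) -> exists c : E, z = j c%:A) ->
        exists d, P g d != 0].
Proof.
have [a [b [aS aF ab aB]]] := galois_dual_bases galL.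
exists a, (fun g d => \sum_i j (a i) * d * j (g (b i))); split.
- move=> g d x; have [c [ca cb]] := aB x.
  rewrite mulr_sumr mulr_suml.
  transitivity (\sum_i \sum_k j (c i k)%:A * (j (a k) * d * j (g (b i)))).
    apply: eq_bigr => i _; rewrite !mulrA -rmorphM ca rmorph_sum !mulr_suml.
    by apply: eq_bigr => k _; rewrite -[_ *: a k]mulr_algl rmorphM !mulrA.
  rewrite exchange_big; apply: eq_bigr => k _ /=.
  rewrite -[RHS]mulrA -rmorphM -rmorphM [b k * _]mulrC cb !rmorph_sum mulr_sumr.
  apply: eq_bigr => i _.
  rewrite jE -mulrA -rmorphM mulr_algr; congr (_ * j _).
  by rewrite -[RHS]/(g (c i k *: b i)) linearZ.
- move=> d; rewrite exchange_big /=.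
  transitivity (\sum_i j (a i) * d * j (galTr (b i))).
    have one : \sum_i j (a i) * j (galTr (b i)) = 1.
      rewrite -(rmorph1 j); under eq_bigr do rewrite -rmorphM.
      rewrite -rmorph_sum; congr (j _).
      under eq_bigr do rewrite mulr_sumr; rewrite exchange_big /=.
      rewrite (bigD1 1%g)//= [X in _ + X]big1 ?addr0.
        transitivity (((1%g : gal_of {:L}) == 1%g)%:R : L); last by rewrite eqxx.
        by rewrite -ab; apply: eq_bigr => i _; rewrite !gal_id.
      move=> g g1; transitivity (((1%g : gal_of {:L}) == g)%:R : L).
        by rewrite -ab; apply: eq_bigr => i _; rewrite gal_id.
      by rewrite eq_sym (negPf g1).
    rewrite -[LHS]mul1r -one mulr_suml; apply: eq_bigr => i _.
    by have [c ->] := galTr_in galL (b i); rewrite -mulrA jE mulrA.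
  by apply: eq_bigr => i _; rewrite rmorph_sum mulr_sumr.
- move=> g h d hd; under eq_bigr do rewrite hd -mulrA -rmorphM.
  rewrite -mulr_sumr -rmorph_sum ab [g == h]eq_sym.
  by case: eqP; rewrite ?rmorph1 ?mulr1// rmorph0 mulr0.
- move=> g d d'; rewrite -big_split; apply: eq_bigr => i _.
  by rewrite mulrDr mulrDl.
(* If [P g] were zero, faithfulness would kill every [g (b i)], against
   [\sum_i g (a i) * g (b i) = 1]. *)
move=> g Ddiv Dcen; apply: contrapT => /forallNP P0.
have P0' d : \sum_i j (a i) * d * j (g (b i)) = 0.
  by apply/eqP/negPn/negP => /P0.
have gb0 i : j (g (b i)) = 0.
  apply: (@central_mul_indep D E (j \o in_alg L) _ (j \o a) (fun i => j (g (b i)))) => //= c.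
  rewrite -[RHS](rmorph0 j) => cE; apply: aF; apply: (fmorph_inj j).
  rewrite -[RHS]cE rmorph_sum; apply: eq_bigr => k _.
  by rewrite -[_ *: a k]mulr_algl rmorphM jE.
have := ab 1%g g; rewrite big1 => [|i _]; last first.
  by have /eqP := gb0 i; rewrite fmorph_eq0 => /eqP->; rewrite mulr0.
have := ab g g; rewrite big1 => [|i _]; last first.
  by have /eqP := gb0 i; rewrite fmorph_eq0 => /eqP->; rewrite mulr0.
by rewrite eqxx => /esym/eqP; rewrite oner_eq0.
Qed.

(** Any nonzero value of the projection [P g] will do. A bare division ring [D] covers both [A] over
    [F] and the Mal'cev-Neumann ring over its own center. *)
Lemma skolem_noether :
  division_ring D ->
  (forall z : D, (forall d, z * d = d * z) -> exists c : E, z = j c%:A) ->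
  forall g, exists2 u, u != 0 & eigen g u.
Proof.
move=> Ddiv Dcen g; have [a [P [Pe _ _ _ Pn]]] := galois_eigenprojections.
by have [d d0] := Pn g Ddiv Dcen; exists (P g d).
Qed.

Lemma eigen_independent (d : gal_of {:L} -> D) :
  (forall g, eigen g (d g)) -> \sum_g d g = 0 -> forall g, d g = 0.
Proof.
move=> de d0 g; have [a [P [_ _ Pp PD _]]] := galois_eigenprojections.
have P0 : P g 0 = 0 by apply: (addIr (P g 0)); rewrite -PD !add0r.
have : P g (\sum_h d h) = 0 by rewrite d0.
rewrite (big_morph (P g) (PD g) P0) (bigD1 g)//= (Pp _ _ _ (de g)) eqxx.
rewrite big1 ?addr0// => h hg.
by rewrite (Pp _ _ _ (de h)) eq_sym (negPf hg).
Qed.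

End RingDecomposition.

(* By Skolem-Noether g is induced by a conjugation of D, and conjugations
   preserve w because its value group is commutative. *)
Lemma galois_invariant_val (E : fieldType) (L : splittingFieldType E)
    (D : nzRingType) (j : {rmorphism L -> D}) (V : oag) (w : valuation D V) :
  galois 1%VS {:L} -> division_ring D ->
  (forall (c : E) d, j c%:A * d = d * j c%:A) ->
  (forall z : D, (forall d, z * d = d * z) -> exists c : E, z = j c%:A) ->
  forall (g : gal_of {:L}) x, w (j (g x)) = w (j x).
Proof.
move=> galL Ddiv jE Dcen g x; have [u u0 ue] := skolem_noether galL jE Ddiv Dcen g.
have [c uc] := val_neq0 w u0.
apply: (@val_mulr_inj _ _ w _ _ u); first by rewrite uc.
by rewrite (ue x) !val_mul vaddC.
Qed.

(** * Valuations of Galois extensions of global fields *)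

Lemma exists_vmin (V : oag) (I : finType) (P : pred I) (f : I -> option V) i0 :
  P i0 -> exists2 i, P i & forall k, P k -> vle (f i) (f k).
Proof.
move=> Pi0.
have tr : transitive (@vle V) by move=> h g k; apply: vle_trans.
have [i Pi iP] := extremumP f (@vle_refl V) tr (@vle_total V) Pi0.
by exists i.
Qed.

(** * Cyclic value groups under finite extensions *)

Section CyclicValueGroup.
Variable V : oag.

(** The least value of a nonzero term must be attained twice: a single such term would dominate the
    others and the sum could not vanish. *)
Lemma val_sum_tie (R : nzRingType) (w : valuation R V) (I : finType)
    (f : I -> R) i0 : \sum_i f i = 0 -> f i0 != 0 ->
  exists i k, [/\ i != k, f i != 0, f k != 0 & w (f i) = w (f k)].
Proof.
move=> f0 fi0.
have [i fi iP] := exists_vmin (P := fun i => f i != 0) (w \o f) fi0.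
have [g wi] := val_neq0 w fi.
apply: contrapT => /forallNP /(_ i) /forallNP nk.
have : vlt (Some g) (w (\sum_(k | k != i) f k)).
  apply: vlt_sum => k ki; have [->|fk] := eqVneq (f k) 0; first by rewrite val0.
  have /vleVlt[e|] := iP k fk; last by rewrite /= wi.
  by case: (nk k); split=> //; rewrite eq_sym.
move: f0; rewrite (bigD1 i)//= => /eqP; rewrite addr_eq0 => /eqP fiE.
by rewrite -wi fiE valN vlt_irr.
Qed.

Definition cyclic_val (F : fieldType) (w : valuation F V) : Prop :=
  exists g x0, w x0 = Some g /\ forall x, x != 0 -> exists k : int, w x = Some (g *~ k).

(** Two terms of equal value in the minimal polynomial of [x], of degrees [i < k], put [k - i] times
    the value of [x] among the multiples of [g]. *)
Lemma power_val_ext (E : fieldType) (L : fieldExtType E) (w : valuation L V) g :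
  (forall c : E, c != 0 -> exists k : int, w c%:A = Some (g *~ k)) ->
  forall x : L, x != 0 ->
  exists (m : nat) (k : int), (0 < m <= \dim {:L})%N /\ w (x ^+ m) = Some (g *~ k).
Proof.
move=> gE x x0; pose p := minPoly 1%VS x.
have ps : ((size p).-1 <= \dim {:L})%N.
  by rewrite size_minPoly /= adjoin_degreeE dimv1 divn1 dimvS// subvf.
have p0 : \sum_(i < size p) p`_i * x ^+ i = 0.
  by have /rootP := root_minPoly 1%VS x; rewrite horner_coef.
have pc i : p`_i != 0 -> exists k : int, w p`_i = Some (g *~ k).
  move=> pi0; have /vlineP[c cE] : p`_i \in 1%VS.
    by apply/polyOverP/minPolyOver.
  rewrite cE; apply: gE; apply: contra pi0 => /eqP c0.
  by rewrite cE c0 scale0r.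
have sp : (0 < size p)%N by rewrite size_minPoly.
have lead0 : p`_(size p).-1 * x ^+ (size p).-1 != 0.
  by rewrite mulf_neq0 ?expf_neq0// -lead_coefE (monicP (monic_minPoly _ _)) oner_neq0.
have ltp : ((size p).-1 < size p)%N by rewrite prednK.
have [i [k [ik fi fk wik]]] := val_sum_tie w (i0 := Ordinal ltp) p0 lead0.
wlog lik : i k ik fi fk wik / (i < k)%N.
  move=> H; have [|ki|/val_inj ie] := ltngtP i k; first exact: H.
    by apply: (H k i); rewrite // eq_sym.
  by rewrite ie eqxx in ik.
have [pi0 pk0] : p`_i != 0 /\ p`_k != 0.
  by split; [apply: contra fi|apply: contra fk] => /eqP->; rewrite mul0r.
have [[a wa] [b wb]] := (pc _ pi0, pc _ pk0).
have [h wx] := val_neq0 w x0.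
exists (k - i)%N, (a - b); split.
  rewrite subn_gt0 lik /= (leq_trans _ ps)//.
  by rewrite (leq_trans (leq_subr _ _))// -ltnS prednK// ltn_ord.
move: wik; rewrite !val_mul wa wb !(valX_some _ wx) /= => -[].
rewrite -[in h *+ k](subnK (ltnW lik)) mulrnDr addrA => /addIr e.
by congr Some; rewrite mulrzBr e addrAC subrr add0r.
Qed.

(** Multiplication by the factorial [M] of the degree is injective and sends all values to multiples
    of [g], by [power_val_ext]. A generator is found as for subgroups of the integers, from the
    least positive exponent. *)
Lemma cyclic_val_ext (E : fieldType) (L : fieldExtType E) (w : valuation L V) g :
  (forall c : E, c != 0 -> exists k : int, w c%:A = Some (g *~ k)) -> cyclic_val w.
Proof.
move=> gE; pose M := (\dim {:L})`!.
have M0 : (M%:Z != 0) by rewrite -lt0n fact_gt0.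
have wM x : x != 0 -> exists k : int, w (x ^+ M) = Some (g *~ k).
  move=> x0; have [m [k [/andP[m0 mn] wk]]] := power_val_ext gE x0.
  have /dvdnP[q ->] : (m %| M)%N by apply: dvdn_fact; rewrite m0.
  exists (k * q%:Z); rewrite mulnC exprM (valX_some _ wk).
  by rewrite mulrzA -pmulrn.
have wMx x h k : w x = Some h -> w (x ^+ M) = Some k -> k = h *~ M.
  by move=> wx; rewrite (valX_some _ wx) => -[<-]; rewrite pmulrn.
pose Q := [pred d : nat | (0 < d)%N && `[< exists2 x, x != 0 & w (x ^+ M) = Some (g *~ d) >]].
have [exQ|nQ] := pselect (exists d, Q d); last first.
  (* Without a positive exponent there is no negative one either, by taking inverses; so [w] is
     trivial and 0 generates. *)
  exists 0, 1; split; first exact: Defs.val1.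
  move=> x x0; exists 0; have [h wx] := val_neq0 w x0.
  rewrite wx mulr0z; congr Some; have [k wk] := wM x x0.
  suff k0 : k = 0.
    have := wMx _ _ _ wx wk; rewrite k0 mulr0z => /esym hM.
    by apply: (oag_mulrz_inj M0); rewrite hM mul0rz.
  case: k wk => [[|k]|k] // wk; case: nQ.
    by exists k.+1; rewrite /Q /=; apply/asboolP; exists x.
  exists k.+1; rewrite /Q /=; apply/asboolP; exists x^-1; first by rewrite invr_eq0.
  by rewrite exprVn (valV wk) NegzE mulrNz opprK.
have [d /= /andP[d0 /asboolP[y y0 wy]] dmin] := ex_minnP exQ.
have [h wyh] := val_neq0 w y0.
exists h, y; split=> // x x0; have [k wk] := wM x x0.
exists (k %/ d)%Z; have [l wx] := val_neq0 w x0; rewrite wx; congr Some.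
have := divz_eq k d; set q := (k %/ d)%Z; set r := (k %% d)%Z => kE.
have r0 : 0 <= r by rewrite modz_ge0//; case: (d) d0.
have rd : r < d by rewrite ltz_pmod.
have xy0 : x * y ^ (- q) != 0 by rewrite mulf_neq0// expfz_neq0.
have wr : w ((x * y ^ (- q)) ^+ M) = Some (g *~ r).
  rewrite exprMn val_mul wk.
  have -> : (y ^ (- q)) ^+ M = (y ^+ M) ^ (- q).
    by rewrite -[LHS]/((y ^ (- q)) ^ M%:Z) -[y ^+ M]/(y ^ M%:Z) !exprz_exp mulrC.
  rewrite (valXz _ wy) /=; congr Some.
  by rewrite -mulrzA -mulrzDr kE; congr (_ *~ _); lia.
have rz : r = 0.
  case: (r) r0 rd wr => [[|r']|] // _ rd wr.
  have : Q r'.+1 by apply/asboolP; exists (x * y ^ (- q)).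
  by move=> /dmin; rewrite leqNgt -ltz_nat rd.
apply: (oag_mulrz_inj M0); rewrite -(wMx _ _ _ wx wk).
by rewrite kE rz addr0 mulrC mulrzA (wMx _ _ _ wyh wy) -!mulrzA mulrC.
Qed.

End CyclicValueGroup.

(** * Valuations of the rationals and of rational function fields *)

Section EuclideanValuation.
Variables (R : idomainType) (F : fieldType) (f : {rmorphism R -> F}) (V : oag).
Variables (w : valuation F V) (nrm : R -> nat).
Hypothesis f_inj : injective f.
Hypothesis f_frac : forall x, exists a b, b != 0 /\ x = f a / f b.
Hypothesis w_ge0 : forall a, vle (Some 0) (w (f a)).
Hypothesis euclid : forall p x, p != 0 ->
  exists q r, x = q * p + r /\ (r = 0 \/ (nrm r < nrm p)%N).
Hypothesis nrm_mul : forall p q, vlt (Some 0) (w (f p)) -> p != 0 -> q != 0 ->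
  (nrm q < nrm (q * p))%N.

(** The generator is the value of an element [p] of least norm among those of positive value. In a
    division by [p], a nonzero remainder has value 0, and so has the dividend; if the remainder is
    zero, the quotient has smaller norm and the induction applies. *)
Lemma euclid_cyclic : exists g, forall x, x != 0 -> exists k : int, w x = Some (g *~ k).
Proof.
suff [g gP] : exists g, forall a, a != 0 -> exists k : int, w (f a) = Some (g *~ k).
  exists g => x x0; have [a [b [b0 xE]]] := f_frac x.
  have a0 : a != 0.
    by apply: contra x0 => /eqP a0; rewrite xE a0 rmorph0 mul0r.
  have [[k wa] [l wb]] := (gP _ a0, gP _ b0).
  by exists (k - l); rewrite xE val_mul wa (valV wb) /= mulrzBr.
pose Q := [pred n : nat | `[< exists p, [/\ p != 0, vlt (Some 0) (w (f p)) & nrm p = n] >]].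
have [exQ|nQ] := pselect (exists n, Q n); last first.
  exists 0 => a a0; exists 0.
  have [/esym|gt0] := vleVlt (w_ge0 a); first by rewrite mul0rz.
  by case: nQ; exists (nrm a); apply/asboolP; exists a.
have [_ /asboolP[p [p0 wp <-]] pmin] := ex_minnP exQ.
have [g wpg] : exists g, w (f p) = Some g.
  by apply: val_neq0; rewrite (raddf_eq0 _ f_inj).
exists g => a; have [m] := ubnP (nrm a); elim: m a => // m IHm a am a0.
have [q [r [aE rp]]] := euclid a p0.
have [r0|r0] := eqVneq r 0.
  have q0 : q != 0 by apply: contra a0 => /eqP q0; rewrite aE q0 r0 mul0r addr0.
  have qa : (nrm q < nrm a)%N by rewrite aE r0 addr0 nrm_mul.
  have [k wq] := IHm q (leq_trans qa am) q0.
  exists (k + 1); rewrite aE r0 addr0 rmorphM val_mul wq wpg /=.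
  by rewrite mulrzDr mulr1z.
exists 0; rewrite mulr0z.
have [/eqP|{}rp] := rp; first by rewrite (negPf r0).
have wr : w (f r) = Some 0.
  have [//|gt0] := vleVlt (w_ge0 r).
  have : (nrm p <= nrm r)%N by apply: pmin; apply/asboolP; exists r.
  by rewrite leqNgt rp.
rewrite -wr; apply: val_near; rewrite wr aE rmorphD addrK rmorphM val_mul.
by rewrite -[Some 0](vadd0 (Some 0)); apply: vadd_lt.
Qed.

End EuclideanValuation.

Lemma rat_cyclic (V : oag) (w : valuation rat V) :
  exists g, forall x, x != 0 -> exists k : int, w x = Some (g *~ k).
Proof.
apply: (@euclid_cyclic int rat (@intmul rat 1) V w absz).
- by move=> x y /eqP; rewrite eqr_int => /eqP.
- move=> x; exists (numq x), (denq x); split; first exact: denq_neq0.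
  by rewrite divq_num_den.
- move=> [n|n]; first exact: (val_nat w n).
  by have := val_nat w n.+1; rewrite -valN.
- move=> p x p0; exists (x %/ p)%Z, (x %% p)%Z; split; first exact: divz_eq.
  right; rewrite -ltz_nat abszE ger0_norm ?modz_ge0//.
  exact: ltz_mod.
move=> p q wp p0 q0; rewrite abszM -[X in (X < _)%N]muln1 ltn_pmul2l ?absz_gt0//.
rewrite ltn_neqAle absz_gt0 p0 andbT; apply/eqP => /esym p1; move: wp.
have /orP[/eqP->|/eqP->] : (p == 1) || (p == -1) by lia.
  by rewrite Defs.val1 vlt_irr.
by have := Defs.valN1 w => wN1; rewrite -[X in w X]/(-1 : rat) wN1 vlt_irr.
Qed.

Lemma fraction_frac (R : idomainType) (x : {fraction R}) :
  exists a b : R, b != 0 /\ x = tofrac a / tofrac b.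
Proof.
elim/quotW: x => r; exists (frac r).1, (frac r).2.
split; first exact: denom_ratioP.
apply: (canRL (mulfK _)); first by rewrite tofrac_eq0 denom_ratioP.
rewrite !piE /=; apply/eqmodP.
rewrite /= FracField.equivfE /FracField.mulf !numden_Ratio ?mulr1 ?oner_neq0 ?denom_ratioP//.
by rewrite mulrC.
Qed.

(** From [c ^+ #|k| = c], the value is killed by [#|k| - 1], and value groups are torsion-free. *)
Lemma finite_unit_val (k : finFieldType) (R : nzRingType) (f : {rmorphism k -> R})
    (V : oag) (w : valuation R V) (c : k) : c != 0 -> w (f c) = Some 0.
Proof.
move=> c0; have ck : c ^+ #|k| = c by apply: expf_card.
have [g wg] : exists g, w (f c) = Some g.
  by apply: val_neq0; rewrite fmorph_eq0.
have := valX_some #|k| wg; rewrite -rmorphXn ck wg => -[].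
have := finNzRing_gt1 k; case: #|k| => [|[|n]] // _.
rewrite mulrS => /eqP; rewrite addrC -subr_eq0 opprD addrA addrAC subrr add0r oppr_eq0.
by move=> /eqP/oag_mulrn_eq0->.
Qed.

(** If ['X] has nonnegative value, so have all polynomials, and Euclidean division applies.
    Otherwise the leading term dominates and a polynomial has the value of ['X] times its degree. *)
Lemma fracpoly_cyclic (k : finFieldType) (V : oag)
    (w : valuation {fraction {poly k}} V) :
  exists g, forall x, x != 0 -> exists k : int, w x = Some (g *~ k).
Proof.
pose f : {rmorphism {poly k} -> {fraction {poly k}}} := @tofrac {poly k}.
have fI : injective f by move=> x y /eqP; rewrite tofrac_eq => /eqP.
have wc c : c != 0 -> w (f c%:P) = Some 0.
  by move=> c0; apply: (finite_unit_val (f \o polyC)).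
have wc0 c : vle (Some 0) (w (f c%:P)).
  by have [->|/wc->] := eqVneq c 0; rewrite ?rmorph0 ?val0// vle_refl.
have [g wX] : exists g, w (f 'X) = Some g.
  by apply: val_neq0; rewrite tofrac_eq0 polyX_eq0.
have [X0|Xneg] := boolP (vle (Some 0) (w (f 'X))).
  have wge0 a : vle (Some 0) (w (f a)).
    elim/poly_ind: a => [|p c IHp]; first by rewrite rmorph0 val0.
    rewrite rmorphD; apply: vle_add => //.
    by rewrite rmorphM val_mul -[Some 0](vadd0 (Some 0)); apply: vadd_le.
  apply: (@euclid_cyclic {poly k} _ f V w (fun p => size p)) => //.
  - exact: fraction_frac.
  - move=> p x p0; exists (x %/ p), (x %% p); split; first exact: divp_eq.
    by right; rewrite ltn_modp.
  move=> p q wp p0 q0; rewrite size_mul//.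
  have : (1 < size p)%N.
    rewrite ltnNge; apply/negP => /size1_polyC pE.
    have c0 : p`_0 != 0 by apply: contra p0 => /eqP c0; rewrite pE c0.
    by rewrite pE wc// vlt_irr in wp.
  by case: (size p) => [|[|n]] // _; rewrite addnS /= addnS ltnS leq_addr.
have gneg n : vlt (Some (g *+ n.+1)) (Some 0).
  rewrite wX in Xneg; elim: n => // n IHn; rewrite mulrS.
  rewrite -[Some 0](vadd0 (Some 0)) -[Some (_ + _)]/(vadd (Some g) (Some _)).
  by apply: vadd_lt => //; apply: vltW.
have wp p : p != 0 -> w (f p) = Some (g *+ (size p).-1).
  elim/poly_ind: p => [|p c IHp]; first by rewrite eqxx.
  have [->|p0 _] := eqVneq p 0.
    rewrite mul0r add0r polyC_eq0 => c0.
    by rewrite wc// size_polyC c0 mulr0n.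
  have wpX : w (f (p * 'X)) = Some (g *+ size p).
    rewrite rmorphM val_mul IHp// wX /= -mulrSr prednK//.
    by rewrite size_poly_gt0.
  rewrite size_MXaddC (negPf p0) /= -wpX; apply: val_near.
  rewrite wpX rmorphD addrAC subrr add0r.
  apply: vlt_le_trans (wc0 c); move: p0; rewrite -size_poly_gt0.
  by case: (size p) => // n _; apply: gneg.
exists g => x x0; have [a [b [b0 xE]]] := fraction_frac x.
have a0 : a != 0.
  by apply: contra x0 => /eqP a0; rewrite xE a0 tofrac0 mul0r.
exists ((size a).-1%:Z - (size b).-1%:Z).
by rewrite xE val_mul wp// (valV (wp _ b0)) /= mulrzBr -!pmulrn.
Qed.

Lemma global_cyclic (F : fieldType) (V : oag) (v : valuation F V) :
  global_field F -> cyclic_val v.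
Proof.
suff H (F0 : fieldType) (L : fieldExtType F0) (f : {rmorphism L -> F}) :
    (forall w : valuation F0 V,
       exists g, forall x, x != 0 -> exists k : int, w x = Some (g *~ k)) ->
    bijective f -> cyclic_val v.
  case=> [[L [f bf]]|[k [L [f bf]]]].
    exact: H (@rat_cyclic V) bf.
  exact: H (@fracpoly_cyclic k V) bf.
move=> cyc0 [f' fK f'K].
pose w := val_comp (can_inj fK) v.
pose w0 := val_comp (fmorph_inj (in_alg L)) w.
have [g gP] := cyc0 w0.
have [h [x0 [wx0 wP]]] := cyclic_val_ext (w := w) gP.
exists h, (f x0); split=> // x x0'.
have [|n wn] := wP (f' x); last by exists n; rewrite -wn /= f'K.
by apply: contra x0' => /eqP fx; rewrite -(f'K x) fx rmorph0.
Qed.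

(** * Galois-invariant valuations: tameness and uniqueness *)

Section InvariantValuation.
Variables (E : fieldType) (L : splittingFieldType E) (V : oag).
Hypothesis galL : galois 1%VS {:L}.
Variable w : valuation L V.
Hypothesis w_gal : forall (g : gal_of {:L}) x, w (g x) = w x.
Hypothesis w_card : w #|{: gal_of {:L}}|%:R = Some 0.

(** The element [y = x - h x] has trace zero along the powers of [h], so [m y] is minus the sum of
    the differences [(h ^+ i) y - y], all of larger value than [y]. As the order [m] is a unit, [y]
    must be 0. *)
Lemma no_wild_inertia (h : gal_of {:L}) :
  (forall x, x != 0 -> vlt (w x) (w (h x - x))) -> h = 1%g.
Proof.
move=> hw; have hiw i x : x != 0 -> vlt (w x) (w ((h ^+ i)%g x - x)).
  move=> x0; elim: i => [|i IHi].
    by rewrite expg0 gal_id subrr val0; have [c ->] := val_neq0 w x0.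
  rewrite expgSr galMf -[_ - x](subrKA (h x)) -rmorphB.
  by apply: vlt_add; [rewrite w_gal | apply: hw].
pose m := #[h]%g; have wm : w m%:R = Some 0.
  by apply: val_dvdn w_card; rewrite -cardsT order_dvdG ?inE.
have m0 : m%:R != 0 :> L by apply: val_neq0E wm.
have hm x : \sum_(i < m) (h ^+ i)%g (h x) = \sum_(i < m) (h ^+ i)%g x.
  under eq_bigr do rewrite -galMf -expgS.
  have [k mk] : exists k, m = k.+1 by exists m.-1; rewrite prednK ?order_gt0.
  rewrite mk big_ord_recr [RHS]big_ord_recl /= -mk addrC expg_order expg0.
  by congr (_ + _).
apply/eqP/gal_eqP => x _; rewrite gal_id.
pose y := x - h x; have y0 : \sum_(i < m) (h ^+ i)%g y = 0.
  by under eq_bigr do rewrite rmorphB; rewrite sumrB hm subrr.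
suff /eqP : y = 0 by rewrite subr_eq0 => /eqP.
apply/eqP/negPn/negP => yn0; have [c wy] := val_neq0 w yn0.
have : vlt (Some c) (w (\sum_(i < m) ((h ^+ i)%g y - y))).
  by apply: vlt_sum => i _; rewrite -wy; apply: hiw.
rewrite sumrB y0 sub0r valN sumr_const card_ord -mulr_natl val_mul wm vadd0.
by rewrite wy vlt_irr.
Qed.

End InvariantValuation.

Lemma val_extends_gt0 (R S : nzRingType) (V W : oag) (f : R -> S)
    (v : valuation R V) (w : valuation S W) x :
  val_extends f v w -> vlt (Some 0) (w (f x)) = vlt (Some 0) (v x).
Proof.
move=> [phi [phile ->]]; rewrite /vlt; congr (~~ _).
by case: (v x) => //= c; rewrite -(raddf0 phi) phile.
Qed.

Lemma val_prod_XsubC (R : comNzRingType) (V : oag) (w : valuation R V)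
    (s : seq R) :
  {in s, forall z, vlt (Some 0) (w z)} ->
  forall i, (i < size s)%N -> vlt (Some 0) (w (\prod_(z <- s) ('X - z%:P))`_i).
Proof.
elim: s => // z s IHs zs i; rewrite big_cons; set Q := \prod_(_ <- _) _.
have Qs k : (k < size s)%N -> vlt (Some 0) (w Q`_k).
  by apply: IHs => y ys; apply: zs; rewrite inE ys orbT.
have Qge k : vle (Some 0) (w Q`_k).
  have [/Qs/vltW//|] := ltnP k (size s); rewrite leq_eqVlt => /predU1P[<-|sk].
    have /monicP := monic_prod_XsubC s xpredT id.
    by rewrite lead_coefE size_prod_XsubC /= => ->; rewrite Defs.val1 oag_refl.
  by rewrite nth_default ?val0// size_prod_XsubC.
move=> /= si; rewrite mulrBl coefB coefXM coefCM.
apply: vlt_sub.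
  by case: i si => [|i] si /=; rewrite ?val0//; apply: Qs.
rewrite val_mul -[Some 0](vadd0 (Some 0)) vaddC.
by apply: vadd_lt => //; apply: zs; rewrite mem_head.
Qed.

(* An invariant extension of v to a Galois extension is, up to equivalence,
   the only extension of v. *)
Section UniqueExtension.
Variables (F : fieldType) (K : splittingFieldType F) (V W W' : oag).
Hypothesis galK : galois 1%VS {:K}.
Variables (v : valuation F V) (w : valuation K W) (w' : valuation K W').
Hypothesis w_gal : forall (g : gal_of {:K}) x, w (g x) = w x.
Hypothesis w_ext : val_extends (in_alg K) v w.
Hypothesis w'_ext : val_extends (in_alg K) v w'.

(** By invariance all conjugates of [y] have positive value, so [y] is a root of a monic polynomial
    whose lower coefficients lie in [F] and have positive value for [v], hence for [w']. Were the
    [w']-value of [y] nonpositive, the leading term would dominate. *)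
Lemma unique_val_gt0_sub y : vlt (Some 0) (w y) -> vlt (Some 0) (w' y).
Proof.
move=> wy; pose s := [seq (g : gal_of {:K}) y | g <- index_enum (gal_of {:K})].
pose P := \prod_(z <- s) ('X - z%:P).
have sw : {in s, forall z, vlt (Some 0) (w z)}.
  by move=> _ /mapP[g _ ->]; rewrite w_gal.
have PF i : exists c : F, P`_i = c%:A.
  apply: (gal_invariant galK) => g; rewrite -coef_map /P rmorph_prod /=.
  congr (polyseq _)`_i; rewrite !big_map /=.
  rewrite [RHS](reindex_inj (@mulIg _ g)) /=; apply: eq_bigr => h _.
  by rewrite rmorphB /= map_polyX map_polyC /= galMf.
have sP : size P = (size s).+1 by rewrite size_prod_XsubC.
have Pw' i : (i < size s)%N -> vlt (Some 0) (w' P`_i).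
  move=> /(val_prod_XsubC sw); rewrite -/P; have [c ->] := PF i.
  by rewrite (val_extends_gt0 c w_ext) (val_extends_gt0 c w'_ext).
have Py : P.[y] = 0.
  apply/rootP; rewrite root_prod_XsubC; apply/mapP; exists 1%g; last by rewrite gal_id.
  by rewrite mem_index_enum.
rewrite -vleNlt; apply/negP => w'y; have y0 : y != 0.
  by apply/eqP => y0; move: w'y; rewrite y0 val0.
have [c wc] := val_neq0 w' y0; rewrite wc in w'y.
have s0 : P`_(size s) = 1.
  have /monicP := monic_prod_XsubC s xpredT id.
  by rewrite lead_coefE -/P sP.
have cn (i n : nat) : (i <= n)%N -> oag_le (c *+ n) (c *+ i).
  move=> /subnK <-; rewrite mulrnDr -[X in oag_le _ X]add0r.
  apply: oag_add (oag_refl _); have := oag_mulrn_le (n - i) (w'y : oag_le c 0).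
  by rewrite mul0rn.
move: Py; rewrite horner_coef sP big_ord_recr /= s0 mul1r => /eqP.
rewrite addr_eq0 => /eqP e.
have : vlt (Some (c *+ size s)) (w' (\sum_(i < size s) P`_i * y ^+ i)).
  apply: vlt_sum => i _; rewrite val_mul (valX_some i wc) vaddC.
  rewrite -[Some (c *+ size s)]vadd0 vaddC; apply: vadd_lt; last exact: Pw'.
  by apply: cn; apply: ltnW.
by rewrite e valN (valX_some _ wc) vlt_irr.
Qed.

Lemma unique_val_ge0 y : vle (Some 0) (w' y) -> vle (Some 0) (w y).
Proof.
move=> w'y; have [->|y0] := eqVneq y 0; first by rewrite val0.
apply: contraT; rewrite vleNlt => /val_gt0V /unique_val_gt0_sub.
have [c wc] := val_neq0 w' y0; rewrite (valV wc); rewrite wc in w'y.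
move=> h; have : vlt (vadd (Some 0) (Some 0)) (vadd (Some c) (Some (- c))).
  exact: vadd_lt.
by rewrite /= subrr addr0 vlt_irr.
Qed.

End UniqueExtension.

(* The generic polynomial X in the second variable records all the elements at
   which theta could differ from the members of H. *)
Lemma artin_endomorphism (k : fieldType) (gT : finGroupType) (H : {group gT})
    (act : gT -> {rmorphism k -> k}) (theta : {rmorphism k -> k}) :
  (forall c, act 1%g c = c) ->
  {in H &, forall g h c, act (g * h)%g c = act h (act g c)} ->
  (forall c, {in H, forall h, act h c = c} -> theta c = c) ->
  exists2 h, h \in H & theta =1 act h.
Proof.
move=> act1 actM fix_th; apply: contrapT => nH.
have /choice[x xP] : forall h, exists x, h \in H -> theta x != act h x.
  move=> h; have [Hh|//] := boolP (h \in H); last by exists 0.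
  have [x xn] : exists x, theta x <> act h x.
    by apply/existsNP => thh; apply: nH; exists h.
  by exists x => _; apply/eqP.
pose X := \poly_(n < #|gT|) x (nth 1%g (enum gT) n).
(* The coefficients of [P] are polynomials over the fixed field of [H], so [theta] fixes [P] and
   sends its root [X] to another root, the image of [X] under some [h]. The coefficient of [X]
   stored for this [h] was chosen to prevent that. *)
pose P := \prod_(h in H) ('X - (map_poly (act h) X)%:P).
have Pth : map_poly (map_poly theta) P = P.
  apply/polyP => m; apply/polyP => l; rewrite coef_map /= coef_map; apply: fix_th => h Hh.
  suff {2}<- : map_poly (map_poly (act h)) P = P by rewrite coef_map /= coef_map.
  rewrite rmorph_prod [RHS](reindex_inj (mulIg h)) /=.
  apply: eq_big => [g|g Hg]; first by rewrite groupMr.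
  rewrite rmorphB /= map_polyX map_polyC /=; congr (_ - _%:P).
  apply/polyP => i; rewrite coef_map /= coef_map [RHS]coef_map; exact/esym/actM.
have PX : P.[X] = 0.
  rewrite horner_prod (bigD1 1%g) ?group1//= !hornerE.
  suff -> : map_poly (act 1%g) X = X by rewrite subrr mul0r.
  by apply/polyP => i; rewrite coef_map; exact: act1.
have : P.[map_poly theta X] = 0.
  by rewrite -Pth horner_map PX /= rmorph0.
move/eqP; rewrite horner_prod prodf_seq_eq0 => /hasP[h _ /andP[Hh]].
rewrite !hornerE subr_eq0 => /eqP/polyP/(_ (index h (enum gT))).
rewrite !coef_map coef_poly.
have hi : (index h (enum gT) < #|gT|)%N by rewrite cardE index_mem mem_enum.
by rewrite hi nth_index ?mem_enum// => /eqP; apply/negP/xP.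
Qed.

(** * Residue fields and inertia *)

Section Residue.
Local Open Scope quotient_scope.
Variables (F : fieldType) (V : oag) (v : valuation F V).
Implicit Types (x y : F).

(** Total on [F], with value 0 off the valuation ring, so that residues are computed on field
    elements instead of on the subtype [val_ring]. *)
Definition res x : residue_field v :=
  if insub x is Some o then \pi_({ideal_quot (@val_max F V v)}) (o : val_ring v) else 0.

Lemma resE (o : val_ring v) : res (\val o) = \pi_({ideal_quot (@val_max F V v)}) o.
Proof. by rewrite /res valK. Qed.

Lemma val_ringP x : vle (Some 0) (v x) -> exists o : val_ring v, x = \val o.
Proof. by move=> vx; exists (Sub x vx); rewrite SubK. Qed.

Lemma val_ring_ge0 (o : val_ring v) : vle (Some 0) (v (\val o)).
Proof. exact: (valP o). Qed.

Lemma res_add x y : vle (Some 0) (v x) -> vle (Some 0) (v y) ->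
  res (x + y) = res x + res y.
Proof.
move=> /val_ringP[o ->] /val_ringP[o' ->].
by rewrite -rmorphD !resE -(rmorphD (\pi_({ideal_quot (@val_max F V v)}))).
Qed.

Lemma res_mul x y : vle (Some 0) (v x) -> vle (Some 0) (v y) ->
  res (x * y) = res x * res y.
Proof.
move=> /val_ringP[o ->] /val_ringP[o' ->].
by rewrite -rmorphM !resE -(rmorphM (\pi_({ideal_quot (@val_max F V v)}))).
Qed.

Lemma res1 : res 1 = 1.
Proof.
rewrite -(rmorph1 (\val : val_ring v -> F)) resE.
by rewrite (rmorph1 (\pi_({ideal_quot (@val_max F V v)}))).
Qed.

Lemma res_eq0 x : vle (Some 0) (v x) -> (res x == 0) = vlt (Some 0) (v x).
Proof.
move=> /val_ringP[o ->]; rewrite resE.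
have := Quotient.idealrBE (@val_max F V v) o 0.
have p0 : \pi_({ideal_quot (@val_max F V v)}) 0 = 0 by apply: rmorph0.
by rewrite subr0 inE => ->; apply/eqP/eqP => e; rewrite [LHS]e p0.
Qed.

Lemma res_surj (c : residue_field v) : exists2 x, vle (Some 0) (v x) & res x = c.
Proof.
elim/quotW: c => o; exists (\val o); first exact: val_ring_ge0.
by rewrite resE.
Qed.

Definition res_inv (c : residue_field v) : residue_field v :=
  if c == 0 then 0 else res (s2val (cid2 (res_surj c)))^-1.

Lemma res_eq0P x : vle (Some 0) (v x) -> res x != 0 -> v x = Some 0.
Proof. by move=> vx; rewrite res_eq0//; have [] := vleVlt vx => [->|->]. Qed.

Lemma res_mulV c : c != 0 -> res_inv c * c = 1.
Proof.
rewrite /res_inv => c0; rewrite (negPf c0); case: cid2 => x /= vx xc.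
have vx0 : v x = Some 0 by apply: res_eq0P; rewrite ?xc.
rewrite -xc -res_mul ?vx0 ?(valV vx0) ?oppr0 ?vle_refl//.
by rewrite mulVf ?(val_neq0E vx0) ?res1.
Qed.

Lemma res_inv0 : res_inv 0 = 0.
Proof. by rewrite /res_inv eqxx. Qed.

HB.instance Definition _ :=
  GRing.ComNzRing_isField.Build (residue_field v) res_mulV res_inv0.

Lemma res0 : res 0 = 0.
Proof. by apply/eqP; rewrite res_eq0 val0. Qed.

Lemma res_sub x y : vle (Some 0) (v x) -> vle (Some 0) (v y) ->
  res (x - y) = res x - res y.
Proof.
move=> vx vy; apply: (addIr (res y)); rewrite subrK -res_add ?subrK//.
exact: vle_sub.
Qed.

Lemma res_eq x y : vle (Some 0) (v x) -> vle (Some 0) (v y) ->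
  (res x == res y) = vlt (Some 0) (v (x - y)).
Proof. by move=> vx vy; rewrite -subr_eq0 -res_sub// res_eq0// vle_sub. Qed.

Lemma res_sum (I : Type) (r : seq I) (P : pred I) (f : I -> F) :
  (forall i, P i -> vle (Some 0) (v (f i))) ->
  res (\sum_(i <- r | P i) f i) = \sum_(i <- r | P i) res (f i).
Proof.
move=> vf; elim: r => [|i r IHr]; first by rewrite !big_nil res0.
rewrite !big_cons; case: ifP => // Pi.
by rewrite res_add ?IHr//; [exact: vf | exact: vle_sum].
Qed.

Lemma res_nat n : res n%:R = n%:R.
Proof.
elim: n => [|n IHn]; first exact: res0.
by rewrite !mulrS res_add ?IHn ?res1// ?Defs.val1 ?vle_refl ?val_nat.
Qed.

End Residue.

(** The hypothesis is a mere bijection of sets. It is used to pack [k] as a finite field, for which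
    the identity [x ^+ q = x] and the prime power order are known. *)
Lemma finite_field_card (k : fieldType) (q : nat) : ([set: k] #= `I_q)%card ->
  [/\ exists2 s : seq k, uniq s & size s = q,
      forall x : k, x ^+ q = x &
      exists p n, [/\ prime p, p \in [pchar k], q = (p ^ n)%N & (1 < q)%N]].
Proof.
case/card_set_bijP => f [fF fI fS].
have injf : injective f by move=> x y; apply: fI; rewrite in_setT.
have /choice[g gP] : forall i, exists c, (i < q)%N -> f c = i.
  move=> i; case: (ltnP i q) => [iq|]; last by exists 0.
  by have [c _ <-] := fS i iq; exists c.
pose s := [seq g i | i <- iota 0 q].
have us : uniq s.
  rewrite map_inj_in_uniq ?iota_uniq// => i j; rewrite !mem_iota add0n /=.
  by move=> iq jq gij; rewrite -(gP i iq) gij gP.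
have sizes : size s = q by rewrite size_map size_iota.
have fq c : (f c < q)%N by apply: fF.
have ss c : c \in s.
  apply/mapP; exists (f c); first by rewrite mem_iota add0n fq.
  by apply: injf; rewrite gP.
have sA : Finite.axiom s by move=> c; rewrite count_uniq_mem// ss.
have gK : pcancel f (fun i => Some (g i)).
  by move=> c; congr Some; apply: injf; rewrite gP// fq.
pose ck := @PCanIsCountable nat k f _ gK.
pose kF : finFieldType := HB.pack k ck (@isFinite.Build k s sA).
have ckF : #|kF| = q.
  by rewrite -sizes cardT enumT unlock.
split; first by exists s.
  by move=> x; have := @expf_card kF x; rewrite ckF.
have [p pp pk] := @finPcharP kF.
exists p, (logn p q); split=> //; rewrite -ckF; last exact: finNzRing_gt1.
exact: (card_pprimeChar pk).
Qed.

Lemma frobenius_morphism (k : fieldType) (p n : nat) : p \in [pchar k] ->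
  exists theta : {rmorphism k -> k}, forall x, theta x = x ^+ (p ^ n).
Proof.
move=> pk; have pp := pcharf_prime pk; pose f (x : k) := x ^+ (p ^ n).
have pn : ([pchar k].-nat (p ^ n))%N.
  by rewrite pnatX pnatE// pk.
have fB : zmod_morphism f.
  by move=> x y; rewrite /f exprDn_pchar// exprNn_pchar.
have fM : monoid_morphism f.
  by split; [exact: expr1n | move=> x y; exact: exprMn].
pose theta : {rmorphism k -> k} :=
  HB.pack f (GRing.isZmodMorphism.Build _ _ f fB) (GRing.isMonoidMorphism.Build _ _ f fM).
by exists theta.
Qed.

(** * Frobenius elements and tame inertia *)

Section Ramification.
Variables (F : fieldType) (M : splittingFieldType F) (V W : oag).
Hypothesis galM : galois 1%VS {:M}.
Variables (v : valuation F V) (w : valuation M W).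
Hypothesis w_gal : forall (g : gal_of {:M}) x, w (g x) = w x.
Hypothesis w_ext : val_extends (in_alg M) v w.
Hypothesis w_card : w #|{: gal_of {:M}}|%:R = Some 0.
Variable q : nat.
Hypothesis v_card : residue_card v q.
Implicit Types (g h s t : gal_of {:M}) (x y : M).

Lemma w_gt0E (a : F) : vlt (Some 0) (w a%:A) = vlt (Some 0) (v a).
Proof. exact: (val_extends_gt0 a w_ext). Qed.

Lemma w_ge0E (a : F) : vle (Some 0) (w a%:A) = vle (Some 0) (v a).
Proof.
have [phi [phile ww]] := w_ext; rewrite (_ : w a%:A = omap phi (v a)); last exact: ww.
by case: (v a) => //= c; rewrite -(raddf0 phi) phile.
Qed.

Lemma residue_action : exists act : gal_of {:M} -> {rmorphism residue_field w -> residue_field w},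
  forall g x, vle (Some 0) (w x) -> act g (res w x) = res w (g x).
Proof.
suff /choice[act actP] : forall g, exists f : {rmorphism residue_field w -> residue_field w},
    forall x, vle (Some 0) (w x) -> f (res w x) = res w (g x) by exists act.
move=> g; have /choice[l lP] : forall c, exists x, vle (Some 0) (w x) /\ res w x = c.
  by move=> c; have [x wx xc] := res_surj c; exists x.
pose f c := res w (g (l c)).
have wg x : vle (Some 0) (w x) -> vle (Some 0) (w (g x)) by rewrite w_gal.
have fP x : vle (Some 0) (w x) -> f (res w x) = res w (g x).
  move=> wx; have [wl lx] := lP (res w x).
  apply/eqP; rewrite /f res_eq ?wg// -rmorphB w_gal -res_eq//.
  exact/eqP.
have fB : zmod_morphism f.
  move=> c d; have [[wc <-] [wd <-]] := (lP c, lP d).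
  by rewrite -res_sub// !fP ?vle_sub// rmorphB res_sub ?wg.
have fM : monoid_morphism f.
  split; first by rewrite -res1 fP ?rmorph1// Defs.val1 vle_refl.
  move=> c d; have [[wc <-] [wd <-]] := (lP c, lP d).
  have wcd : vle (Some 0) (w (l c * l d)).
    by rewrite val_mul -[Some 0]vadd0; apply: vadd_le.
  by rewrite -res_mul// !fP// rmorphM res_mul ?wg.
by exists (HB.pack f (GRing.isZmodMorphism.Build _ _ f fB) (GRing.isMonoidMorphism.Build _ _ f fM)
  : {rmorphism _ -> _}).
Qed.

Lemma base_residue_frob (a : F) : vle (Some 0) (v a) ->
  (res w a%:A) ^+ q = res w a%:A.
Proof.
move=> va; have [_ /(_ (res v a)) aq _] := finite_field_card v_card.
have wX (x : M) n : vle (Some 0) (w x) ->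
    vle (Some 0) (w (x ^+ n)) /\ res w (x ^+ n) = res w x ^+ n.
  move=> wx; elim: n => [|n [IH1 IH2]].
    by rewrite !expr0 res1 Defs.val1 vle_refl.
  rewrite !exprS val_mul res_mul// IH2; split=> //.
  by rewrite -[Some 0]vadd0; apply: vadd_le.
have vX n : vle (Some 0) (v (a ^+ n)) /\ res v (a ^+ n) = res v a ^+ n.
  elim: n => [|n [IH1 IH2]]; first by rewrite !expr0 res1 Defs.val1 vle_refl.
  rewrite !exprS val_mul res_mul// IH2; split=> //.
  by rewrite -[Some 0]vadd0; apply: vadd_le.
have wa : vle (Some 0) (w a%:A) by rewrite w_ge0E.
have [wq <-] := wX _ q wa; apply/eqP; rewrite res_eq//.
rewrite -[_ ^+ q](rmorphXn (in_alg M)) -[_ - _](rmorphB (in_alg M)) /= w_gt0E.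
by have [vq vaq] := vX q; rewrite -res_eq// vaq aq.
Qed.

(** The residues of [F] already give [q] roots of ['X^q - 'X], which leaves no room for another. *)
Lemma frob_fixed_base (c : residue_field w) : c ^+ q = c ->
  exists2 a : F, vle (Some 0) (v a) & c = res w a%:A.
Proof.
move=> cq; have [[s us ss] _ [p [n [_ _ _ q1]]]] := finite_field_card v_card.
have /choice[l lP] : forall d, exists b, vle (Some 0) (v b) /\ res v b = d.
  by move=> d; have [b vb bd] := res_surj d; exists b.
pose e (d : residue_field v) := res w (l d)%:A.
have wl d : vle (Some 0) (w (l d)%:A) by rewrite w_ge0E; have [] := lP d.
have eI : injective e.
  move=> d d' /eqP; rewrite res_eq// -(rmorphB (in_alg M)) /= w_gt0E.
  have [[vd dE] [vd' d'E]] := (lP d, lP d').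
  by rewrite -res_eq// dE d'E => /eqP.
apply: contrapT => nc.
have u : uniq (c :: [seq e d | d <- s]).
  rewrite /= map_inj_uniq// us andbT; apply/mapP => -[d _ cE].
  by apply: nc; exists (l d); [have [] := lP d | rewrite cE].
pose P : {poly residue_field w} := 'X^q - 'X.
have sP : size P = q.+1 by rewrite size_polyDl size_polyXn// size_polyN size_polyX.
have P0 : P != 0 by rewrite -size_poly_eq0 sP.
suff Pr : all (root P) (c :: [seq e d | d <- s]).
  by have := max_poly_roots P0 Pr u; rewrite sP /= size_map ss ltnn.
apply/andP; split.
  by rewrite rootE !hornerE cq subrr.
apply/allP => _ /mapP[d _ ->]; rewrite rootE !hornerE.
by rewrite base_residue_frob ?subrr//; have [] := lP d.
Qed.

Definition inert s := forall x, vle (Some 0) (w x) -> vlt (Some 0) (w (s x - x)).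

(** Both parts use [artin_endomorphism] on the residue field of [M]. Elements fixed by the whole
    group are residues of [F], on which the [q]-th power is the identity, so this power map is
    induced by some [phi]. Elements fixed by [phi] are roots of ['X^q - 'X], again residues of [F],
    so every [g] acts as a power of [phi]. *)
Lemma residue_frobenius : exists phi : gal_of {:M},
  (forall x, vle (Some 0) (w x) -> res w (phi x) = res w x ^+ q) /\
  forall g, exists i, inert (g * phi ^- i)%g.
Proof.
have [act actP] := residue_action.
have w_g g x : vle (Some 0) (w x) -> vle (Some 0) (w (g x)) by rewrite w_gal.
have act1 c : act 1%g c = c.
  by have [x wx <-] := res_surj c; rewrite actP// gal_id.
have actM g h c : act (g * h)%g c = act h (act g c).
  by have [x wx <-] := res_surj c; rewrite !actP ?w_g// galMf.
have [_ _ [p [n [pp pk qE q1]]]] := finite_field_card v_card.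
have pkw : p \in [pchar residue_field w].
  rewrite inE pp /= -res_nat res_eq0 ?val_nat//.
  have -> : p%:R = (p%:R)%:A :> M by rewrite scaler_nat.
  rewrite w_gt0E -res_eq0 ?val_nat// res_nat.
  by rewrite pcharf0.
have [theta thetaE] := frobenius_morphism n pkw.
have n0 : #|{: gal_of {:M}}|%:R != 0 :> residue_field w.
  by rewrite -res_nat res_eq0 ?w_card ?vle_refl// vlt_irr.
(* A fixed residue comes from [F]: average a lift over the group, whose order is a unit. *)
have fixed c : (forall g, act g c = c) -> exists2 a : F, vle (Some 0) (v a) & c = res w a%:A.
  move=> cg; have [x wx xc] := res_surj c.
  pose m := #|{: gal_of {:M}}|; pose y := galTr x.
  have wy : vle (Some 0) (w y) by apply: vle_sum => g _; apply: w_g.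
  have resy : res w y = m%:R * c.
    rewrite /y /galTr res_sum => [|g _]; last exact: w_g.
    under eq_bigr do rewrite -actP// xc cg.
    by rewrite sumr_const mulr_natl.
  have wm : w (m%:R^-1) = Some 0 by rewrite (valV w_card) oppr0.
  have [a aE] : exists a : F, m%:R^-1 * y = a%:A.
    apply: (gal_invariant galM) => g; rewrite rmorphM fmorphV rmorph_nat.
    congr (_ * _).
    by rewrite /y; have [b ->] := galTr_in galM x; apply: gal_scale.
  have wa : vle (Some 0) (w a%:A) by rewrite -aE val_mul wm vadd0.
  exists a; first by rewrite -w_ge0E.
  rewrite -aE res_mul ?wm ?vle_refl// resy mulrA.
  rewrite -(res_nat w m) -res_mul ?wm ?val_nat ?vle_refl//.
  by rewrite mulVf ?res1 ?mul1r//; apply: val_neq0E w_card.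
have [||phi _ phiP] := @artin_endomorphism _ _ [set: gal_of {:M}]%G act theta act1.
- by move=> g h _ _ c; rewrite actM.
- move=> c cg; have [|a va ->] := fixed c; first by move=> g; apply: cg; rewrite inE.
  by rewrite thetaE -qE base_residue_frob.
have phiE x : vle (Some 0) (w x) -> res w (phi x) = res w x ^+ q.
  by move=> wx; rewrite -actP// -phiP thetaE -qE.
exists phi; split=> // g.
have [||h /cycleP[i ->] hP] := @artin_endomorphism _ _ <[phi]>%G act (act g) act1.
- by move=> h h' _ _ c; rewrite actM.
- move=> c cphi; have [|a va ->] := @frob_fixed_base c.
    by rewrite qE -thetaE phiP cphi ?cycle_id.
  by rewrite actP ?w_ge0E// gal_scale.
exists i => x wx; rewrite galMf.
have wgx : vle (Some 0) (w (g x)) by apply: w_g.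
rewrite -(w_gal (phi ^+ i)%g).
have -> : (phi ^+ i)%g ((phi ^- i)%g (g x) - x) = g x - (phi ^+ i)%g x.
  by rewrite galfB -[X in X - _](galMf (phi ^- i)%g (phi ^+ i)%g) mulVg gal_id.
rewrite -res_eq ?w_g// -!actP//.
by apply/eqP; apply: hP.
Qed.

Definition inertia : {set gal_of {:M}} := [set s | `[< inert s >]]%SET.

Lemma inertiaP s : reflect (inert s) (s \in inertia).
Proof. by rewrite inE; apply: asboolP. Qed.

Lemma inertia_group_set : group_set inertia.
Proof.
apply/group_setP; split=> [|s t /inertiaP Is /inertiaP It].
  by apply/inertiaP => x wx; rewrite gal_id subrr val0.
apply/inertiaP => x wx; rewrite galMf -[_ - x](subrKA (s x)).
apply: vlt_add; last exact: Is.
by apply: It; rewrite w_gal.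
Qed.

Canonical inertia_gp := Group inertia_group_set.

Hypothesis w_cyclic : cyclic_val w.

(** The character is s |-> res(s x0 / x0) with [x0] of generating value. If it is 1 at [s], then s x
    / x has residue 1 for every [x], since [x] is a unit times a power of [x0]; [no_wild_inertia]
    then gives [s = 1]. *)
Lemma inertia_character : exists chi : gal_of {:M} -> residue_field w,
  [/\ chi 1%g = 1,
      {in inertia &, forall s t, chi (s * t)%g = chi s * chi t},
      {in inertia, forall s, chi s = 1 -> s = 1%g} &
      forall phi : gal_of {:M},
        (forall x, vle (Some 0) (w x) -> res w (phi x) = res w x ^+ q) ->
      {in inertia, forall s, (s ^ phi)%g \in inertia /\ chi (s ^ phi)%g = chi s ^+ q}].
Proof.
have [g0 [x0 [wx0 wP]]] := w_cyclic; have x0n := val_neq0E wx0.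
pose chi s := res w (s x0 / x0).
have O0 x : w x = Some 0 -> vle (Some 0) (w x) by move=> ->; rewrite vle_refl.
have wq x y : x != 0 -> w y = w x -> w (y / x) = Some 0.
  by move=> x_n0 wyx; have [c wx] := val_neq0 w x_n0; apply: (val_div (g := c)); rewrite ?wyx.
have unit1 s x : s \in inertia -> w x = Some 0 -> res w (s x / x) = 1.
  move=> /inertiaP Is wx; have xn := val_neq0E wx.
  apply/eqP; rewrite -res1 res_eq ?Defs.val1 ?vle_refl//; last by rewrite O0// wq// w_gal.
  rewrite -[1](divff xn) -mulrBl val_mul (valV wx) oppr0 vaddC vadd0.
  by apply: Is; apply: O0.
have psiM s x y : x != 0 -> y != 0 ->
    res w (s (x * y) / (x * y)) = res w (s x / x) * res w (s y / y).
  move=> xn yn; rewrite -res_mul; try by apply: O0; rewrite wq ?w_gal.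
  by congr (res w _); rewrite rmorphM invfM; ring.
(* On inertia any element of value [g0] may replace [x0]. Replacing it by [s x0] gives
   multiplicativity, and by its preimage under [phi] the [q]-th power rule. *)
have chiE s x : s \in inertia -> w x = Some g0 -> chi s = res w (s x / x).
  move=> Is wx; have wu : w (x / x0) = Some 0 by apply: (val_div (g := g0)).
  rewrite -[x](divfK x0n) psiM ?(val_neq0E wu)// unit1// mul1r.
  by [].
exists chi; split.
- by rewrite /chi gal_id divff// res1.
- move=> s t Is It; rewrite /chi galMf.
  have -> : t (s x0) / x0 = (s x0 / x0) * (t (s x0) / s x0).
    by field; rewrite fmorph_eq0 x0n.
  rewrite res_mul; try by apply: O0; rewrite wq ?fmorph_eq0 ?w_gal.
  by congr (_ * _); rewrite -(chiE t (s x0))// w_gal.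
- move=> s Is chi1; apply: (no_wild_inertia w_gal w_card) => x xn.
  have psiX n : res w (s (x0 ^+ n) / x0 ^+ n) = 1.
    elim: n => [|n IHn]; first by rewrite expr0 rmorph1 divr1 res1.
    by rewrite exprS psiM ?expf_neq0// IHn mulr1.
  have psiXz k : res w (s (x0 ^ k) / x0 ^ k) = 1.
    case: k => n; first exact: psiX.
    have xn0 : x0 ^+ n.+1 != 0 by rewrite expf_neq0.
    have := psiM s _ _ xn0 (invr_neq0 xn0); rewrite divff// rmorph1 divr1 res1.
    by rewrite psiX mul1r NegzE exprnN => <-.
  have [k wx] := wP x xn; pose u := x / x0 ^ k.
  have x0k : x0 ^ k != 0 by apply: expfz_neq0.
  have wu : w u = Some 0 by apply: (val_div (g := g0 *~ k)) => //; apply: valXz.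
  have r1 : res w (s x / x) = 1.
    by rewrite -[x](divfK x0k) psiM ?(val_neq0E wu)// unit1// psiXz mulr1.
  have : vlt (Some 0) (w (s x / x - 1)).
    rewrite -res_eq ?r1 ?res1// ?Defs.val1 ?vle_refl//.
    by apply: O0; rewrite wq ?w_gal.
  have [c wc] := val_neq0 w xn.
  rewrite -[1](divff xn) -mulrBl val_mul (valV wc) wc => h.
  have : vlt (vadd (Some c) (Some 0)) (vadd (Some c) (vadd (w (s x - x)) (Some (- c)))).
    by apply: vadd_lt => //; apply: vle_refl.
  rewrite vaddC vadd0 vaddC -vaddA.
  by rewrite [vadd (Some _) (Some _)]/= addNr vaddC vadd0.
move=> phi phiP s Is.
have phiV x : (phi^-1)%g (phi x) = x by rewrite -galMf mulgV gal_id.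
have phiK x : phi ((phi^-1)%g x) = x by rewrite -galMf mulVg gal_id.
have sphi x : (s ^ phi)%g x = phi (s ((phi^-1)%g x)) by rewrite /conjg !galMf.
have Isphi : (s ^ phi)%g \in inertia.
  apply/inertiaP => x wx; rewrite sphi.
  rewrite -(w_gal phi^-1%g) galfB phiV.
  by move/inertiaP: Is; apply; rewrite w_gal.
split=> //; rewrite /chi sphi -[in X in _ / X](phiK x0) -galf_inv -galf_mul.
rewrite phiP; last by apply: O0; rewrite wq ?fmorph_eq0 ?w_gal.
by rewrite -(chiE s)// w_gal.
Qed.

End Ramification.

(** * Recognizing the quaternion group *)

(* The action of a Frobenius element phi on a tame inertia group I, embedded by
   chi in the units of the residue field. *)
Definition tame_group (gT : finGroupType) (I : {group gT}) (q : nat) : Prop :=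
  exists (phi : gT) (k : fieldType) (chi : gT -> k),
  [/\ [/\ chi 1%g = 1,
      {in I &, forall s t, chi (s * t)%g = chi s * chi t} &
      {in I, forall s, chi s = 1 -> s = 1%g}],
      {in I, forall s, (s ^ phi)%g \in I /\ chi (s ^ phi)%g = chi s ^+ q} &
      forall g, exists i, (g * phi ^- i)%g \in I].

Section TameGroup.
Variables (gT : finGroupType) (I : {group gT}) (q : nat).
Local Open Scope group_scope.

Lemma tame_inj (k : fieldType) (chi : gT -> k) : chi 1 = 1%R ->
  {in I &, forall s t, chi (s * t) = (chi s * chi t)%R} ->
  {in I, forall s, chi s = 1%R -> s = 1} ->
  {in I &, injective chi}.
Proof.
move=> chi1 chiM chiI s t Is It st.
have It' : t^-1 \in I by rewrite groupV.
apply/eqP; rewrite eq_mulgV1; apply/eqP; apply: chiI; first by rewrite groupM.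
by rewrite chiM// st -chiM// mulgV.
Qed.

Hypothesis tameI : tame_group I q.

Lemma tame_abelian : {in I &, forall s t, s * t = t * s}.
Proof.
case: tameI => phi [k [chi [[chi1 chiM chiI] _ _]]] s t Is It.
by apply: (tame_inj chi1 chiM chiI); rewrite ?groupM// !chiM// mulrC.
Qed.

(** The injective character sends an involution to a square root of 1 other than 1, that is to
    -1. *)
Lemma tame_unique_involution : {in I &, forall s t,
  s * s = 1 -> t * t = 1 -> s != 1 -> t != 1 -> s = t}.
Proof.
case: tameI => phi [k [chi [[chi1 chiM chiI] _ _]]] s t Is It ss tt s1 t1.
have chiN u : u \in I -> u * u = 1 -> u != 1 -> chi u = (-1)%R.
  move=> Iu uu u1; have : (chi u ^+ 2 == 1)%R by rewrite expr2 -chiM// uu chi1.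
  rewrite sqrf_eq1 => /orP[|] /eqP // cu1.
  by case/eqP: u1; apply: chiI.
by apply: (tame_inj chi1 chiM chiI) => //; rewrite !chiN.
Qed.

(** On [I], where fourth powers are trivial, the [q]-th power is inversion, so [phi] inverts [I]. An
    element outside [H] is an element of the abelian group [I] times an odd power of [phi], because
    even powers of [phi] lie in [H]. *)
Lemma tame_inverts (H : {group gT}) : (q %% 4)%N = 3 ->
  {in I, forall s, s ^+ 4 = 1} -> I \subset H ->
  (forall g h, g \notin H -> h \notin H -> g * h \in H) ->
  forall g, g \notin H -> {in I, forall s, s ^ g = s^-1}.
Proof.
case: tameI => phi [k [chi [[chi1 chiM chiI] phiI genI]]] q3 I4 /fintype.subsetP IH H2 g gH.
have chiX s n : s \in I -> chi (s ^+ n) = (chi s ^+ n)%R.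
  move=> Is; elim: n => [|n IHn]; first by rewrite expg0 expr0.
  by rewrite expgS chiM ?groupX// IHn exprS.
have sphi s : s \in I -> s ^ phi = s^-1.
  move=> Is; have [Isp chip] := phiI s Is.
  apply: (tame_inj chi1 chiM chiI); rewrite ?groupV// chip.
  rewrite (divn_eq q 4) q3 mulnC exprD exprM -[(chi s ^+ 4)%R]chiX// I4// chi1.
  rewrite expr1n mul1r -chiX//; congr chi; apply/eqP.
  by rewrite eq_mulgV1 invgK -expgSr I4.
have sphiX s a : s \in I -> s ^ (phi ^+ a) = if odd a then s^-1 else s.
  move=> Is; elim: a => [|a IHa]; first by rewrite expg0 conjg1.
  by rewrite expgSr conjgM IHa /=; case: (odd a); rewrite /= ?conjVg sphi ?invgK.
have [a] := genI g; set x := g * _ => Ix.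
have gE : g = x * phi ^+ a by rewrite /x mulgKV.
have oa : odd a.
  apply: contraR gH => ea; rewrite gE groupM ?(IH _ Ix)//.
  have [phiH|phiH] := boolP (phi \in H); first by rewrite groupX.
  rewrite -[a]odd_double_half (negPf ea) add0n -mul2n expgM groupX// expgS expg1.
  exact: H2.
move=> s Is; rewrite gE conjgM [s ^ x]conjgE (tame_abelian Is Ix) mulKg.
by rewrite sphiX// oa.
Qed.

(* The quotient by I is cyclic, so it has a unique involution. *)
Lemma tame_quotient_involution u t : u \notin I -> t \notin I ->
  u * u = 1 -> t * t = 1 -> u * t \in I.
Proof.
case: tameI => phi [k [chi [[chi1 chiM chiI] phiI genI]]] uI tI uu tt.
have nphi : phi \in 'N(I).
  rewrite inE; apply/fintype.subsetP => _ /imsetP[s Is ->].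
  by have [] := phiI s Is.
have nI g : g \in 'N(I).
  have [a Ix] := genI g; rewrite -[g](mulgKV (phi ^+ a)) groupM ?groupX//.
  exact: (fintype.subsetP (normG I)).
have cyc : cyclic ([set: gT] / I).
  apply/cyclicP; exists (coset I phi); apply/eqP; rewrite finset.eqEsubset; apply/andP; split.
    apply/fintype.subsetP => _ /morphimP[g _ _ ->].
    have [a Ix] := genI g; rewrite -[g](mulgKV (phi ^+ a)).
    by rewrite morphM ?nI//= (coset_id Ix) mul1g morphX ?nI// mem_cycle.
  by rewrite cycle_subG mem_quotient ?inE.
have o2 g : g \notin I -> g * g = 1 -> #[coset I g] = 2.
  move=> gI gg; apply/eqP; rewrite eqn_leq order_gt1 andbC; apply/andP; split.
    by apply: contra gI => /eqP; apply: coset_idr.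
  by rewrite dvdn_leq// order_dvdn expgS expg1 -morphM ?nI//= gg morph1.
have : <[coset I u]> = <[coset I t^-1]>.
  apply/eqP; rewrite (eq_subG_cyclic cyc) ?cycle_subG ?mem_quotient ?inE//.
  by rewrite -!orderE !o2 ?groupV// -invMg tt invg1.
have tt' : t^-1 = t by apply/eqP; rewrite eq_invg_mul tt.
rewrite tt' => uteq.
have : coset I u \in <[coset I t]> by rewrite -uteq cycle_id.
rewrite cycle2g ?o2// !inE => /orP[/eqP u1|/eqP utI].
  by have := o2 u uI uu; rewrite u1 order1.
apply: coset_idr; first exact: nI.
by rewrite morphM ?nI//= utI -morphM ?nI//= tt morph1.
Qed.

End TameGroup.

(* H true and H false stand for the stabilizers of the square roots generating
   the two inertia fields of K, and e for the generator of Gal(M/K). *)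
Section QuaternionGroup.
Variables (gT : finGroupType) (H I : bool -> {group gT}) (q : bool -> nat).
Variable (e : gT).
Local Open Scope group_scope.
Hypothesis tameI : forall k, tame_group (I k) (q k).
Hypothesis q3 : forall k, (q k %% 4)%N = 3.
Hypothesis IH : forall k, I k \subset H k.
Hypothesis H2 : forall k g h, g \notin H k -> h \notin H k -> g * h \in H k.
Hypothesis HN : forall k, exists2 g, g \in H k & g \notin H (~~ k).
Hypothesis NE : forall n, n \in H true -> n \in H false -> n = 1 \/ n = e.
Hypothesis e1 : e != 1.
Hypothesis eH : forall k, e \in H k.

Let NEk k n : n \in H k -> n \in H (~~ k) -> n = 1 \/ n = e.
Proof. by case: k => h1 h2; apply: NE. Qed.

Let ee : e * e = 1.
Proof.
have [//|h] : e * e = 1 \/ e * e = e by apply: NE; rewrite groupM ?eH.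
by case/eqP: e1; apply: (mulgI e); rewrite h mulg1.
Qed.

Let sqN g : g * g = 1 \/ g * g = e.
Proof.
have sqH k : g * g \in H k.
  by have [gH|gH] := boolP (g \in H k); [rewrite groupM | apply: H2].
by apply: NE; apply: sqH.
Qed.

(** Otherwise [I k] lies in both [H true] and [H false], and modulo their intersection the group is
    generated by [phi]; but [HN] makes this quotient noncyclic. *)
Let I_notN k : exists2 s, s \in I k & s \notin H (~~ k).
Proof.
apply: contrapT => nI.
have IN : I k \subset H (~~ k).
  apply/fintype.subsetP => s Is; apply: contraT => sH.
  by case: nI; exists s.
have IH' l : I k \subset H l.
  by case: (l =P k) => [->|/eqP]; [exact: IH|case: l k IN {nI} => [] [] //].
have [phi [kk [chi [_ _ genI]]]] := tameI k.
have gphi g l : exists a, [/\ g \in H l = (phi ^+ a \in H l) &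
    g \in H (~~ l) = (phi ^+ a \in H (~~ l))].
  have [a Ix] := genI g; exists a; rewrite -[g](mulgKV (phi ^+ a)).
  by split; rewrite groupMl ?mulgKV//; apply: (fintype.subsetP (IH' _)).
have [phiH|phiH] := boolP (phi \in H true).
  have [g gf gt] := HN false; have [a [+ _]] := gphi g true.
  by rewrite groupX// (negPf gt).
have [phiH'|phiH'] := boolP (phi \in H false).
  have [g gt gf] := HN true; have [a [+ _]] := gphi g false.
  by rewrite groupX// (negPf gf).
have [g gt gf] := HN true; have [a []] := gphi g true.
rewrite gt (negPf gf) => /esym pt /esym pf.
have ph2 l : phi ^+ 2 \in H l.
  by rewrite expgS expg1; apply: H2; case: l.
have oa l : phi ^+ a \in H l -> ~~ odd a.
  apply: contraL => oa; rewrite -[a]odd_double_half oa -mul2n expgD expgM /= expg1.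
  by rewrite (groupMr _ (groupX _ (ph2 l))); case: l.
have ea := oa _ pt; case/negP: (negbT pf).
by rewrite -[a]odd_double_half (negPf ea) add0n -mul2n expgM groupX.
Qed.

Let I_square k s : s \in I k -> s \notin H (~~ k) -> e \in I k -> s * s = e.
Proof.
move=> Is sH eI; have [ss|//] := sqN s.
have s1 : s != 1 by apply: contra sH => /eqP->; apply: group1.
have se := tame_unique_involution (tameI k) Is eI ss ee s1 e1.
by rewrite se eH in sH.
Qed.

Let I_exp4 k : {in I k, forall s, s ^+ 4 = 1}.
Proof.
move=> s _; rewrite (expgM s 2 2) !expgS !expg0 !mulg1.
by have [->|->] := sqN s; rewrite ?mulg1 ?ee.
Qed.

Let inverts k g : g \notin H k -> {in I k, forall s, s ^ g = s^-1}.
Proof. by apply: (tame_inverts (tameI k) (q3 k)) => //; apply: H2. Qed.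

(** If [e] were outside [I k], then [g] and [e] would both give the involution of the cyclic
    quotient by [I k], so [g * e], and with it [g], would lie in [H k]. *)
Let involution_e k g : g \notin H k -> g * g = 1 -> e \in I k.
Proof.
move=> gH gg; apply: contraT => eI.
have gI : g \notin I k by apply: contra gH; apply: (fintype.subsetP (IH k)).
have := tame_quotient_involution (tameI k) gI eI gg ee.
move=> /(fintype.subsetP (IH k)); rewrite groupMr ?eH// => gH'.
by rewrite gH' in gH.
Qed.

(** An involution [g] outside [H k] would put [e] into both [I true] and [I false]. Then [H k] is
    contained in [I k], so the product of [g] with an element [t] of [I (~~ k)] outside [H k] is
    inverted by [t], which forces [g * g = e^-1]. *)
Lemma quaternion_square g : ~~ ((g \in H true) && (g \in H false)) -> g * g = e.
Proof.
move=> gN; have [gg|//] := sqN g.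
have [k gH] : exists k, g \notin H k.
  by move: gN; rewrite negb_and => /orP[]; [exists true|exists false].
have ek := involution_e gH gg.
have [s Is sH] := I_notN k.
have ss := I_square Is sH ek.
have sHk : s \in H k by apply: (fintype.subsetP (IH k)).
(* If [g] lies in [H (~~ k)], replace it by [g * s], which does not, and which is still an
   involution because [g] inverts [s]. *)
have el : e \in I (~~ k).
  have [gH'|gH'] := boolP (g \in H (~~ k)); last exact: involution_e gH' gg.
  apply: (@involution_e _ (g * s)); first by rewrite groupMl.
  have gi : g^-1 = g by apply/eqP; rewrite eq_invg_mul gg.
  have := inverts gH Is; rewrite conjgE gi => gs.
  by rewrite mulgA -[g * s * g]mulgA gs mulVg.
have [t It tH] := I_notN (~~ k); rewrite negbK in tH.
have tHl : t \in H (~~ k) by apply: (fintype.subsetP (IH _)).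
have tt : t * t = e by apply: I_square It _ el; rewrite negbK.
(* Modulo [e], an element of [H k] is 1 or [s], and both [e] and [s] are in [I k]. *)
have HI h : h \in H k -> h \in I k.
  move=> hH; have [hH'|hH'] := boolP (h \in H (~~ k)).
    by have [->|->] := NEk hH hH'; rewrite ?group1.
  have hs : h * s \in H k by rewrite groupM.
  have hs' : h * s \in H (~~ k) by apply: H2.
  rewrite -[h](mulgK s) groupM ?groupV//.
  by have [->|->] := NEk hs hs'; rewrite ?group1.
have Iy : g * t \in I k by apply: HI; apply: H2.
have gE : g = g * t * t^-1 by rewrite mulgK.
have : g * g = e^-1.
  have := inverts tH Iy; rewrite conjgE => yt.
  set y := g * t in yt gE; rewrite gE -tt invMg !mulgA; congr (_ * _).
  have : y * (t^-1 * (y * t)) = 1 by rewrite yt mulgV.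
  by rewrite !mulgA => yy; apply: (mulIg t); rewrite yy mulVg.
by rewrite gg => /esym/eqP; rewrite invg_eq1 (negPf e1).
Qed.

End QuaternionGroup.

(** * Witt's criterion for quaternion extensions *)

Lemma isometric_orthogonal (F : fieldType) (n : nat) (d : n.-tuple F)
    (p : 'I_n -> 'I_n -> F) :
  (forall i, tnth d i != 0) ->
  (forall i k, \sum_j p i j * p k j = (i == k)%:R * tnth d i) ->
  isometric (diag_form d) (diag_form [tuple 1 | _ < n]).
Proof.
move=> d0 pp; exists (\matrix_(i, j) p i j).
  have : (\matrix_(i, j) p i j) *m (\matrix_(j, k) (p k j / tnth d k)) = 1%:M.
    apply/matrixP => i k; rewrite !mxE; under eq_bigr do rewrite !mxE mulrA.
    rewrite -mulr_suml pp; have [->|] := eqVneq i k; first by rewrite mul1r divff.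
    by rewrite !mul0r.
  by case/mulmx1_unit.
move=> x; rewrite /diag_form.
transitivity (\sum_(j < n) \sum_i \sum_k x 0 i * x 0 k * (p i j * p k j)).
  apply: eq_bigr => j _; rewrite tnth_mktuple mul1r mxE expr2.
  rewrite big_distrlr /=; apply: eq_bigr => i _; apply: eq_bigr => k _.
  by rewrite !mxE; ring.
rewrite exchange_big; apply: eq_bigr => i _ /=.
rewrite exchange_big (bigD1 i)//= [X in _ + X]big1 ?addr0.
  by rewrite -mulr_sumr pp eqxx mul1r mulrC expr2.
by move=> k ki; rewrite -mulr_sumr pp eq_sym (negPf ki) mul0r mulr0.
Qed.

(* The entries of the isometry are those of the Euler-Rodrigues rotation matrix
   attached to the four conjugates x0, ..., x3 of theta, divided by their sum of
   squares and scaled by alpha, beta, alpha beta to become rational. *)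
Section WittQuaternion.
Variables (F : fieldType) (M : splittingFieldType F).
Variables (s t e : gal_of {:M}) (al be : M) (a b : F).
Hypothesis two_neq0 : 2%:R != 0 :> M.
Hypotheses (al2 : al ^+ 2 = a%:A) (be2 : be ^+ 2 = b%:A).
Hypotheses (a0 : a != 0) (b0 : b != 0).
Hypotheses (sal : s al = al) (sbe : s be = - be) (tal : t al = - al) (tbe : t be = be).
Hypotheses (ss : (s * s)%g = e) (tt : (t * t)%g = e) (stst : (s * t * (s * t))%g = e).
Hypotheses (e1 : e != 1%g) (ee : (e * e)%g = 1%g).
Hypothesis st_fixed : forall y, s y = y -> t y = y -> exists c : F, y = c%:A.

Let galN (g : gal_of {:M}) x : g (- x) = - g x.
Proof. exact: rmorphN. Qed.
Let galD (g : gal_of {:M}) x y : g (x + y) = g x + g y.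
Proof. exact: rmorphD. Qed.

Let sse x : s (s x) = e x. Proof. by rewrite -galMf ss. Qed.
Let tte x : t (t x) = e x. Proof. by rewrite -galMf tt. Qed.
Let eeE x : e (e x) = x. Proof. by rewrite -galMf ee gal_id. Qed.
Let seC x : s (e x) = e (s x). Proof. by rewrite -!sse. Qed.
Let teC x : t (e x) = e (t x). Proof. by rewrite -!tte. Qed.
Let tsE x : t (s x) = e (s (t x)).
Proof.
have h : t (s (t (s x))) = e x by rewrite -stst !galMf.
have {}h : s (t (s x)) = t x.
  by apply: (fmorph_inj e); rewrite /= -tte h teC.
by rewrite -h sse eeE.
Qed.

Definition sum4 x := x ^+ 2 + s x ^+ 2 + t x ^+ 2 + s (t x) ^+ 2.

(** If [sum4] vanished at [l * y] for [l] equal to 1, [1 + al], [1 + be] and [1 + al * be], then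
    four signed sums of the squares of the conjugates of [y] would vanish, and these add up to
    [4 y ^+ 2]. *)
Let sum4_neq0 : exists2 th, e th = - th & sum4 th != 0.
Proof.
have [z ez] : exists z, e z != z.
  apply: contrapT => /forallNP ez; case/negP: e1; apply/gal_eqP => z _.
  by rewrite gal_id; apply/eqP/negPn/negP/ez.
have [y ey yn] : exists2 y, e y = - y & y != 0.
  exists (z - e z); first by rewrite galfB eeE opprB.
  by rewrite subr_eq0 eq_sym.
have eal : e al = al by rewrite -sse !sal.
have ebe : e be = be by rewrite -tte !tbe.
have aln : al != 0.
  by apply: contra a0 => /eqP al0; rewrite -(fmorph_eq0 (in_alg M)) /= -al2 al0 expr0n.
have ben : be != 0.
  by apply: contra b0 => /eqP be0; rewrite -(fmorph_eq0 (in_alg M)) /= -be2 be0 expr0n.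
apply: contrapT => nth.
have S l : e l = l -> sum4 (l * y) = 0.
  move=> el; apply/eqP/negPn/negP => n0; apply: nth; exists (l * y) => //.
  by rewrite galf_mul el ey mulrN.
have eone : e 1 = 1 by apply: rmorph1.
have one g : (g : gal_of {:M}) 1 = 1 by apply: rmorph1.
have S1 := S 1 eone.
have Sa := S (1 + al); have Sb := S (1 + be); have Sc := S (1 + al * be).
rewrite /sum4 !(galf_mul, galD, one, eone, eal, ebe, sal, sbe, tal, tbe, galN) in S1 Sa Sb Sc.
have {}Sa := Sa erefl; have {}Sb := Sb erefl; have {}Sc := Sc erefl.
set y1 := s y in S1 Sa Sb Sc; set y2 := t y in S1 Sa Sb Sc; set y3 := s y2 in S1 Sa Sb Sc.
have lin (A B C c : M) : A = 0 -> B = 0 -> C = A - c * B -> C = 0.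
  by move=> -> -> ->; rewrite mulr0 subrr.
have Sa' : 2%:R * al * (y ^+ 2 + y1 ^+ 2 - y2 ^+ 2 - y3 ^+ 2) = 0.
  by apply: (lin _ _ _ (1 + al ^+ 2) Sa S1); ring.
have Sb' : 2%:R * be * (y ^+ 2 - y1 ^+ 2 + y2 ^+ 2 - y3 ^+ 2) = 0.
  by apply: (lin _ _ _ (1 + be ^+ 2) Sb S1); ring.
have Sc' : 2%:R * (al * be) * (y ^+ 2 - y1 ^+ 2 - y2 ^+ 2 + y3 ^+ 2) = 0.
  by apply: (lin _ _ _ (1 + (al * be) ^+ 2) Sc S1); ring.
have cancel (c x : M) : c != 0 -> 2%:R * c * x = 0 -> x = 0.
  by move=> cn /eqP; rewrite !mulf_eq0 (negPf two_neq0) (negPf cn) => /eqP.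
have {}Sa := cancel _ _ aln Sa'; have {}Sb := cancel _ _ ben Sb'.
have {}Sc := cancel _ _ (mulf_neq0 aln ben) Sc'.
have : 2%:R * 2%:R * (y ^+ 2) = 0.
  apply: (lin _ _ _ (-1) (lin _ _ _ (-1) S1 Sa erefl)
    (lin _ _ _ (-1) Sb Sc erefl)); ring.
move=> /(cancel _ _ two_neq0)/eqP; rewrite sqrf_eq0; exact/negP.
Qed.

Lemma witt_quaternion :
  isometric (diag_form [tuple a; b; a * b]) (diag_form [tuple 1; 1; 1]).
Proof.
have [x0 ex0 n0] := sum4_neq0; rewrite /sum4 in n0.
set x1 := s x0 in n0; set x2 := t x0 in n0; set x3 := s x2 in n0.
(* On [x0], [x1], [x2], [x3] the maps [s] and [t] act as left multiplication by i and j acts on the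
   quaternions 1, i, j, k. In particular they fix [n]. *)
have sx1 : s x1 = - x0 by rewrite sse.
have sx2 : s x2 = x3 by [].
have sx3 : s x3 = - x2 by rewrite sse -teC ex0 galN.
have tx2 : t x2 = - x0 by rewrite tte.
have tx1 : t x1 = - x3 by rewrite tsE -/x2 -seC -teC ex0 !galN.
have tx3 : t x3 = x1 by rewrite tsE tx2 galN -/x1 galN -seC ex0 galN opprK.
set n := _ + x3 ^+ 2 in n0.
have sn : s n = n by rewrite /n !galD !expr2 !galf_mul -/x1 sx1 sx2 sx3; ring.
have tn : t n = n by rewrite /n !galD !expr2 !galf_mul -/x2 tx1 tx2 tx3; ring.
(* Apart from the row factors, [s] negates the last two rows and [t] the first and third. The
   factors [al], [be], [al * be] change by the same signs, so every entry is fixed. *)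
pose r (i j : 'I_3) : M := nth 0 (nth [::] [::
  [:: al * (x0 ^+ 2 + x1 ^+ 2 - x2 ^+ 2 - x3 ^+ 2) / n;
      al * (2%:R * (x1 * x2 - x0 * x3)) / n;
      al * (2%:R * (x1 * x3 + x0 * x2)) / n];
  [:: be * (2%:R * (x1 * x2 + x0 * x3)) / n;
      be * (x0 ^+ 2 - x1 ^+ 2 + x2 ^+ 2 - x3 ^+ 2) / n;
      be * (2%:R * (x2 * x3 - x0 * x1)) / n];
  [:: al * be * (2%:R * (x1 * x3 - x0 * x2)) / n;
      al * be * (2%:R * (x2 * x3 + x0 * x1)) / n;
      al * be * (x0 ^+ 2 - x1 ^+ 2 - x2 ^+ 2 + x3 ^+ 2) / n]] i) j.
have two g : (g : gal_of {:M}) 2%:R = 2%:R by apply: rmorph_nat.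
have rF i j : exists c : F, r i j = c%:A.
  apply: st_fixed; case: i => [[|[|[|i]]] hi] //; case: j => [[|[|[|j]]] hj] //;
    rewrite /r /= !(galf_mul, galf_inv, galD, galN, expr2, two, sn, tn, sal, sbe, tal, tbe);
    rewrite -?/x1 -?/x2 ?(sx1, sx2, sx3, tx1, tx2, tx3); ring.
have /choice[p pE] : forall ij : 'I_3 * 'I_3, exists c : F, r ij.1 ij.2 = c%:A.
  by move=> [i j]; apply: rF.
have -> : [tuple 1; 1; 1] = [tuple (1 : F) | _ < 3].
  by apply: eq_from_tnth => i; rewrite tnth_mktuple; case: i => [[|[|[|i]]] hi].
apply: (@isometric_orthogonal _ _ _ (fun i j => p (i, j))).
  by case=> [[|[|[|i]]] hi] //; rewrite (tnth_nth 0) /= ?mulf_neq0.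
move=> i k; apply: (fmorph_inj (in_alg M)); rewrite rmorph_sum /=.
transitivity (\sum_j r i j * r k j).
  by apply: eq_bigr => j _; rewrite !(pE (_, _)) -[RHS](rmorphM (in_alg M)).
rewrite !big_ord_recl big_ord0 (tnth_nth 0).
have abE : (a * b)%:A = al ^+ 2 * be ^+ 2 by rewrite al2 be2 -[RHS](rmorphM (in_alg M)).
case: i => [[|[|[|i]]] hi] //; case: k => [[|[|[|k]]] hk] //; rewrite /r /=;
  rewrite ?mul0r ?scale0r ?mul1r -?al2 -?be2 ?abE; rewrite /n in n0 *; field; exact: n0.
Qed.

End WittQuaternion.

(** * Octic Galois subfields *)

Lemma eq_on_adjoin (F : fieldType) (K : fieldExtType F) (R : nzRingType)
    (f g : {rmorphism K -> R}) (U : {subfield K}) (x : K) :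
  {in U, f =1 g} -> f x = g x -> {in <<U; x>>%VS, f =1 g}.
Proof.
move=> fgU fgx y /Fadjoin_polyP[p pU ->]; rewrite -!horner_map /= fgx.
congr (_.[_]); apply/polyP => i; rewrite !coef_map /=; apply: fgU.
exact: (polyOverP pU).
Qed.

Lemma sqrt_sign (F : fieldType) (K : splittingFieldType F) (g : gal_of {:K})
    (x : K) (c : F) : x ^+ 2 = c%:A -> g x = x \/ g x = - x.
Proof.
move=> xc; have : g x ^+ 2 == x ^+ 2 by rewrite expr2 -galf_mul -expr2 xc gal_scale.
by rewrite eqf_sqr => /orP[] /eqP ->; [left|right].
Qed.

Lemma sqrt_separable (F : fieldType) (K : fieldExtType F) (x : K) (c : F) :
  2%:R != 0 :> K -> x ^+ 2 = c%:A -> separable_element 1%VS x.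
Proof.
move=> two xc; have [->|x0] := eqVneq x 0.
  by apply: base_separable; apply: mem0v.
apply/separable_elementP; exists ('X^2 - (c%:A)%:P); split.
- rewrite rpredB ?rpredX ?polyOverX// polyOverC; exact: rpredZ (mem1v _).
- by rewrite rootE !hornerE xc subrr.
have -> : 'X^2 - (c%:A)%:P = \prod_(y <- [:: x; - x]) ('X - y%:P).
  by rewrite !big_cons big_nil mulr1 polyCN opprK -xc [x ^+ 2]expr2 polyCM; ring.
rewrite separable_prod_XsubC /= inE andbT eq_sym -subr_eq0 -opprD oppr_eq0.
by rewrite -mulr2n -mulr_natl mulf_neq0.
Qed.

Section Biquadratic.
Variables (F : fieldType) (a b : F) (K : splittingFieldType F) (al be : K).
Hypotheses (al2 : al ^+ 2 = a%:A) (be2 : be ^+ 2 = b%:A).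
Hypotheses (a0 : a != 0) (b0 : b != 0).
Hypothesis two : 2%:R != 0 :> K.
Hypothesis K_gen : <<1 & [:: al; be]>>%VS = fullv.
Variables (sigma tau : gal_of {:K}).
Hypotheses (sal : sigma al = - al) (sbe : sigma be = be).
Hypotheses (tal : tau al = al) (tbe : tau be = - be).

Lemma biquad_galois : galois 1%VS {:K}.
Proof.
apply/and3P; split; [exact: sub1v | | exact: normalFieldf].
rewrite -K_gen; apply: separable_Fadjoin_seq => /=.
by rewrite (sqrt_separable two al2) (sqrt_separable two be2).
Qed.

Lemma biquad_eq (R : nzRingType) (f g : {rmorphism K -> R}) :
  (forall c : F, f c%:A = g c%:A) -> f al = g al -> f be = g be -> f =1 g.
Proof.
move=> fg1 fga fgb x; have : x \in <<1 & [:: al; be]>>%VS by rewrite K_gen memvf.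
rewrite !adjoin_cons adjoin_nil subfield_closed; apply: eq_on_adjoin => //.
by apply: eq_on_adjoin => // _ /vlineP[c ->].
Qed.

Let aln : al != 0.
Proof. by apply: contra a0 => /eqP z; rewrite -(fmorph_eq0 (in_alg K)) /= -al2 z expr0n. Qed.
Let ben : be != 0.
Proof. by apply: contra b0 => /eqP z; rewrite -(fmorph_eq0 (in_alg K)) /= -be2 z expr0n. Qed.
Let nalE x : x != 0 -> (- x == x :> K) = false.
Proof.
move=> xn; rewrite -subr_eq0 -opprD oppr_eq0 -mulr2n -mulr_natl mulf_eq0.
by rewrite (negPf two) (negPf xn).
Qed.

Lemma biquad_gal_eq (g h : gal_of {:K}) : g al = h al -> g be = h be -> g = h.
Proof.
move=> ga gb; apply/eqP/gal_eqP => x _.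
by apply: (biquad_eq (f := g) (g := h)) => // c /=; rewrite !gal_scale.
Qed.

Lemma biquad_gal (g : gal_of {:K}) :
  [\/ g = 1%g, g = sigma, g = tau | g = (sigma * tau)%g].
Proof.
have galN (h : gal_of {:K}) x : h (- x) = - h x by apply: rmorphN.
have sta : (sigma * tau)%g al = - al by rewrite galMf sal galN tal.
have stb : (sigma * tau)%g be = - be by rewrite galMf sbe tbe.
have [ga|ga] := sqrt_sign g al2; have [gb|gb] := sqrt_sign g be2.
- by constructor 1; apply: biquad_gal_eq; rewrite gal_id.
- by constructor 3; apply: biquad_gal_eq; rewrite ?ga ?gb ?tal ?tbe.
- by constructor 2; apply: biquad_gal_eq; rewrite ?ga ?gb ?sal ?sbe.
- by constructor 4; apply: biquad_gal_eq; rewrite ?ga ?gb ?sta ?stb.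
Qed.

(** Square roots generating the three quadratic subfields of [K]. *)
Definition quad_gen : seq K := [:: al; be; al * be].

Lemma quad_gen_neq (d d' : K) : d \in quad_gen -> d' \in quad_gen -> d != d' ->
  exists rho : gal_of {:K}, rho d = d /\ rho d' = - d'.
Proof.
have galN (h : gal_of {:K}) x : h (- x) = - h x by apply: rmorphN.
rewrite !inE => /or3P[] /eqP -> /or3P[] /eqP ->; rewrite ?eqxx// => _.
- by exists tau; rewrite tal tbe.
- by exists tau; rewrite galf_mul tal tbe mulrN.
- by exists sigma; rewrite sal sbe.
- by exists sigma; rewrite galf_mul sal sbe mulNr.
- by exists (sigma * tau)%g; rewrite !galMf !(galf_mul, galN, sal, sbe, tal, tbe) mulrNN.
- by exists (sigma * tau)%g; rewrite !galMf !(galf_mul, galN, sal, sbe, tal, tbe) mulrNN.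
Qed.

Lemma quad_gen_sq (d : K) : d \in quad_gen -> exists c : F, d ^+ 2 = c%:A.
Proof.
rewrite !inE => /or3P[] /eqP ->; [by exists a|by exists b|exists (a * b)].
rewrite exprMn al2 be2; exact/esym/(rmorphM (in_alg K)).
Qed.

Lemma quad_gen_neq0 (d : K) : d \in quad_gen -> d != 0.
Proof. by rewrite !inE => /or3P[] /eqP -> //; apply: mulf_neq0. Qed.

(** The set [S] may fail to be a group. If it contained two of [sigma], [tau] and their product,
    only [F] would be fixed, of dimension 1. So it contains at most one of them, some square root is
    fixed by [S], and it generates by dimension. *)
Lemma quad_subfield (S : {set gal_of {:K}}) : \dim (fixedField S) = 2%N ->
  exists2 d, d \in quad_gen & fixedField S = <<1; d>>%VS.
Proof.
move=> dim2; have galN (h : gal_of {:K}) x : h (- x) = - h x by apply: rmorphN.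
have [d dq dS] : exists2 d, d \in quad_gen & d \in fixedField S.
  have inS d : (forall g, g \in S -> g d = d) -> d \in fixedField S.
    by move=> gd; apply/fixedFieldP; rewrite ?memvf.
  have all1 : (forall x, x \in fixedField S -> sigma x = x /\ tau x = x) -> False.
    move=> H; suff : (fixedField S <= 1)%VS by move/dimvS; rewrite dim2 dimv1.
    apply/subvP => x /H[sx tx]; have [c ->] : exists c : F, x = c%:A.
      apply: (gal_invariant biquad_galois) => g.
      by have [->|->|->|->] := biquad_gal g; rewrite ?galMf ?sx ?tx ?gal_id.
    exact: rpredZ (mem1v _).
  have fixS x g : x \in fixedField S -> g \in S -> g x = x.
    by move=> /mem_fixedFieldP[_]; apply.
  have [Ss|Ss] := boolP (sigma \in S); have [St|St] := boolP (tau \in S).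
  - by case: all1 => x xS; rewrite !(fixS x).
  - have [Su|Su] := boolP ((sigma * tau)%g \in S).
      case: all1 => x xS; have sx := fixS x _ xS Ss; split=> //.
      by have := fixS x _ xS Su; rewrite galMf sx.
    exists be; first by rewrite !inE eqxx orbT.
    apply: inS => g gS; have [ge|ge|ge|ge] := biquad_gal g; rewrite ge ?gal_id//.
      by rewrite -ge gS in St.
    by rewrite -ge gS in Su.
  - have [Su|Su] := boolP ((sigma * tau)%g \in S).
      case: all1 => x xS; have tx := fixS x _ xS St; split=> //.
      have := fixS x _ xS Su; rewrite galMf -{2}tx => stx.
      by apply: (fmorph_inj tau).
    exists al; first by rewrite !inE eqxx.
    apply: inS => g gS; have [ge|ge|ge|ge] := biquad_gal g; rewrite ge ?gal_id//.
      by rewrite -ge gS in Ss.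
    by rewrite -ge gS in Su.
  exists (al * be); first by rewrite !inE eqxx !orbT.
  apply: inS => g gS; have [ge|ge|ge|ge] := biquad_gal g; rewrite ge ?gal_id//.
  - by rewrite -ge gS in Ss.
  - by rewrite -ge gS in St.
  by rewrite galMf !(galf_mul, galN, sal, sbe, tal, tbe) mulrNN.
exists d => //; apply/esym/eqP; rewrite eqEdim; apply/andP; split.
  by apply/FadjoinP; split=> //; apply: sub1v.
rewrite dim2 dim_Fadjoin dimv1 muln1 ltn_neqAle eq_sym adjoin_deg_eq1.
rewrite andbC; apply/andP; split.
  by rewrite lt0n; apply/eqP => z; have := adim_gt0 <<1; d>>%AS; rewrite dim_Fadjoin z.
apply/negP => /vlineP[c dc].
have [d' d'q dd'] : exists2 d', d' \in quad_gen & d' != d.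
  have [dal|dal] := eqVneq d al; last by exists al; rewrite ?inE ?eqxx// eq_sym.
  exists be; first by rewrite !inE eqxx orbT.
  rewrite dal; apply/eqP => ba; move: sal; rewrite -ba sbe ba => /esym/eqP.
  by rewrite nalE.
have [rho [_ rd]] := quad_gen_neq d'q dq dd'.
move: rd; rewrite dc gal_scale -dc => /esym/eqP.
by rewrite nalE// quad_gen_neq0.
Qed.

Lemma biquad_dim : \dim {:K} = 4%N.
Proof.
have galN (h : gal_of {:K}) x : h (- x) = - h x by apply: rmorphN.
rewrite -(card_galf biquad_galois).
pose s := [:: 1%g; sigma; tau; (sigma * tau)%g].
have sT g : g \in s by have [] := biquad_gal g => ->; rewrite !inE eqxx ?orbT.
rewrite cardT -[4%N]/(size s); apply/perm_size/uniq_perm; first exact: enum_uniq.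
  apply: (@map_uniq _ _ (fun g : gal_of {:K} => (g al == al, g be == be))).
  by rewrite /= !galMf !gal_id sal sbe !galN ?tal ?tbe !eqxx !nalE.
by move=> g; rewrite mem_enum sT.
Qed.

End Biquadratic.

Lemma central_division_ring (F : fieldType) (A : falgType F) :
  central_division_algebra A -> division_ring A.
Proof.
by move=> [Au _] x /Au xu; exists x^-1; rewrite mulVr ?divrr.
Qed.

Lemma central_division_center (F : fieldType) (A : falgType F) (z : A) :
  central_division_algebra A -> (forall x, z * x = x * z) ->
  exists c : F, z = c%:A.
Proof.
move=> [_ ZA] zx; have : z \in 'Z({:A})%VS.
  by rewrite memv_cap memvf; apply/centvP => x _; apply: zx.
by rewrite ZA => /vlineP[c ->]; exists c.
Qed.

Lemma lrmorph_scalar (F : fieldType) (L : fieldExtType F) (A : falgType F)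
    (f : {lrmorphism L -> A}) (c : F) : f c%:A = c%:A.
Proof. by rewrite linearZ /= rmorph1. Qed.

Lemma gal_transport (F : fieldType) (K M : splittingFieldType F)
    (A : falgType F) (iota : {lrmorphism K -> A}) (j : {lrmorphism M -> A}) :
  (forall x : K, exists y : M, j y = iota x) ->
  exists2 i : {rmorphism K -> M}, forall x, j (i x) = iota x &
    forall c : F, i c%:A = c%:A.
Proof.
move=> /choice[f fP]; have jI := fmorph_inj j.
have fB : zmod_morphism f by move=> x y; apply: jI; rewrite /= fP !rmorphB /= !fP.
have fM : monoid_morphism f.
  split; first by apply: jI; rewrite /= fP !rmorph1.
  by move=> x y; apply: jI; rewrite /= fP !rmorphM /= !fP.
pose i : {rmorphism K -> M} :=
  HB.pack f (GRing.isZmodMorphism.Build _ _ f fB) (GRing.isMonoidMorphism.Build _ _ f fM).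
exists i => // c; apply: jI; rewrite [LHS]fP.
rewrite lrmorph_scalar; exact/esym/lrmorph_scalar.
Qed.

(** * Inertia in an octic extension containing K *)

Section LocalStructure.
Variables (F : fieldType) (A : falgType F).
Hypothesis F_global : global_field F.
Hypothesis A_div : central_division_algebra A.
Variables (a b : F) (K : splittingFieldType F) (al be : K).
Hypotheses (al2 : al ^+ 2 = a%:A) (be2 : be ^+ 2 = b%:A).
Hypotheses (a0 : a != 0) (b0 : b != 0).
Hypothesis two : 2%:R != 0 :> F.
Hypothesis K_gen : <<1 & [:: al; be]>>%VS = fullv.
Variables (sigma tau : gal_of {:K}).
Hypotheses (sal : sigma al = - al) (sbe : sigma be = be).
Hypotheses (tal : tau al = al) (tbe : tau be = - be).
Variables (iota : {lrmorphism K -> A}) (M : splittingFieldType F).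
Variables (j : {lrmorphism M -> A}) (i : {rmorphism K -> M}).
Hypotheses (ji : forall x, j (i x) = iota x) (iF : forall c : F, i c%:A = c%:A).
Hypotheses (galM : galois 1%VS {:M}) (dimM : \dim {:M} = 8%N).

Lemma two_ext (L : fieldExtType F) : 2%:R != 0 :> L.
Proof. by rewrite -(rmorph_nat (in_alg L)) fmorph_eq0. Qed.

Lemma gal_restrict (s : gal_of {:M}) : exists rho : gal_of {:K},
  forall x, s (i x) = i (rho x).
Proof.
have galN (h : gal_of {:K}) x : h (- x) = - h x by apply: rmorphN.
suff [rho [ra rb]] : exists rho : gal_of {:K}, s (i al) = i (rho al) /\ s (i be) = i (rho be).
  exists rho; apply: (biquad_eq K_gen (f := s \o i) (g := i \o rho)) => // c /=.
  by rewrite iF gal_scale -iF gal_scale.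
have ial2 : i al ^+ 2 = a%:A by rewrite -rmorphXn al2 iF.
have ibe2 : i be ^+ 2 = b%:A by rewrite -rmorphXn be2 iF.
have [->|->] := sqrt_sign s ial2; have [->|->] := sqrt_sign s ibe2.
- by exists 1%g; rewrite !gal_id.
- by exists tau; rewrite tal tbe rmorphN.
- by exists sigma; rewrite sal sbe rmorphN.
by exists (sigma * tau)%g; rewrite !galMf sal sbe galN tal tbe !rmorphN.
Qed.

(** The inertia field refers to some extension [w'] of [v] to [K], while [I] is the inertia group of
    the valuation that [M] inherits from [A]. The uniqueness lemmas place the restriction to [K] of
    an element of [I] in the inertia group of [w'], so it fixes [d]. Being odd and not 1 modulo 4,
    [q] is 3 modulo 4. *)
Lemma local_structure (V : oag) (v : valuation F V) (E : {vspace K}) (q : nat) :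
  nondyadic v -> extends_to A v -> is_inertia_field v E -> \dim E = 2%N ->
  residue_card v q -> (q <> 1 %[mod 4])%N ->
  exists d (I : {group gal_of {:M}}),
  [/\ [/\ d \in quad_gen al be & E = <<1; d>>%VS], tame_group I q,
      {in I, forall s : gal_of {:M}, s (i d) = i d} & (q %% 4)%N = 3%N].
Proof.
move=> v_nd [W [wA wA_ext]] [W' [w' [w'_ext EE]]] dimE v_card q14.
have Ad := central_division_ring A_div.
have Acen (L : splittingFieldType F) (f : {lrmorphism L -> A}) z :
    (forall x, z * x = x * z) -> exists c : F, z = f c%:A.
  move=> /(central_division_center A_div)[c ->]; exists c.
  by rewrite lrmorph_scalar.
have Fcen (L : splittingFieldType F) (f : {lrmorphism L -> A}) (c : F) x :
    f c%:A * x = x * f c%:A.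
  by rewrite lrmorph_scalar mulr_algl mulr_algr.
have galK := biquad_galois al2 be2 (two_ext K) K_gen.
pose w := val_comp (fmorph_inj j) wA.
pose wK := val_comp (fmorph_inj iota) wA.
have w_gal (g : gal_of {:M}) x : w (g x) = w x.
  by apply: (galois_invariant_val wA galM Ad (Fcen _ j) (Acen _ j)).
have wK_gal (g : gal_of {:K}) x : wK (g x) = wK x.
  by apply: (galois_invariant_val wA galK Ad (Fcen _ iota) (Acen _ iota)).
have wiE x : w (i x) = wK x by rewrite /= ji.
have restr (L : splittingFieldType F) (f : {lrmorphism L -> A}) :
    val_extends (in_alg L) v (val_comp (fmorph_inj f) wA).
  move: wA_ext => [phi [phile wAE]]; exists phi; split=> // x.
  by rewrite -wAE /= lrmorph_scalar.
have w_ext : val_extends (in_alg M) v w by apply: restr.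
have wK_ext : val_extends (in_alg K) v wK by apply: restr.
have v2 : v 2%:R = Some 0.
  apply: res_eq0P; first exact: val_nat.
  by rewrite res_nat; apply: contra v_nd => r2; rewrite inE.
(* Since [v] is nondyadic, the group order 8 is a unit and inertia is tame. *)
have w8 : w #|{: gal_of {:M}}|%:R = Some 0.
  rewrite (card_galf galM) dimM (_ : 8%N = (2 * 2 * 2)%N)// !natrM !val_mul.
  have -> : w 2%:R = Some 0; last by rewrite /= !addr0.
  move: w_ext => [phi [_ wE]]; have := wE 2%:R.
  by rewrite /= scaler_nat v2 /= raddf0.
have w_cyc : cyclic_val w.
  have [g [x0 [vx0 vP]]] := global_cyclic v F_global.
  have [phi [_ wE]] := w_ext.
  apply: (@cyclic_val_ext _ _ _ w (phi g)) => c c0.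
  have [k vc] := vP c c0; exists k.
  by rewrite (wE c : w c%:A = _) vc /= raddfMz.
have [phi [phiP genI]] := residue_frobenius galM w_gal w_ext w8 v_card.
have [chi [chi1 chiM chiI chiphi]] := inertia_character w_gal w8 q w_cyc.
have q3 : (q %% 4)%N = 3%N.
  have [_ _ [p [n [pp pk qE q1]]]] := finite_field_card v_card.
  have p2 : p != 2%N by apply: contra v_nd => /eqP <-.
  have oq : odd q.
    rewrite qE oddX; have [e|->] := even_prime pp; last by rewrite orbT.
    by rewrite e in p2.
  have := q14; rewrite (modn_small (_ : 1 < 4)%N)//; lia.
have dimF : \dim (fixedField (inertia_group w')) = 2%N by rewrite -EE.
have [d dq dE] := quad_subfield al2 be2 a0 b0 (two_ext K) K_gen sal sbe tal tbe dimF.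
exists d, (inertia_gp w_gal); split=> //.
- by split; rewrite // EE.
- exists phi, (residue_field w), chi; split=> //.
    exact: chiphi.
  by move=> g; have [k Ik] := genI g; exists k; apply/inertiaP.
move=> s /inertiaP Is; have [rho rhoE] := gal_restrict s.
rewrite rhoE; congr (i _).
have : d \in fixedField (inertia_group w') by rewrite dE memv_adjoin.
move=> /mem_fixedFieldP[_]; apply; rewrite inE; apply/asboolP => x w'x.
apply: (unique_val_gt0_sub galK wK_gal wK_ext w'_ext).
have wKx : vle (Some 0) (wK x) by apply: (unique_val_ge0 galK wK_gal wK_ext w'_ext).
by rewrite -wiE rmorphB -rhoE; apply: Is; rewrite wiE.
Qed.

End LocalStructure.

Lemma card_index2 (gT : finGroupType) (G H : {group gT}) :
  H \subset G -> (exists2 g, g \in G & g \notin H) ->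
  (forall g h, g \in G -> h \in G -> g \notin H -> h \notin H -> (g * h)%g \in H) ->
  #|G| = (2 * #|H|)%N.
Proof.
move=> HG [g gG gH] H2.
have -> : G = (H :|: H :* g)%g :> {set gT}.
  apply/setP => x; rewrite inE mem_rcoset; have [xH|xH] := boolP (x \in H).
    by rewrite (fintype.subsetP HG).
  apply/idP/idP => [xG|xg]; first by apply: H2; rewrite ?groupV.
  by rewrite -(mulgKV g x) groupM// (fintype.subsetP HG).
rewrite cardsU card_rcoset.
rewrite [(H :&: _)%g](_ : _ = finset.set0) ?cards0 ?subn0 ?mul2n ?addnn//.
apply/setP => x; rewrite !inE mem_rcoset; apply/negP => /andP[xH xg].
by move: xg; rewrite (groupMl _ xH) groupV (negPf gH).
Qed.

Definition gal_stab (F : fieldType) (M : splittingFieldType F) (x : M) :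
  {set gal_of {:M}} := [set g : gal_of {:M} | g x == x]%SET.

Lemma gal_stab_group_set (F : fieldType) (M : splittingFieldType F) (x : M) :
  group_set (gal_stab x).
Proof.
apply/group_setP; split=> [|g h]; first by rewrite inE gal_id.
by rewrite !inE galMf => /eqP-> /eqP->.
Qed.

Canonical gal_stab_group (F : fieldType) (M : splittingFieldType F) (x : M) :=
  Group (gal_stab_group_set x).

Lemma gal_stabE (F : fieldType) (M : splittingFieldType F) (x : M)
  (g : gal_of {:M}) : (g \in gal_stab x) = (g x == x).
Proof. by rewrite inE. Qed.

Section OcticGaloisGroup.
Variables (F : fieldType) (M : splittingFieldType F).
Hypothesis galM : galois 1%VS {:M}.
Hypothesis two : 2%:R != 0 :> M.

(** Take [g] negating [y]. If it negates [x] as well, use an [h] moving [x * y], which negates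
    exactly one of the two: either [h] or [g * h] works. *)
Lemma gal_separate (x y : M) (c d : F) : x ^+ 2 = c%:A -> y ^+ 2 = d%:A ->
  x \notin 1%VS -> y \notin 1%VS -> x * y \notin 1%VS ->
  exists g : gal_of {:M}, g x = x /\ g y = - y.
Proof.
move=> x2 y2 nx ny nxy.
have galN (h : gal_of {:M}) z : h (- z) = - h z by apply: rmorphN.
have mov z : z \notin 1%VS -> exists g : gal_of {:M}, g z != z.
  move=> nz; apply: contrapT => /forallNP gz; case/negP: nz.
  have [|u ->] := gal_invariant galM (x := z); last exact: rpredZ (mem1v _).
  by move=> g; apply/eqP/negPn/negP/gz.
have [g gy] := mov _ ny; have {}gy : g y = - y.
  by have [e|//] := sqrt_sign g y2; rewrite e eqxx in gy.
have [gx|gx] := sqrt_sign g x2; first by exists g.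
have [h] := mov _ nxy; rewrite galf_mul.
have [hx|hx] := sqrt_sign h x2; have [hy|hy] := sqrt_sign h y2; rewrite hx hy => hxy.
- by rewrite eqxx in hxy.
- by exists h.
- by exists (g * h)%g; rewrite !galMf gx gy !galN hx hy opprK.
- by rewrite mulrNN eqxx in hxy.
Qed.

(* The group is quaternion by quaternion_square, so Witt's criterion applies. *)
Lemma octic_isometric (al be : M) (a b : F) (d : bool -> M)
    (I : bool -> {group gal_of {:M}}) (q : bool -> nat) :
  \dim {:M} = 8%N -> al ^+ 2 = a%:A -> be ^+ 2 = b%:A -> a != 0 -> b != 0 ->
  al \notin 1%VS -> be \notin 1%VS -> al * be \notin 1%VS ->
  (forall k, exists c : F, d k ^+ 2 = c%:A) ->
  (forall k, d k \notin 1%VS) -> d true * d false \notin 1%VS ->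
  (forall g : gal_of {:M}, (forall k, g (d k) = d k) <-> (g al = al /\ g be = be)) ->
  (forall k, tame_group (I k) (q k)) ->
  (forall k, {in I k, forall s : gal_of {:M}, s (d k) = d k}) ->
  (forall k, (q k %% 4)%N = 3%N) ->
  isometric (diag_form [tuple a; b; a * b]) (diag_form [tuple 1; 1; 1]).
Proof.
move=> dim8 al2 be2 a0 b0 nal nbe nab d2 nd ndd dab tameI Id q3.
have galN (h : gal_of {:M}) z : h (- z) = - h z by apply: rmorphN.
have n0 x : x \notin 1%VS -> x != 0 by apply: contra => /eqP->; apply: mem0v.
have nE (x : M) : x != 0 -> (- x == x) = false.
  move=> xn; rewrite -subr_eq0 -opprD oppr_eq0 -mulr2n -mulr_natl mulf_eq0.
  by rewrite (negPf two) (negPf xn).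
pose H k := [group of gal_stab (d k)].
have HE k g : (g \in H k) = (g (d k) == d k) by rewrite gal_stabE.
have nHE k g : g \notin H k -> g (d k) = - d k.
  have [c dc] := d2 k; rewrite HE.
  by have [->|//] := sqrt_sign g dc; rewrite eqxx.
have H2 k g h : g \notin H k -> h \notin H k -> (g * h)%g \in H k.
  by move=> /nHE gd /nHE hd; rewrite HE galMf gd galN hd opprK.
have ndd' k : d k * d (~~ k) \notin 1%VS by case: k; rewrite // mulrC.
have HN k : exists2 g, g \in H k & g \notin H (~~ k).
  have [[c dc] [c' dc']] := (d2 k, d2 (~~ k)).
  have [g [g1 g2]] := gal_separate dc dc' (nd k) (nd _) (ndd' k).
  by exists g; rewrite HE ?g1// g2 nE ?n0.
pose N := [group of H true :&: H false]%SET.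
have NiE x : (x \in N) = (x \in H true) && (x \in H false) by rewrite finset.in_setI.
(* Fixing [d true], then also [d false], halves the order 8 each time. *)
have cardN : #|N| = 2%N.
  have c8 : #|[set: gal_of {:M}]%G| = 8%N by rewrite cardsT card_galf.
  have c4 : #|[set: gal_of {:M}]%G| = (2 * #|H true|)%N.
    apply: card_index2; first exact: finset.subsetT.
      by have [g _ gn] := HN false; exists g => //; rewrite inE.
    by move=> g h _ _; apply: H2.
  have c2 : #|H true| = (2 * #|N|)%N.
    apply: card_index2; first exact: subsetIl.
      by have [g gt gn] := HN true; exists g => //; rewrite NiE gt.
    move=> g h gt ht.
    by rewrite !NiE gt ht groupM//=; apply: H2.
  lia.
have [e eN e1] : exists2 e, e \in N & e != 1%g.
  apply/trivgPn; apply/negP => /eqP N1.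
  by move: cardN; rewrite N1 cards1.
have NE n : n \in N -> n = 1%g \/ n = e.
  move=> nN; have [->|n1] := eqVneq n 1%g; [by left | right].
  apply/eqP; apply: contraT => ne.
  have : (#|[set 1%g; e; n]%SET| <= #|N|)%N.
    apply/subset_leq_card/fintype.subsetP => x.
    rewrite 2!finset.in_setU !finset.in_set1.
    by case/orP => [/orP[]|] /eqP -> //; apply: group1.
  rewrite cardN finset.setUC cardsU1 cards2 !inE negb_or n1 ne eq_sym e1.
  by [].
have [eT eF] : e \in H true /\ e \in H false by move: eN; rewrite NiE => /andP.
have quat g : ~~ ((g \in H true) && (g \in H false)) -> (g * g)%g = e.
  apply: (quaternion_square (I := I) (q := q)) => //.
  - move=> k; apply/fintype.subsetP => s Is; rewrite HE; apply/eqP.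
    exact: Id.
  - by move=> n nT nF; apply: NE; rewrite NiE nT nF.
  - by case.
have notN (g : gal_of {:M}) : g al != al \/ g be != be -> ~~ ((g \in H true) && (g \in H false)).
  move=> gab; apply/negP => /andP[gT gF].
  have [|ga gb] := (dab g).1; first by case; apply/eqP; rewrite -HE.
  by case: gab; rewrite ?ga ?gb eqxx.
have [s [sal sbe]] := gal_separate al2 be2 nal nbe nab.
have [t [tbe tal]] : exists g : gal_of {:M}, g be = be /\ g al = - al.
  by apply: (gal_separate be2 al2) => //; rewrite mulrC.
have eab : e al = al /\ e be = be.
  by apply/dab; case; apply/eqP; rewrite -HE.
have e_inv (g : gal_of {:M}) : g al = al -> g be = be -> g = 1%g \/ g = e.
  move=> ga gb; apply: NE; rewrite NiE !HE.
  by rewrite !((dab g).2 (conj ga gb)) !eqxx.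
apply: (@witt_quaternion F M s t e al be) => //.
- by apply: quat; apply: notN; right; rewrite sbe nE// n0.
- by apply: quat; apply: notN; left; rewrite tal nE// n0.
- by apply: quat; apply: notN; left; rewrite galMf sal tal nE// n0.
- have [//|eee] := NE (e * e)%g (groupM eN eN).
  by case/eqP: e1; apply: (mulgI e); rewrite eee mulg1.
move=> y sy ty; apply: (gal_invariant galM) => g.
have ey : e y = y.
  have <- : (s * s)%g = e by apply: quat; apply: notN; right; rewrite sbe nE// n0.
  by rewrite galMf !sy.
have fixg (h : gal_of {:M}) : h y = y -> (h^-1)%g y = y.
  by move=> {1}<-; rewrite -galMf mulgV gal_id.
(* Every [g] agrees on [al] and [be] with one of 1, [s], [t], [s * t], so it differs from that
   element by 1 or [e], and all of these fix [y]. *)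
have red (h : gal_of {:M}) : h y = y -> (g * h^-1)%g al = al -> (g * h^-1)%g be = be -> g y = y.
  move=> hy gha ghb; have ghy : (g * h^-1)%g y = y.
    by have [->|->] := e_inv _ gha ghb; rewrite ?gal_id.
  by rewrite -[g](mulgKV h) galMf ghy.
have inv_sign (h : gal_of {:M}) z (u : M) : h z = u -> (h^-1)%g u = z.
  by move=> <-; rewrite -galMf mulgV gal_id.
have [ga|ga] := sqrt_sign g al2; have [gb|gb] := sqrt_sign g be2.
- by apply: (red 1%g); rewrite ?gal_id// invg1 mulg1.
- by apply: (red s) => //; rewrite galMf ?ga ?gb; apply: inv_sign.
- by apply: (red t) => //; rewrite galMf ?ga ?gb; apply: inv_sign.
apply: (red (s * t)%g); rewrite ?galMf ?sy ?ty// ?ga ?gb; apply: inv_sign.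
- by rewrite galMf sal tal.
- by rewrite galMf sbe galN tbe.
Qed.

End OcticGaloisGroup.

Section NoGaloisOctic.
Variables (F : fieldType) (A : falgType F).
Hypothesis F_global : global_field F.
Hypothesis F_char : 2%N \notin [pchar F].
Hypothesis A_div : central_division_algebra A.
Variables (a b : F) (K : splittingFieldType F) (al be : K).
Hypotheses (al2 : al ^+ 2 = a%:A) (be2 : be ^+ 2 = b%:A).
Hypotheses (a0 : a != 0) (b0 : b != 0).
Hypothesis K_gen : <<1 & [:: al; be]>>%VS = fullv.
Variables (sigma tau : gal_of {:K}).
Hypotheses (sal : sigma al = - al) (sbe : sigma be = be).
Hypotheses (tal : tau al = al) (tbe : tau be = - be).
Variable iota : {lrmorphism K -> A}.

Lemma char_neq2 : 2%:R != 0 :> F.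
Proof. by apply: contra F_char => h; rewrite inE. Qed.

Let twoK : 2%:R != 0 :> K.
Proof. exact/two_ext/char_neq2. Qed.

Let nE (L : fieldExtType F) (x : L) : x != 0 -> (- x == x) = false.
Proof.
move=> xn; rewrite -subr_eq0 -opprD oppr_eq0 -mulr2n -mulr_natl mulf_eq0.
by rewrite (negPf (two_ext char_neq2 L)) (negPf xn).
Qed.

Let notin1 (x : K) (rho : gal_of {:K}) : x != 0 -> rho x = - x -> x \notin 1%VS.
Proof.
move=> xn rx; apply/negP => /vlineP[c xc]; move: rx; rewrite xc gal_scale -xc.
by move/esym/eqP; rewrite nE.
Qed.

Let galN (h : gal_of {:K}) x : h (- x) = - h x.
Proof. exact: rmorphN. Qed.

Lemma quad_gen_notin1 d : d \in quad_gen al be -> d \notin 1%VS.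
Proof.
move=> dq; have dn := quad_gen_neq0 al2 be2 a0 b0 dq.
move: dq dn; rewrite !inE => /or3P[] /eqP -> dn.
- exact: notin1 dn sal.
- exact: notin1 dn tbe.
by apply: (notin1 (rho := sigma) dn); rewrite galf_mul sal sbe mulNr.
Qed.

Lemma quad_gen_mul_notin1 d d' : d \in quad_gen al be -> d' \in quad_gen al be ->
  d != d' -> d * d' \notin 1%VS.
Proof.
move=> dq d'q dd'; have qn := quad_gen_neq0 al2 be2 a0 b0.
have [rho [rd rd']] := quad_gen_neq sal sbe tal tbe dq d'q dd'.
apply: (notin1 (rho := rho)); first by rewrite mulf_neq0 ?qn.
by rewrite galf_mul rd rd' mulrN.
Qed.

Lemma no_galois_octic
    (ab_form : ~ isometric (diag_form [tuple a; b; a * b])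
                           (diag_form [tuple 1; 1; 1]))
    (V1 V2 : oag) (v1 : valuation F V1) (v2 : valuation F V2) :
  nondyadic v1 -> nondyadic v2 -> extends_to A v1 -> extends_to A v2 ->
  forall E1 E2 : {vspace K},
  is_inertia_field v1 E1 -> is_inertia_field v2 E2 ->
  \dim E1 = 2%N -> \dim E2 = 2%N -> E1 <> E2 ->
  forall q1 q2, residue_card v1 q1 -> residue_card v2 q2 ->
  (q1 <> 1 %[mod 4])%N -> (q2 <> 1 %[mod 4])%N ->
  ~ exists (M : splittingFieldType F) (j : {lrmorphism M -> A}),
       [/\ galois 1%VS {:M}, \dim {:M} = 8%N &
           forall x : K, exists y : M, j y = iota x].
Proof.
move=> nd1 nd2 ext1 ext2 E1 E2 in1 in2 dim1 dim2 E12 q1 q2 c1 c2 m1 m2.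
case=> M [j [galM dimM KM]].
have [i ji iF] := gal_transport KM.
have [d1 [I1 [[d1q E1d] T1 Id1 q13]]] := local_structure F_global A_div al2 be2 a0 b0
  char_neq2 K_gen sal sbe tal tbe ji iF galM dimM nd1 ext1 in1 dim1 c1 m1.
have [d2 [I2 [[d2q E2d] T2 Id2 q23]]] := local_structure F_global A_div al2 be2 a0 b0
  char_neq2 K_gen sal sbe tal tbe ji iF galM dimM nd2 ext2 in2 dim2 c2 m2.
have d12 : d1 != d2 by apply/eqP => d12; apply: E12; rewrite E1d E2d d12.
have i_notin1 x : x \notin 1%VS -> i x \notin 1%VS.
  apply: contra => /vlineP[c]; rewrite -iF => /(fmorph_inj i) ->.
  exact: rpredZ (mem1v _).
have isq x c : x ^+ 2 = c%:A -> i x ^+ 2 = c%:A by move=> xc; rewrite -rmorphXn xc iF.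
pose d k := i (if k then d1 else d2).
pose I k := if k then I1 else I2.
pose q k := if k then q1 else q2.
have dq k : (if k then d1 else d2) \in quad_gen al be by case: k.
apply: ab_form.
apply: (@octic_isometric F M galM (two_ext char_neq2 M) (i al) (i be) a b d I q) => //.
- exact: isq.
- exact: isq.
- by apply/i_notin1/quad_gen_notin1; rewrite !inE eqxx.
- by apply/i_notin1/quad_gen_notin1; rewrite !inE eqxx orbT.
- by rewrite -rmorphM; apply/i_notin1/quad_gen_notin1; rewrite !inE eqxx !orbT.
- by move=> k; have [c dc] := quad_gen_sq al2 be2 (dq k); exists c; apply: isq.
- by move=> k; apply/i_notin1/quad_gen_notin1.
- by rewrite -rmorphM; apply/i_notin1/quad_gen_mul_notin1.
(* [d1] and [d2] are two of the three square roots, and any two of these determine the action of [g]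
   on the third. *)
- move=> g; split=> [gd|[ga gb] k]; last first.
    have := dq k; rewrite /d !inE; set x := if k then _ else _.
    by move=> /or3P[] /eqP ->; rewrite ?rmorphM /= ?galf_mul ?ga ?gb.
  have n0 x : x \in quad_gen al be -> i x != 0.
    by move=> /(quad_gen_neq0 al2 be2 a0 b0); rewrite fmorph_eq0.
  have := gd true; have := gd false; rewrite /d /=.
  have al0 : i al != 0 by apply: n0; rewrite !inE eqxx.
  have be0 : i be != 0 by apply: n0; rewrite !inE eqxx orbT.
  have galab : g (i (al * be)) = g (i al) * g (i be) by rewrite rmorphM /= galf_mul.
  have iab : i (al * be) = i al * i be by rewrite rmorphM.
  have cl x y : x != 0 -> g x = x -> g x * g y = x * y -> g y = y.
    by move=> xn ->; apply: mulfI.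
  have cr x y : y != 0 -> g y = y -> g x * g y = x * y -> g x = x.
    by move=> yn ->; apply: mulIf.
  move: d1q d2q d12; rewrite !inE => /or3P[] /eqP -> /or3P[] /eqP ->; rewrite ?eqxx// => _ h2 h1.
  - by split=> //; apply: (cl (i al)) => //; rewrite -galab h2 iab.
  - by split=> //; apply: (cr _ (i be)) => //; rewrite -galab h2 iab.
  - by split=> //; apply: (cl (i al)) => //; rewrite -galab h1 iab.
  - by split=> //; apply: (cr _ (i be)) => //; rewrite -galab h1 iab.
- by case.
- by case.
- by case.
Qed.

End NoGaloisOctic.

(** * The Mal'cev-Neumann division algebra *)

Section LeadingTerm.
Variables (G : oag) (A : nzRingType).
Implicit Types (f g : G -> A) (c d : G).
Local Notation le := (@oag_le G).

Lemma conv_lead f g m n :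
  (forall c, f c != 0 -> le m c) -> (forall c, g c != 0 -> le n c) ->
  conv f g (m + n) = f m * g n.
Proof.
move=> fm gn; rewrite (@convE _ _ _ _ _ [:: m]) => //; last first.
  move=> x /mul_neq0[/fm mx /gn nx]; rewrite inE; apply/eqP/oag_anti => //.
  have := go_add (oag_leP G) (x - n) nx.
  by rewrite [n + _]addrC subrK addrA subrK addrK.
by rewrite big_seq1 [m + n]addrC addrK.
Qed.

Lemma conv_support_ge f g m n c :
  (forall c, f c != 0 -> le m c) -> (forall c, g c != 0 -> le n c) ->
  conv f g c != 0 -> le (m + n) c.
Proof.
move=> fm gn /conv_neq0[x /mul_neq0[/fm mx /gn nx]].
by rewrite -[c](subrK x) addrC; apply: oag_add.
Qed.

Definition single d (b : A) : G -> A := fun c => if c == d then b else 0.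

Lemma conv_single_r f d b c : conv f (single d b) c = f (c - d) * b.
Proof.
rewrite (@convE _ _ _ _ _ [:: c - d]) => //.
  by rewrite big_seq1 /single subKr eqxx.
move=> x /mul_neq0[_]; rewrite /single inE.
by case: (c - x =P d) => [<- _|_]; rewrite ?subKr eqxx.
Qed.

Lemma conv_single_l f d b c : conv (single d b) f c = b * f (c - d).
Proof.
rewrite (@convE _ _ _ _ _ [:: d]) => //.
  by rewrite big_seq1 /single eqxx.
by move=> x /mul_neq0[+ _]; rewrite /single inE; case: (x == d); rewrite ?eqxx.
Qed.

Lemma conv_commute f g : well_ordered (fsupp f) -> well_ordered (fsupp g) ->
  (forall c d, f c * g d = g d * f c) -> conv f g =1 conv g f.
Proof.
move=> wf wg fg c; have [s [us sP]] := conv_seq c wf wg.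
rewrite (convE us); last by move=> x /mul_neq0[fx gx]; apply: sP.
rewrite (@convE _ _ _ _ _ [seq c - x | x <- s]).
- by rewrite big_map; apply: eq_bigr => x _; rewrite subKr fg.
- by rewrite map_inj_uniq// => x y /(congr1 (fun z => c - z)); rewrite !subKr.
move=> x /mul_neq0[gx fx]; apply/mapP; exists (c - x); last by rewrite subKr.
by apply: sP; rewrite ?subKr.
Qed.

Lemma well_ordered_single d b : well_ordered (fsupp (single d b)).
Proof.
apply: (well_ordered_sub _ (@well_ordered1 G d)) => c; rewrite /fsupp /single /=.
by case: (c =P d) => // _; rewrite eqxx.
Qed.

End LeadingTerm.

Section MalcevNeumannSeries.
Variables (F : fieldType) (A : falgType F) (K : splittingFieldType F).
Variables (iota : {lrmorphism K -> A}) (G : oag) (D : mn_data iota G).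
Local Notation eps := (mn_eps D).
Local Notation le := (@oag_le G).
Implicit Types (x y z : mn_ring D) (c d : G).

(* The series sum_c a_c r_c is faithfully represented by the function
   c |-> u_(eps c) r_c, and the twisted product becomes plain convolution. *)
Definition tw x : G -> A := mn_twist D (mn_coef x).

Lemma tw_wo x : well_ordered (fsupp (tw x)).
Proof. by rewrite fsupp_twist; apply: mn_supp. Qed.

Lemma tw_inj x y : tw x =1 tw y -> x = y.
Proof. move=> h; apply: mn_ringP; apply: (@twist_inj _ _ _ _ _ D); exact: funext h. Qed.

Lemma tw_mul x y : tw (x * y) =1 conv (tw x) (tw y).
Proof. by move=> c; rewrite /tw /= twist_mul//; apply: mn_supp. Qed.

Lemma tw_add x y c : tw (x + y) c = tw x c + tw y c.
Proof. by rewrite /tw /mn_twist /= mulrDr. Qed.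

Lemma tw_opp x c : tw (- x) c = - tw x c.
Proof. by rewrite /tw /mn_twist /= mulrN. Qed.

Lemma tw0 c : tw 0 c = 0.
Proof. by rewrite /tw /mn_twist /= mulr0. Qed.

Lemma eps0 : eps 0 = 1%g.
Proof. by apply: (mulgI (eps 0)); rewrite -mn_epsD addr0 mulg1. Qed.

Lemma tw1 : tw 1 =1 single 0 1.
Proof.
move=> c; rewrite /tw /mn_twist /single /=; case: eqP => [->|]; last by rewrite mulr0.
by rewrite eps0 mn_u1 mulr1.
Qed.

Lemma tw_sum (I : Type) (r : seq I) (P : pred I) (f : I -> mn_ring D) c :
  tw (\sum_(i <- r | P i) f i) c = \sum_(i <- r | P i) tw (f i) c.
Proof.
elim: r => [|i r IHr]; first by rewrite !big_nil tw0.
by rewrite !big_cons; case: ifP => // _; rewrite tw_add IHr.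
Qed.

(** Together with [tw_surj] this identifies the ring with the functions of well-ordered support
    whose value at each [c] lies in the eigenspace of [A] for [eps c]. *)
Lemma tw_eigen x c : eigen iota (eps c) (tw x c).
Proof.
move=> k; have /centralizerP rC := mn_coefP x c.
by rewrite /tw /mn_twist mulrA -u_intertwine -!mulrA rC.
Qed.

Lemma tw_surj (f : G -> A) : (forall c, eigen iota (eps c) (f c)) ->
  well_ordered (fsupp f) -> exists x, tw x =1 f.
Proof.
move=> fe fw; pose r c := (mn_u D (eps c))^-1 * f c.
have uf c : mn_u D (eps c) * r c = f c by rewrite mulVKr ?mn_u_unit.
have rC c : r c \in centralizer iota.
  apply/centralizerP => k; rewrite /r -mulrA.
  have [k' ->] := gal_surj (eps c) k.
  by rewrite -fe mulrA uV_intertwine mulrA.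
have rw : well_ordered (fsupp r).
  apply: (well_ordered_sub _ fw) => c; rewrite /fsupp /=; apply: contra => /eqP f0.
  by rewrite /r f0 mulr0.
by exists (@MNRing _ _ _ _ _ D r rC rw) => c; rewrite /tw /mn_twist /= uf.
Qed.

Lemma single_surj d b : eigen iota (eps d) b -> exists x, tw x =1 single d b.
Proof.
move=> bd; apply: tw_surj; last exact: well_ordered_single.
move=> c k; rewrite /single; case: eqP => [->|_]; first exact: bd.
by rewrite mulr0 mul0r.
Qed.

Lemma scalar_surj d (a : F) : eps d = 1%g -> exists x, tw x =1 single d a%:A.
Proof.
by move=> ed; apply: single_surj => k; rewrite ed gal_id mulr_algl mulr_algr.
Qed.

Definition is_lead x m := tw x m != 0 /\ forall c, tw x c != 0 -> le m c.

Lemma is_lead_uniq x m n : is_lead x m -> is_lead x n -> m = n.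
Proof. by move=> [xm mP] [xn nP]; apply: oag_anti; [apply: mP | apply: nP]. Qed.

Lemma lead_ex x : x != 0 -> exists m, is_lead x m.
Proof.
move=> x0; have [c xc] : exists c, tw x c != 0.
  apply: contrapT => /forallNP nc; case/eqP: x0; apply: tw_inj => c.
  by rewrite tw0; apply/eqP/negPn/negP/nc.
have [||m xm mP] := @tw_wo x (fsupp (tw x)).
- by move=> z.
- by exists c.
- by exists m.
Qed.

Definition lead x : option G :=
  match pselect (exists m, is_lead x m) with
  | left h => Some (sval (cid h)) | right _ => None end.

Lemma leadP x m : lead x = Some m <-> is_lead x m.
Proof.
rewrite /lead; case: pselect => [h|nh]; last first.
  by split=> // h; case: nh; exists m.
case: (cid h) => n /= hn; split=> [[<-]//|hm].
by rewrite (is_lead_uniq hm hn).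
Qed.

Lemma lead_None x : lead x = None <-> x = 0.
Proof.
split=> [xN|->].
  apply/eqP/negPn/negP => /lead_ex[m] /leadP; by rewrite xN.
rewrite /lead; case: pselect => // h; exfalso.
by case: h => m []; rewrite tw0 eqxx.
Qed.

Lemma lead_ge x m : vle (Some m) (lead x) <-> forall c, tw x c != 0 -> le m c.
Proof.
case xl: (lead x) => [n|] /=.
  have [xn nP] := (leadP x n).1 xl.
  split=> [mn c /nP|]; first exact: oag_trans.
  exact.
split=> // _ c; have /lead_None -> := xl.
by rewrite tw0 eqxx.
Qed.

Lemma lead_gt x m : vle (Some m) (lead x) -> vlt (Some m) (lead x) = (tw x m == 0).
Proof.
case xl: (lead x) => [n|] /=; last first.
  by have /lead_None -> := xl; rewrite tw0 eqxx.
have [xn nP] := (leadP x n).1 xl; rewrite /vlt /= => mn.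
apply/idP/idP => [|/eqP xm0]; last first.
  by apply/negP => nm; case/eqP: xn; rewrite -xm0; congr (tw x _); apply: oag_anti.
by apply: contraR => xm; apply: nP.
Qed.

Lemma lead_add x y : vle (vmin (lead x) (lead y)) (lead (x + y)).
Proof.
case mE: (vmin (lead x) (lead y)) => [m|]; last first.
  move: mE; rewrite /vmin; case: ifP => h e.
    have ye : lead y = None by move: h; rewrite e; case: (lead y).
    have /lead_None -> := e; have /lead_None -> := ye.
    by rewrite add0r (_ : lead 0 = None)//; apply/lead_None.
  by rewrite e vle_None in h.
have [mx my] : vle (Some m) (lead x) /\ vle (Some m) (lead y).
  rewrite -mE /vmin; case: ifP => h; rewrite vle_refl; split=> //.
  by have := vle_total (lead x) (lead y); rewrite h.
apply/lead_ge => c; rewrite tw_add => xyc.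
have [xc|xc] := eqVneq (tw x c) 0.
  by rewrite xc add0r in xyc; move/lead_ge: my; apply.
by move/lead_ge: mx; apply.
Qed.

Hypothesis A_div : division_ring A.

Lemma lead_mul x y : lead (x * y) = vadd (lead x) (lead y).
Proof.
case xl: (lead x) => [m|] /=; last first.
  by have /lead_None -> := xl; rewrite mul0r; apply/lead_None.
case yl: (lead y) => [n|] /=; last first.
  by have /lead_None -> := yl; rewrite mulr0; apply/lead_None.
have [[xm mP] [yn nP]] := ((leadP x m).1 xl, (leadP y n).1 yl).
apply/leadP; split=> [|c]; rewrite tw_mul; last exact: conv_support_ge.
rewrite conv_lead//; apply/eqP => /(division_mul_eq0 A_div)[] /eqP.
  exact/negP.
exact/negP.
Qed.

Definition mn_val : valuation (mn_ring D) G := Valuation lead_None lead_add lead_mul.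

Lemma tw_lead_mul x y m n : lead x = Some m -> lead y = Some n ->
  tw (x * y) (m + n) = tw x m * tw y n.
Proof.
move=> /leadP[_ mP] /leadP[_ nP].
by rewrite tw_mul conv_lead.
Qed.

Lemma tw0_mul x y : vle (Some 0) (lead x) -> vle (Some 0) (lead y) ->
  tw (x * y) 0 = tw x 0 * tw y 0.
Proof.
move=> /lead_ge x0 /lead_ge y0.
by rewrite tw_mul -[X in conv _ _ X]addr0 conv_lead.
Qed.

Lemma mn_mul_eq0 x y : x * y = 0 -> x = 0 \/ y = 0.
Proof.
move=> xy; have := lead_mul x y; rewrite xy.
have -> : lead 0 = None by apply/lead_None.
case xl: (lead x) => [m|]; last by left; apply/lead_None.
by case yl: (lead y) => [n|] // _; right; apply/lead_None.
Qed.

End MalcevNeumannSeries.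

(** * Linear algebra and independence of characters *)

Lemma free_subseq (F : fieldType) (V : vectType F) (Y : seq V) :
  exists Z : seq V, [/\ {subset Z <= Y}, free Z & <<Z>>%VS = <<Y>>%VS].
Proof.
elim: Y => [|y Y [Z [ZY Zf ZE]]].
  by exists [::]; split=> //; apply: nil_free.
have [yZ|yZ] := boolP (y \in <<Z>>%VS).
  exists Z; split=> //; first by move=> z /ZY zY; rewrite inE zY orbT.
  by rewrite span_cons -ZE; apply/esym/addv_idPr; rewrite -memvE.
exists (y :: Z); split.
- by move=> z; rewrite !inE => /orP[->//|/ZY ->]; rewrite orbT.
- by rewrite free_cons yZ.
by rewrite !span_cons ZE.
Qed.

Lemma left_kernel (E : fieldType) (I J : finType) (m : I -> J -> E) :
  (#|J| < #|I|)%N ->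
  exists c : I -> E, (exists i, c i != 0) /\ forall k, \sum_i c i * m i k = 0.
Proof.
move=> JI; pose M := \matrix_(i < #|I|, k < #|J|) m (enum_val i) (enum_val k).
have : kermx M != 0.
  by rewrite kermx_eq0 /row_free neq_ltn (leq_ltn_trans (rank_leq_col _)).
case/rowV0Pn => v /sub_kermxP vM v0.
exists (fun i => v 0 (enum_rank i)); split.
  apply: contrapT => /forallNP v00; case/negP: v0; apply/eqP/rowP => k.
  by rewrite mxE -[k]enum_valK; apply/eqP/negPn/negP/v00.
move=> k; have := congr1 (fun N : 'M_(_, _) => N 0 (enum_rank k)) vM.
rewrite !mxE => vMk; rewrite -[RHS]vMk.
rewrite (reindex (@enum_val I predT)) /=; last first.
  by exists enum_rank => i _; [apply: enum_valK | apply: enum_rankK].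
by apply: eq_bigr => i _; rewrite mxE enum_valK enum_rankK.
Qed.

(** Steinitz's bound when [E] acts on the ring [R] through left multiplication: with more vectors
    than generators, the rows of coordinates satisfy a linear relation. *)
Lemma span_indep_le (E : fieldType) (R : nzRingType) (f : {rmorphism E -> R})
    (I J : finType) (e : I -> R) (e' : J -> R) :
  (forall x, exists c : I -> E, x = \sum_i f (c i) * e i) ->
  (forall c : J -> E, \sum_i f (c i) * e' i = 0 -> forall i, c i = 0) ->
  (#|J| <= #|I|)%N.
Proof.
move=> eS e'I; have /choice[C CE] : forall k, exists c : I -> E, e' k = \sum_i f (c i) * e i.
  by move=> k; apply: eS.
rewrite leqNgt; apply/negP => /(left_kernel C)[c [[k ck] cC]].
case/eqP: ck; move: k; apply: e'I; under eq_bigr do rewrite CE mulr_sumr.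
rewrite exchange_big big1// => i _ /=; under eq_bigr do rewrite mulrA -rmorphM.
by rewrite -mulr_suml -rmorph_sum cC rmorph0 mul0r.
Qed.

(** A subspace of largest dimension inside [P] contains every vector of [P], since adding the line
    through a missing one would enlarge it within [P]. *)
Lemma vspace_of_pred (F : fieldType) (V : vectType F) (P : V -> Prop) :
  P 0 -> (forall (a : F) x y, P x -> P y -> P (a *: x + y)) ->
  exists U : {vspace V}, forall x, x \in U <-> P x.
Proof.
move=> P0 PD; pose Q d := `[< exists U : {vspace V}, \dim U = d /\ forall x, x \in U -> P x >].
have Qb d : Q d -> (d <= \dim {:V})%N by move=> /asboolP[U [<- _]]; rewrite dimvS// subvf.
have Q0 : exists d, Q d.
  exists 0%N; apply/asboolP; exists 0%VS; rewrite dimv0; split=> // x.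
  by rewrite memv0 => /eqP ->.
have [d /asboolP[U [dU UP]] dmax] := ex_maxnP Q0 Qb.
exists U => x; split=> [|Px]; first exact: UP.
have UxP y : y \in (U + <[x]>)%VS -> P y.
  by move=> /memv_addP[u /UP Pu [_ /vlineP[a ->] ->]]; rewrite addrC; apply: PD.
have /eqP -> : U == (U + <[x]>)%VS.
  rewrite eqEdim addvSl dU; apply: dmax; apply/asboolP.
  by exists (U + <[x]>)%VS.
by rewrite (subvP (addvSr _ _))// memv_line.
Qed.

(** Dedekind's argument, by induction on the number of nonzero coefficients. Multiplicativity is
    asked at nonzero elements only, to fit maps such as the residue of g x / x. *)
Lemma multiplicative_indep (I : finType) (L K : fieldType) (theta : I -> L -> K) :
  (forall i, theta i 1 = 1) ->
  (forall i x y, x != 0 -> y != 0 -> theta i (x * y) = theta i x * theta i y) ->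
  (forall i k, i != k -> exists2 x, x != 0 & theta i x != theta k x) ->
  forall c : I -> K, (forall x, x != 0 -> \sum_i c i * theta i x = 0) ->
  forall i, c i = 0.
Proof.
move=> th1 thM thS c.
have [m] := ubnP #|[pred i | c i != 0]|; elim: m c => // m IHm c cm cth i.
apply/eqP/negPn/negP => ci0.
have ck0 k : k != i -> c k = 0.
  move=> ki; have [x x0 thx] := thS _ _ ki.
  pose d k := c k * (theta k x - theta i x).
  have : d k = 0.
    apply: IHm => [|y y0].
      rewrite -ltnS (leq_trans _ cm)// ltnS; apply/proper_card/properP; split.
        apply/fintype.subsetP => l; rewrite !inE; apply: contra => /eqP cl.
        by rewrite /d cl mul0r.
      by exists i; rewrite !inE ?ci0// /d subrr mulr0 eqxx.
    transitivity (\sum_l c l * theta l (x * y) - theta i x * \sum_l c l * theta l y).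
      rewrite mulr_sumr -sumrB; apply: eq_bigr => l _.
      by rewrite /d thM//; ring.
    by rewrite !cth ?mulf_neq0// mulr0 subrr.
  by move/eqP; rewrite mulf_eq0 subr_eq0 (negPf thx) orbF => /eqP.
have := cth 1 (oner_neq0 _); rewrite (bigD1 i)//= th1 mulr1 big1 ?addr0.
  by move/eqP; rewrite (negPf ci0).
by move=> k /ck0 ->; rewrite mul0r.
Qed.

(** * The center of the Mal'cev-Neumann ring and a basis over it *)

Section MalcevNeumannCenter.
Variables (F : fieldType) (A : falgType F) (K : splittingFieldType F).
Variables (iota : {lrmorphism K -> A}) (G : oag) (D : mn_data iota G).
Local Notation eps := (mn_eps D).
Hypothesis A_div : central_division_algebra A.
Hypothesis galK : galois 1%VS {:K}.
Hypothesis eps_surj : forall rho : gal_of {:K}, exists c, eps c = rho.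
Implicit Types (x y z : mn_ring D) (c d : G).

Let iotaF (c : F) (a : A) : iota c%:A * a = a * iota c%:A.
Proof. by rewrite lrmorph_scalar mulr_algl mulr_algr. Qed.

(** Commuting with one-term series makes each coefficient of [z] commute with all eigenvectors, and
    these span [A]. A nonzero scalar is an eigenvector for the identity automorphism only. *)
Lemma mn_center_sub z : (forall x, z * x = x * z) ->
  forall c, exists a : F, tw z c = a%:A /\ (a != 0 -> eps c = 1%g).
Proof.
move=> zC c; have Ccomm rho b : eigen iota rho b -> tw z c * b = b * tw z c.
  move=> brho; have [d dE] := eps_surj rho.
  have [x xE] : exists x, tw x =1 single d b by apply: single_surj; rewrite dE.
  have xE' : tw x = single d b by apply/funext.
  have := congr1 (fun y => tw y (c + d)) (zC x).
  by rewrite !tw_mul xE' conv_single_r conv_single_l addrK.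
have [a zcE] : exists a : F, tw z c = a%:A.
  apply: (central_division_center A_div) => b.
  have [_ [P [Pe Psum _ _ _]]] := galois_eigenprojections galK iotaF.
  rewrite (Psum b) mulr_sumr mulr_suml; apply: eq_bigr => g _.
  exact: Ccomm (Pe g b).
exists a; split=> // a0; apply/eqP/gal_eqP => k _; rewrite gal_id.
have := tw_eigen z c k; rewrite zcE mulr_algl mulr_algr => /(scalerI a0).
by move/(fmorph_inj iota).
Qed.

Lemma mn_center_sup z :
  (forall c, exists a : F, tw z c = a%:A) -> forall x, z * x = x * z.
Proof.
move=> zF x; apply: tw_inj => c; rewrite !tw_mul.
apply: conv_commute; try exact: tw_wo.
by move=> e d; have [a ->] := zF e; rewrite mulr_algl mulr_algr.
Qed.

(** The eigenspaces grade [A] by [gal_of {:K}], and the projections of a basis span [A], so they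
    contain a basis of homogeneous elements. *)
Lemma homogeneous_basis : exists (n : nat) (rho : 'I_n -> gal_of {:K}) (b : 'I_n -> A),
  [/\ n = \dim {:A}, forall i, eigen iota (rho i) (b i),
      forall c : 'I_n -> F, \sum_i c i *: b i = 0 -> forall i, c i = 0 &
      forall (x : A) r, eigen iota r x -> exists c : 'I_n -> F,
        x = \sum_i c i *: b i /\ forall i, c i != 0 -> rho i = r].
Proof.
have [_ [P [Pe Psum Pp PD _]]] := galois_eigenprojections galK iotaF.
have P0 g : P g 0 = 0 by apply: (addIr (P g 0)); rewrite -PD !add0r.
pose Y := [seq P g e | g <- index_enum (gal_of {:K}), e <- vbasis {:A}].
have [Z [ZY Zf ZE]] := free_subseq Y.
have YE : <<Y>>%VS = {:A}%VS.
  apply/eqP; rewrite eqEsubv subvf /= -[X in (X <= _)%VS](span_basis (vbasisP _)).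
  apply/span_subvP => e eb; rewrite (Psum e) rpred_sum// => g _.
  by apply: memv_span; apply: allpairs_f => //; apply: mem_index_enum.
pose n := size Z; have /choice[rho rhoP] : forall i : 'I_n, exists r, eigen iota r Z`_i.
  move=> i; have /ZY/allpairsP[[g e] /= [_ _ ->]] : Z`_i \in Z by apply: mem_nth.
  by exists g.
have Zn (c : 'I_n -> F) : \sum_i c i *: Z`_i = 0 -> forall i, c i = 0.
  move=> c0 i; have /freeP := Zf : free (in_tuple Z); apply.
  by rewrite -[RHS]c0; apply: eq_bigr.
exists n, rho, (fun i => Z`_i); split=> //.
  by rewrite -YE -ZE; apply/esym/eqP.
move=> x r xr; have : x \in <<in_tuple Z>>%VS by rewrite ZE YE memvf.
move/coord_span => xE.
have eZ (a : F) i : eigen iota (rho i) (a *: Z`_i).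
  by move=> k; rewrite -scalerAr rhoP scalerAl.
exists (fun i => if rho i == r then coord (in_tuple Z) i x else 0).
split=> [|i]; last by case: (rho i =P r) => // _ /eqP.
have {1}-> : x = P r x by rewrite (Pp _ _ _ xr) eqxx.
rewrite {1}xE (big_morph (P r) (PD r) (P0 r)); apply: eq_bigr => i _.
by rewrite (Pp _ _ _ (eZ _ i)) eq_sym; case: eqP => // _; rewrite scale0r.
Qed.

Section CenterBasis.
Variables (E : fieldType) (f : {rmorphism E -> mn_ring D}).
Hypothesis f_center : forall z, (forall x, z * x = x * z) <-> exists a : E, z = f a.

Lemma mn_basis : exists e : 'I_(\dim {:A}) -> mn_ring D,
  (forall x, exists c : 'I_(\dim {:A}) -> E, x = \sum_i f (c i) * e i) /\
  (forall c : 'I_(\dim {:A}) -> E, \sum_i f (c i) * e i = 0 -> forall i, c i = 0).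
Proof.
have [n [rho [b [nE be bI bS]]]] := homogeneous_basis; rewrite -nE.
have /choice[dl dlP] : forall i, exists d, eps d = rho i by move=> i; apply: eps_surj.
have /choice[e eE] : forall i, exists x, tw x =1 single (dl i) (b i).
  by move=> i; apply: single_surj; rewrite dlP.
have twf (ce : E) i g : tw (f ce * e i) g = tw (f ce) (g - dl i) * b i.
  have eE' : tw (e i) = single (dl i) (b i) by apply/funext.
  by rewrite tw_mul eE' conv_single_r.
exists e; split.
  move=> x; have /choice[c cP] : forall g, exists c : 'I_n -> F,
      tw x g = \sum_i c i *: b i /\ forall i, c i != 0 -> rho i = eps g.
    by move=> g; apply: bS; apply: tw_eigen.
  have /choice[z zP] : forall i, exists z, tw z =1 (fun g => (c (g + dl i) i)%:A).
    move=> i; apply: tw_surj.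
      move=> g k; have [->|cn] := eqVneq (c (g + dl i) i) 0.
        by rewrite scale0r mulr0 mul0r.
      have := (cP (g + dl i)).2 i cn; rewrite mn_epsD dlP => /esym/eqP.
      rewrite eq_mulgV1 mulgK => /eqP ->.
      by rewrite gal_id mulr_algl mulr_algr.
    have wx := @tw_wo _ _ _ _ _ D x.
    apply: (well_ordered_sub _ (well_ordered_sumset wx (@well_ordered1 G (- dl i)))).
    move=> g /= gn; exists (g + dl i), (- dl i); split=> //; last by rewrite addrK.
    rewrite /fsupp /=; apply: contra gn => /eqP xg0.
    have [xE _] := cP (g + dl i); rewrite xg0 in xE.
    by rewrite (bI _ (esym xE)) scale0r.
  have /choice[ce ceE] : forall i, exists a : E, z i = f a.
    move=> i; apply/f_center; apply: mn_center_sup => g.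
    by exists (c (g + dl i) i); rewrite zP.
  exists ce; apply: tw_inj => g; rewrite tw_sum (cP g).1.
  by apply: eq_bigr => i _; rewrite twf -ceE zP subrK mulr_algl.
move=> c c0.
have /choice[a aP] : forall i, exists a : G -> F, tw (f (c i)) =1 fun g => (a g)%:A.
  move=> i; have fC : forall x, f (c i) * x = x * f (c i) by apply/f_center; exists (c i).
  have /choice[a aP] : forall g, exists a : F, tw (f (c i)) g = a%:A.
    by move=> g; have [u [uE _]] := mn_center_sub fC g; exists u.
  by exists a.
move=> i; apply: (fmorph_inj f); rewrite rmorph0; apply: tw_inj => g.
rewrite tw0 aP; have : \sum_k a k (g + dl i - dl k) *: b k = 0.
  rewrite -[RHS](tw0 D (g + dl i)) -[in RHS]c0 tw_sum; apply: eq_bigr => k _.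
  by rewrite twf aP mulr_algl.
by move/bI => /(_ i); rewrite addrK => ->; rewrite scale0r.
Qed.

End CenterBasis.
End MalcevNeumannCenter.

Lemma algebraic_left_inverse (E : fieldType) (R : nzRingType)
    (f : {rmorphism E -> R}) (x : R) (p : {poly E}) :
  (forall y z : R, y * z = 0 -> y = 0 \/ z = 0) -> x != 0 ->
  p != 0 -> (map_poly f p).[x] = 0 -> exists y, y * x = 1.
Proof.
move=> Rdom x0; elim/poly_ind: p => [|p c IHp]; first by rewrite eqxx.
rewrite rmorphD rmorphM /= map_polyX map_polyC /= hornerMXaddC.
have [->|c0 _ pc] := eqVneq c 0.
  rewrite addr0 rmorph0 addr0 => pX px.
  have [px0|/eqP] := Rdom _ _ px; last by rewrite (negPf x0).
  by apply: IHp => //; apply: contra pX => /eqP->; rewrite mul0r.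
exists (- f c^-1 * (map_poly f p).[x]).
move/eqP: pc; rewrite addr_eq0 => /eqP pc.
by rewrite -mulrA pc mulrNN -rmorphM mulVf// rmorph1.
Qed.

(** The powers of [x] are dependent over [E], and in a domain such a relation gives a left inverse,
    which cancellation makes two-sided. This replaces the direct inversion of series. *)
Lemma finite_domain_division (E : fieldType) (R : nzRingType)
    (f : {rmorphism E -> R}) (n : nat) (e : 'I_n -> R) :
  (forall y z : R, y * z = 0 -> y = 0 \/ z = 0) ->
  (forall x, exists c : 'I_n -> E, x = \sum_i f (c i) * e i) -> division_ring R.
Proof.
move=> Rdom eS x x0.
have [c [k [c0 ck]]] : exists c : 'I_n.+1 -> E, exists k,
    \sum_i f (c i) * x ^+ i = 0 /\ c k != 0.
  apply: contrapT => nc.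
  suff : (#|'I_n.+1| <= #|'I_n|)%N by rewrite !card_ord ltnn.
  apply: (span_indep_le (f := f) (e' := fun i : 'I_n.+1 => x ^+ i) eS) => c c0 i.
  by apply/eqP/negPn/negP => ci; apply: nc; exists c, i.
pose p := \poly_(i < n.+1) c (inord i).
have pc i : (i < n.+1)%N -> p`_i = c (inord i) by move=> ni; rewrite coef_poly ni.
have p0 : p != 0.
  apply: contra ck => /eqP p0; have := pc k (ltn_ord k).
  by rewrite p0 coef0 inord_val => <-.
have [|y yx] := @algebraic_left_inverse _ _ f x p Rdom x0 p0.
  rewrite (@horner_coef_wide _ n.+1) ?size_map_poly ?size_poly//.
  rewrite -[RHS]c0; apply: eq_bigr => i _.
  by rewrite coef_map pc ?ltn_ord//= inord_val.
exists y; split=> //; apply/eqP; rewrite -subr_eq0; apply/eqP.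
have : (x * y - 1) * x = 0 by rewrite mulrBl -mulrA yx mulr1 mul1r subrr.
by move=> /Rdom[->//|/eqP]; rewrite (negPf x0).
Qed.

(** * Maximal subfields and residues *)

Section GaloisSubfieldDimension.
Variables (E : fieldType) (L : splittingFieldType E).
Hypothesis galL : galois 1%VS {:L}.
Variables (D : nzRingType) (j : {rmorphism L -> D}).
Hypothesis jE : forall (c : E) d, j c%:A * d = d * j c%:A.
Hypothesis Ddiv : division_ring D.
Hypothesis Dcen : forall z : D, (forall d, z * d = d * z) -> exists c : E, z = j c%:A.

Let jf : {rmorphism E -> D} := j \o in_alg L.

Lemma galois_unit_eigen : exists u v : gal_of {:L} -> D,
  forall g, [/\ eigen j g (u g), u g * v g = 1 & v g * u g = 1].
Proof.
suff /choice[uv uvP] : forall g, exists uv : D * D,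
    [/\ eigen j g uv.1, uv.1 * uv.2 = 1 & uv.2 * uv.1 = 1].
  by exists (fun g => (uv g).1), (fun g => (uv g).2).
move=> g; have [u u0 ue] := skolem_noether galL jE Ddiv Dcen g.
by have [v [uv vu]] := Ddiv u0; exists (u, v).
Qed.

Let a (i : 'I_(\dim {:L})) : L := (vbasis {:L})`_i.

Let aS x : exists c : 'I_(\dim {:L}) -> E, x = \sum_i c i *: a i.
Proof.
exists (fun i => coord (vbasis {:L}) i x).
by rewrite [LHS](coord_vbasis (memvf x)).
Qed.

Let aF (c : 'I_(\dim {:L}) -> E) : \sum_i c i *: a i = 0 -> forall i, c i = 0.
Proof. by move=> c0; apply/freeP; first exact: basis_free (vbasisP _). Qed.

Let jZ (c : E) x : j (c *: x) = jf c * j x.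
Proof. by rewrite -[c *: x]mulr_algl rmorphM. Qed.

(** The products [u g * j (a i)] are independent over [E], because eigenvectors for different [g]
    are independent and each [u g] is invertible. *)
Lemma galois_dim_le (I : finType) (e : I -> D) :
  (forall d, exists c : I -> E, d = \sum_i jf (c i) * e i) ->
  (\dim {:L} * \dim {:L} <= #|I|)%N.
Proof.
have [u [v uvP]] := galois_unit_eigen => eS.
rewrite -{1}(card_galf galL) -[X in (_ * X)%N]card_ord -card_prod.
apply: (span_indep_le (f := jf)
  (e' := fun gi : gal_of {:L} * 'I_(\dim {:L}) => u gi.1 * j (a gi.2)) eS).
move=> c c0 [g i]; pose x h := \sum_k c (h, k) *: a k.
have ux : \sum_h u h * j (x h) = 0.
  transitivity (\sum_h \sum_k jf (c (h, k)) * (u h * j (a k))); last first.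
    by rewrite pair_bigA -[RHS]c0; apply: eq_bigr => -[h k] _.
  apply: eq_bigr => h _; rewrite rmorph_sum mulr_sumr; apply: eq_bigr => k _.
  by rewrite jZ !mulrA -jE.
have /(_ g) ug0 : forall h, u h * j (x h) = 0.
  apply: (eigen_independent galL jE) => // h k.
  have [ue _ _] := uvP h.
  by rewrite mulrA ue -!mulrA -!rmorphM mulrC.
have /eqP : j (x g) = 0.
  by have [_ _ vu] := uvP g; rewrite -[j _]mul1r -vu -mulrA ug0 mulr0.
by rewrite fmorph_eq0 => /eqP /aF.
Qed.

(** When [L] is its own centralizer the same products span: [v g * P g d] centralizes [L], hence
    lies in it. *)
Lemma galois_dim_ge (J : finType) (e : J -> D) :
  (forall d, (forall x, j x * d = d * j x) -> exists x, d = j x) ->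
  (forall c : J -> E, \sum_i jf (c i) * e i = 0 -> forall i, c i = 0) ->
  (#|J| <= \dim {:L} * \dim {:L})%N.
Proof.
have [u [v uvP]] := galois_unit_eigen => Lmax eF.
rewrite -{1}(card_galf galL) -[X in (_ <= _ * X)%N]card_ord -card_prod.
apply: (span_indep_le (f := jf)
  (e := fun gi : gal_of {:L} * 'I_(\dim {:L}) => u gi.1 * j (a gi.2)) _ eF).
move=> d; have [_ [P [Pe Psum _ _ _]]] := galois_eigenprojections galL jE.
have /choice[x xP] : forall g, exists x, P g d = u g * j x.
  move=> g; have [ue uv vu] := uvP g.
  have [|x xE] := Lmax (v g * P g d).
    move=> y; have [y' ->] : exists y', y = g y'.
      by exists ((g^-1)%g y); rewrite -galMf mulVg gal_id.
    have vj : j (g y') * v g = v g * j y'.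
      rewrite -[LHS]mul1r -vu -[LHS]mulrA [u g * (_ * _)]mulrA -ue.
      by rewrite -[j y' * u g * v g]mulrA uv mulr1.
    by rewrite mulrA vj -!mulrA Pe.
  by exists x; rewrite -xE mulrA uv mul1r.
have /choice[c cE] : forall g, exists c : 'I_(\dim {:L}) -> E, x g = \sum_i c i *: a i.
  by move=> g; apply: aS.
exists (fun gi => c gi.1 gi.2).
rewrite [LHS](Psum d) -(pair_bigA _ (fun h k => jf (c h k) * (u h * j (a k)))) /=.
apply: eq_bigr => g _; rewrite xP cE rmorph_sum mulr_sumr; apply: eq_bigr => k _.
by rewrite jZ !mulrA -jE.
Qed.

End GaloisSubfieldDimension.

Section DoubleCommutant.
Local Open Scope classical_set_scope.

(** The double commutant of [N] together with [d] is a commutative subalgebra containing both, so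
    maximality makes it equal to [N]. *)
Lemma maximal_commutative_centralizer (R : nzRingType) (N : set R) :
  maximal_commutative_subalgebra N ->
  forall d, (forall x, N x -> x * d = d * x) -> N d.
Proof.
move=> [[[NZ NB NM] NC] Nmax] d dN.
pose C (S : set R) := [set x | forall y, S y -> x * y = y * x].
pose S := N `|` [set d].
have SC : S `<=` C S.
  move=> x Sx y Sy; case: Sx Sy => [Nx|->] [Ny|->] //.
  - exact: NC.
  - exact: dN.
  by rewrite dN.
have CCS : C (C S) `<=` C S by move=> x xC y Sy; apply: xC; apply: SC.
have SCC : S `<=` C (C S) by move=> x Sx y yC; rewrite yC.
suff <- : C (C S) = N by apply: SCC; right.
apply: Nmax; last by move=> x Nx; apply: SCC; left.
split; last by move=> x y xC yC; apply: xC; apply: CCS.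
split.
- by move=> z zC y _; apply: zC.
- by move=> x y xC yC z zC; rewrite mulrBl mulrBr xC// yC.
by move=> x y xC yC z zC; rewrite -mulrA yC// mulrA xC// mulrA.
Qed.

End DoubleCommutant.

(** * Residues of a maximal Galois subfield *)

Section CrossedProductSubfield.
Variables (F : fieldType) (A : falgType F) (K : splittingFieldType F).
Variables (iota : {lrmorphism K -> A}) (G : oag) (D : mn_data iota G).
Local Notation eps := (mn_eps D).
Hypothesis A_div : central_division_algebra A.
Hypothesis A_deg : has_degree A 8.
Hypothesis two : 2%:R != 0 :> F.
Hypothesis galK : galois 1%VS {:K}.
Hypothesis dimK : (\dim {:K} <= 4)%N.
Hypothesis eps_surj : forall rho : gal_of {:K}, exists c, eps c = rho.
Variables (E : fieldType) (L : splittingFieldType E).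
Variable j : {rmorphism L -> mn_ring D}.
Hypothesis j_center : range (fun c : E => j c%:A) = @ring_center (mn_ring D).
Hypothesis galL : galois 1%VS {:L}.
Hypothesis j_max : maximal_commutative_subalgebra (range j).

Let Adiv : division_ring A := central_division_ring A_div.

Let f : {rmorphism E -> mn_ring D} := j \o in_alg L.

Let f_center (z : mn_ring D) : (forall x, z * x = x * z) <-> exists a : E, z = f a.
Proof.
split=> [zC|[a ->] x].
  have : @ring_center (mn_ring D) z by [].
  by rewrite -j_center => -[a _ <-]; exists a.
have : @ring_center (mn_ring D) (f a) by rewrite -j_center; exists a.
exact.
Qed.

Let jE (c : E) x : j c%:A * x = x * j c%:A.
Proof. by move: x; apply/f_center; exists c. Qed.

Let jcen (z : mn_ring D) : (forall x, z * x = x * z) -> exists c : E, z = j c%:A.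
Proof. exact: (f_center z).1. Qed.

Lemma mn_division : division_ring (mn_ring D).
Proof.
have [e [eS _]] := mn_basis A_div galK eps_surj f_center.
by apply: finite_domain_division eS; apply: mn_mul_eq0.
Qed.

Lemma dimL8 : \dim {:L} = 8%N.
Proof.
have [e [eS eI]] := mn_basis A_div galK eps_surj f_center.
have h1 := galois_dim_le galL jE mn_division jcen eS.
have h2 : (#|'I_(\dim {:A})| <= \dim {:L} * \dim {:L})%N.
  apply: (galois_dim_ge galL jE mn_division jcen _ eI) => d dL.
  have [x _ <-] : range j d; last by exists x.
  by apply: (maximal_commutative_centralizer j_max) => _ [x _ <-].
move: h1 h2; rewrite !card_ord A_deg => h1 h2.
nia.
Qed.

Definition wL : valuation L G := val_comp (fmorph_inj j) (mn_val D Adiv).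

Lemma wL_gal (g : gal_of {:L}) x : wL (g x) = wL x.
Proof. exact: (galois_invariant_val _ galL mn_division jE jcen). Qed.

Lemma tw_nat n c : tw (n%:R : mn_ring D) c = if c == 0 then n%:R else 0.
Proof.
elim: n => [|n IHn]; first by rewrite tw0; case: ifP.
by rewrite mulrS tw_add tw1 IHn /single mulrS; case: ifP; rewrite ?addr0.
Qed.

Lemma wL_card : wL #|{: gal_of {:L}}|%:R = Some 0.
Proof.
rewrite (card_galf galL) dimL8 /= rmorph_nat; apply/leadP.
have n8 : 8%:R != 0 :> A.
  have t : 2%:R != 0 :> A.
    by rewrite -(rmorph_nat (in_alg A)) fmorph_eq0.
  rewrite (_ : 8%N = (2 * 2 * 2)%N)// !natrM; apply/eqP.
  move=> /(division_mul_eq0 Adiv)[/(division_mul_eq0 Adiv)[]|] /eqP; exact/negP.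
split=> [|c]; rewrite tw_nat; first by rewrite eqxx.
by case: (c =P 0) => [-> _|_]; [exact: oag_refl | rewrite eqxx].
Qed.

Lemma no_wild_L (g h : gal_of {:L}) :
  (forall x, x != 0 -> vlt (wL x) (wL (g x - h x))) -> g = h.
Proof.
move=> gh; apply/eqP; rewrite eq_mulgV1; apply/eqP.
apply: (no_wild_inertia wL_gal wL_card) => x x0.
rewrite -(wL_gal h (_ - x)) galMf galfB -galMf mulVg gal_id.
exact: gh.
Qed.

(* This is the residue of x only when x has nonnegative value. *)
Definition resL x : A := tw (j x) 0.

Lemma resL_add x y : resL (x + y) = resL x + resL y.
Proof. by rewrite /resL rmorphD tw_add. Qed.

Lemma resL_mul x y : vle (Some 0) (wL x) -> vle (Some 0) (wL y) ->
  resL (x * y) = resL x * resL y.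
Proof. by move=> x0 y0; rewrite /resL rmorphM tw0_mul. Qed.

Lemma resL1 : resL 1 = 1.
Proof. by rewrite /resL rmorph1 tw1 /single eqxx. Qed.

Lemma resL_eq0 x : vle (Some 0) (wL x) -> (resL x == 0) = vlt (Some 0) (wL x).
Proof. by move=> x0; rewrite /resL -(lead_gt x0). Qed.

Lemma resL_comm x y : vle (Some 0) (wL x) -> vle (Some 0) (wL y) ->
  resL x * resL y = resL y * resL x.
Proof. by move=> x0 y0; rewrite -!resL_mul// mulrC. Qed.

Lemma resL_eigen x : eigen iota 1%g (resL x).
Proof. by move=> k; rewrite /resL (tw_eigen (j x) 0 k) eps0. Qed.

(** Such elements are fixed by the Galois group of [L]. Multiplying by them shifts values within the
    kernel of [eps] and scales residues by [F], compatibly with conjugation. *)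
Lemma central_monomial d (a : F) : eps d = 1%g ->
  exists c : E, tw (j c%:A) =1 single d a%:A.
Proof.
move=> ed; have [z zE] := scalar_surj (D := D) a ed.
have [|c zc] := @jcen z; last by exists c; rewrite -zc.
apply: mn_center_sup => c; rewrite zE /single; case: ifP => _; first by exists a.
by exists 0; rewrite scale0r.
Qed.

Lemma lead_single d (a : F) (z : mn_ring D) : a != 0 ->
  tw z =1 single d a%:A -> lead z = Some d.
Proof.
move=> a0 zE; apply/leadP; split=> [|c]; rewrite zE /single.
  by rewrite eqxx -(rmorph0 (in_alg A)) (inj_eq (fmorph_inj (in_alg A))).
by case: (c =P d) => [-> _|_]; [exact: oag_refl | rewrite eqxx].
Qed.

Lemma resL_scale (a : F) x : vle (Some 0) (wL x) ->
  exists y, [/\ vle (Some 0) (wL y), resL y = a *: resL x &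
    forall g : gal_of {:L}, resL (g y) = a *: resL (g x)].
Proof.
move=> x0; have [c cE] := central_monomial a (eps0 D).
have c0 : vle (Some 0) (wL c%:A).
  apply/lead_ge => d; rewrite cE /single.
  by case: (d =P 0) => [-> _|_]; [exact: oag_refl | rewrite eqxx].
have rc : resL c%:A = a%:A by rewrite /resL cE /single eqxx.
exists (c%:A * x); split.
- by rewrite val_mul -[Some 0]vadd0; apply: vadd_le.
- by rewrite resL_mul// rc mulr_algl.
by move=> g; rewrite galf_mul gal_scale resL_mul ?wL_gal// rc mulr_algl.
Qed.

Lemma resL_sub x y : resL (x - y) = resL x - resL y.
Proof. by rewrite /resL rmorphB tw_add tw_opp. Qed.

Lemma resL_sum (I : Type) (r : seq I) (P : pred I) (h : I -> L) :
  resL (\sum_(i <- r | P i) h i) = \sum_(i <- r | P i) resL (h i).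
Proof. by rewrite /resL rmorph_sum tw_sum. Qed.

Lemma resL_gal (g : gal_of {:L}) x y : vle (Some 0) (wL x) ->
  vle (Some 0) (wL y) -> resL x = resL y -> resL (g x) = resL (g y).
Proof.
move=> x0 y0 xy; apply/eqP; rewrite -subr_eq0 -resL_sub -galfB.
have xy0 : vle (Some 0) (wL (x - y)) by apply: vle_sub.
by rewrite resL_eq0 wL_gal// -resL_eq0// resL_sub xy subrr.
Qed.

(** Only the image of a value under [eps] is recorded, because [central_monomial] realizes every
    value in the kernel by a central element. *)
Definition value_group : {set gal_of {:K}} :=
  [set h | `[< exists x m, wL x = Some m /\ eps m = h >]]%SET.

Lemma value_groupP h :
  reflect (exists x m, wL x = Some m /\ eps m = h) (h \in value_group).
Proof. by rewrite inE; apply: asboolP. Qed.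

Lemma value_group_set : group_set value_group.
Proof.
apply/group_setP; split=> [|h h' /value_groupP[x [m [xm <-]]] /value_groupP[y [n [yn <-]]]].
  by apply/value_groupP; exists 1, 0; rewrite Defs.val1 eps0.
by apply/value_groupP; exists (x * y), (m + n); rewrite val_mul xm yn mn_epsD.
Qed.

Canonical value_group_gp := Group value_group_set.

(* Elements of L commute, so their leading coefficients act trivially on
   residues lying in K. *)
Lemma value_group_fixes h k x : h \in value_group -> vle (Some 0) (wL x) ->
  resL x = iota k -> h k = k.
Proof.
move=> /value_groupP[y [m [ym <-]]] x0 xk.
have [->|k0] := eqVneq k 0; first exact: rmorph0.
have wx : wL x = Some 0.
  have [//|] := vleVlt x0; rewrite -resL_eq0// xk fmorph_eq0 (negPf k0).
  by [].
have := tw_lead_mul ym wx; have := tw_lead_mul wx ym.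
rewrite addr0 add0r -!rmorphM [y * x]mulrC => ->.
rewrite -[tw (j x) 0]/(resL x) xk (tw_eigen (j y) m k) => /eqP.
rewrite -subr_eq0 -mulrBr -rmorphB => /eqP /(division_mul_eq0 Adiv)[] /eqP.
  by have [/negPf-> _] := (leadP _ _).1 ym.
by rewrite fmorph_eq0 subr_eq0 => /eqP.
Qed.

(* Otherwise the homs g |-> res(g x / x) from the nonzero elements of L to the
   units of K would be too many: they are determined by their values on
   |value_group| representatives times a basis of the residue field. *)
Lemma residue_notin_K :
  exists2 x, vle (Some 0) (wL x) & forall k, resL x != iota k.
Proof.
apply: contrapT => nx.
have inK x : vle (Some 0) (wL x) -> exists k, resL x = iota k.
  move=> x0; apply: contrapT => /forallNP nk; apply: nx; exists x => // k.
  by apply/eqP/nk.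
have iI := fmorph_inj iota.
have /choice[kap kapP] : forall r, exists k, forall k', r = iota k' -> k = k'.
  move=> r; have [[k rk]|nk] := pselect (exists k, r = iota k).
    by exists k => k'; rewrite rk => /iI.
  by exists 0 => k' rk'; case: nk; exists k'.
pose rk x := kap (resL x).
have rkE x : vle (Some 0) (wL x) -> iota (rk x) = resL x.
  by move=> /inK[k xk]; rewrite /rk (kapP _ k xk) xk.
have O0 x : wL x = Some 0 -> vle (Some 0) (wL x) by move=> ->; apply: vle_refl.
have wq (g : gal_of {:L}) x : x != 0 -> wL (g x / x) = Some 0.
  move=> xn; have [m xm] := val_neq0 wL xn.
  by apply: (val_div (g := m)); rewrite ?wL_gal.
have rkM x y : vle (Some 0) (wL x) -> vle (Some 0) (wL y) -> rk (x * y) = rk x * rk y.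
  move=> x0 y0; apply: iI; rewrite /= rmorphM /= !rkE//; first exact: resL_mul.
  by rewrite val_mul -[Some 0]vadd0; apply: vadd_le.
have rk1 : rk 1 = 1.
  by apply: iI; rewrite /= rkE ?resL1 ?rmorph1// Defs.val1 vle_refl.
pose theta (g : gal_of {:L}) x := rk (g x / x).
have th1 g : theta g 1 = 1 by rewrite /theta rmorph1 divr1.
have thM g x y : x != 0 -> y != 0 -> theta g (x * y) = theta g x * theta g y.
  move=> xn yn; rewrite /theta -rkM; try by apply: O0; apply: wq.
  by congr rk; rewrite galf_mul invfM; ring.
have thS g h : g != h -> exists2 x, x != 0 & theta g x != theta h x.
  move=> gh; apply: contrapT => nth; case/eqP: gh; apply: no_wild_L => x xn.
  have thx : theta g x = theta h x.
    by apply/eqP/negPn/negP => tx; apply: nth; exists x.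
  have : vlt (Some 0) (wL (g x / x - h x / x)).
    rewrite -resL_eq0; last by apply: vle_sub; apply: O0; apply: wq.
    rewrite resL_sub -!rkE; try by apply: O0; apply: wq.
    by rewrite -/(theta g x) thx subrr.
  have [m xm] := val_neq0 wL xn.
  rewrite -mulrBl val_mul (valV xm) xm => h0.
  have : vlt (vadd (Some m) (Some 0)) (vadd (Some m) (vadd (wL (g x - h x)) (Some (- m)))).
    by apply: vadd_lt => //; apply: vle_refl.
  rewrite vaddC vadd0 vaddC -vaddA.
  by rewrite [vadd (Some _) (Some _)]/= addNr vaddC vadd0.
pose PS k := exists2 x, vle (Some 0) (wL x) & resL x = iota k.
have [||S0 S0P] := @vspace_of_pred F K PS.
- by exists 0; [rewrite val0 | rewrite /resL rmorph0 tw0 rmorph0].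
- move=> a k k' [x x0 xk] [x' x'0 xk']; have [y [y0 yE _]] := resL_scale a x0.
  by exists (y + x'); [apply: vle_add | rewrite resL_add yE xk xk' rmorphD /= linearZ].
(* Residues lie in the fixed field of [value_group], whose dimension times the order of the group is
   at most the degree of [K]. *)
have fH : (\dim S0 * #|value_group_gp| <= 4)%N.
  have S0H : (\dim S0 <= \dim (fixedField value_group_gp))%N.
    apply/dimvS/subvP => k /S0P[x x0 xk]; apply/fixedFieldP; first exact: memvf.
    by move=> h hH; apply: value_group_fixes hH x0 xk.
  rewrite (dim_fixedField value_group_gp); apply: leq_trans dimK.
  by apply: leq_trans (leq_mul S0H (leqnn _)) _; rewrite mulnC leq_trunc_div.
have /choice[y yP] : forall l : 'I_(\dim S0), exists y,
    vle (Some 0) (wL y) /\ resL y = iota (vbasis S0)`_l.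
  move=> l; have /S0P[y y0 yE] : (vbasis S0)`_l \in S0.
    by apply: vbasis_mem; apply: mem_nth; rewrite size_tuple.
  by exists y.
pose H := {h : gal_of {:K} | h \in value_group}.
have /choice[xh xhP] : forall h : H, exists x, exists m, wL x = Some m /\ eps m = \val h.
  by move=> [h hH] /=; apply/value_groupP.
have xh0 h : xh h != 0 by have [m [xm _]] := xhP h; apply: val_neq0E xm.
have ltJI : (#|{: H * 'I_(\dim S0)}| < #|{: gal_of {:L}}|)%N.
  rewrite card_prod card_ord card_sig (card_galf galL) dimL8 mulnC.
  by apply: leq_ltn_trans fH _.
(* Eight automorphisms against at most four coordinates leave a nonzero [c] killing all coordinates.
   It remains to see that this [c] kills [theta g x] for every [x], against independence. *)
have [c [[g cg] cJ]] := left_kernel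
  (fun (g : gal_of {:L}) (hl : H * 'I_(\dim S0)) => theta g (xh hl.1) * rk (g (y hl.2))) ltJI.
case/eqP: cg; move: g; apply: (multiplicative_indep th1 thM thS) => x xn.
have [m xm] := val_neq0 wL xn.
have hH : eps m \in value_group by apply/value_groupP; exists x, m.
pose h : H := exist _ (eps m) hH.
have [n [hn en]] := xhP h.
have emn : eps (m - n) = 1%g.
  by apply: (mulIg (eps n)); rewrite -mn_epsD subrK en mul1g.
have [c0 c0E] := central_monomial 1 emn.
have wc0 : wL c0%:A = Some (m - n) by apply: lead_single c0E; apply: oner_neq0.
have c0n : c0%:A != 0 :> L by apply: val_neq0E wc0.
(* This writes [x] as a central element, on which every [theta g] is 1, times a representative of
   its value class, times a unit [z]. *)
pose z := x / (c0%:A * xh h).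
have wz : wL z = Some 0.
  by apply: (val_div (g := m)) => //; rewrite val_mul wc0 hn /= subrK.
have zn : z != 0 := val_neq0E wz.
have z0 := O0 _ wz.
have xE : x = c0%:A * xh h * z by rewrite mulrC divfK// mulf_neq0.
have thx g : theta g x = theta g (xh h) * theta g z.
  rewrite {1}xE (thM g _ _ (mulf_neq0 c0n (xh0 h)) zn).
  rewrite (thM g _ _ c0n (xh0 h)).
  by rewrite {1}/theta gal_scale divff// rk1 mul1r.
have [k zk] := inK _ z0.
have kS : k \in S0 by apply/S0P; exists z.
have kE : k = \sum_l coord (vbasis S0) l k *: (vbasis S0)`_l by apply: coord_vbasis.
have /choice[zl zlP] : forall l : 'I_(\dim S0), exists u,
    [/\ vle (Some 0) (wL u), resL u = coord (vbasis S0) l k *: resL (y l) &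
    forall g : gal_of {:L}, resL (g u) = coord (vbasis S0) l k *: resL (g (y l))].
  by move=> l; apply: resL_scale; have [] := yP l.
have rkz (s : gal_of {:L}) : rk (s z) = \sum_l coord (vbasis S0) l k *: rk (s (y l)).
  apply: iI; rewrite /= rkE ?wL_gal// (@resL_gal s z (\sum_l zl l)) => //.
  - rewrite raddf_sum resL_sum rmorph_sum; apply: eq_bigr => l _ /=.
    have [_ _ ->] := zlP l; rewrite linearZ /= rkE// wL_gal.
    by have [] := yP l.
  - by apply: vle_sum => l _; have [] := zlP l.
  rewrite zk resL_sum {1}kE rmorph_sum; apply: eq_bigr => l _ /=.
  by have [_ -> _] := zlP l; have [_ ->] := yP l; rewrite linearZ.
have rkz0 : rk z != 0.
  apply/eqP => rz; have : resL z == 0 by rewrite -rkE// rz rmorph0.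
  by rewrite resL_eq0// wz vlt_irr.
(* Multiplication by [rk z] turns [theta g z] into [rk (g z)], which is linear in the residue of [z]
   and thus a combination of the [rk (g (y l))]. *)
suff /eqP : (\sum_g c g * theta g x) * rk z = 0.
  by rewrite mulf_eq0 (negPf rkz0) orbF => /eqP.
rewrite mulr_suml.
transitivity (\sum_g \sum_l coord (vbasis S0) l k *:
    (c g * (theta g (xh h) * rk (g (y l))))).
  apply: eq_bigr => g _; rewrite thx -!mulrA.
  have -> : theta g z * rk z = rk (g z).
    by rewrite /theta -rkM ?divfK//; apply: O0; apply: wq.
  by rewrite rkz !mulr_sumr; apply: eq_bigr => l _; rewrite -!scalerAr.
rewrite exchange_big big1// => l _; rewrite -scaler_sumr.
by rewrite (cJ (h, l)) scaler0.
Qed.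

(** The conjugates of [x] are the roots of a polynomial over the center of the ring. A central
    series has its coefficient at 0 in [F], so reducing this factorization gives one over [F]. *)
Lemma residue_splitting x : vle (Some 0) (wL x) ->
  exists2 rs : seq A,
    resL x \in rs /\ (forall r, r \in rs -> exists2 y, vle (Some 0) (wL y) & resL y = r) &
    forall i, (\prod_(r <- rs) ('X - r%:P))`_i \in 1%VS.
Proof.
move=> x0.
have xg (g : gal_of {:L}) : g x \in val_ring_pred wL by rewrite inE wL_gal.
pose o (g : gal_of {:L}) : val_ring wL := Sub (g x) (xg g).
have oE (g : gal_of {:L}) : \val (o g) = g x by rewrite SubK.
pose rho (u : val_ring wL) := resL (\val u).
have rhoB : zmod_morphism rho by move=> u u'; rewrite /rho rmorphB resL_sub.
have rhoM : monoid_morphism rho.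
  split=> [|u u']; first by rewrite /rho rmorph1 resL1.
  by rewrite /rho rmorphM resL_mul// val_ring_ge0.
pose r : {rmorphism val_ring wL -> A} :=
  HB.pack rho (GRing.isZmodMorphism.Build _ _ rho rhoB) (GRing.isMonoidMorphism.Build _ _ rho rhoM).
pose P := \prod_(g : gal_of {:L}) ('X - (o g)%:P).
have PE i : exists c : E, \val P`_i = c%:A.
  have -> : \val P`_i = (\prod_(g : gal_of {:L}) ('X - (g x)%:P))`_i.
    rewrite -[LHS](coef_map (\val : {rmorphism val_ring wL -> L})); congr (polyseq _)`_i.
    rewrite rmorph_prod; apply: eq_bigr => g _; rewrite -oE. exact: map_polyXsubC.
  apply: (gal_invariant galL) => h; rewrite -coef_map rmorph_prod /=.
  congr (polyseq _)`_i; rewrite [RHS](reindex_inj (@mulIg _ h)) /=.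
  by apply: eq_bigr => g _; rewrite map_polyXsubC /= galMf.
exists [seq (fun g : gal_of {:L} => resL (g x)) g | g <- index_enum (gal_of {:L})].
  split; first by apply/mapP; exists 1%g; rewrite ?mem_index_enum ?gal_id.
  by move=> _ /mapP[g _ ->]; exists (g x); rewrite ?wL_gal.
move=> i; rewrite big_map.
have -> : \prod_(g : gal_of {:L}) ('X - (resL (g x))%:P) = map_poly r P.
  rewrite rmorph_prod; apply: eq_bigr => g _.
  by rewrite -oE; apply/esym/(map_polyXsubC r).
rewrite coef_map /= /rho; have [c ->] := PE i.
have [a [aE _]] := mn_center_sub A_div galK eps_surj (jE c) 0.
by rewrite /resL aE; apply/vlineP; exists a.
Qed.

Lemma residue_algebra : exists S : {vspace A},
  [/\ 1 \in S,
      forall s t, s \in S -> t \in S -> s * t \in S /\ s * t = t * s,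
      forall s k, s \in S -> s * iota k = iota k * s,
      exists2 s, s \in S & forall k, s != iota k &
      forall s, s \in S -> exists2 rs : seq A,
        s \in rs /\ {subset rs <= S} &
        forall i, (\prod_(r <- rs) ('X - r%:P))`_i \in 1%VS].
Proof.
pose PS r := exists2 x, vle (Some 0) (wL x) & resL x = r.
have [||S SP] := @vspace_of_pred F A PS.
- by exists 0; [rewrite val0 | rewrite /resL rmorph0 tw0].
- move=> a _ _ [x x0 <-] [y y0 <-]; have [z [z0 zE _]] := resL_scale a x0.
  by exists (z + y); [apply: vle_add | rewrite resL_add zE].
exists S; split.
- by apply/SP; exists 1; rewrite ?resL1// Defs.val1 vle_refl.
- move=> _ _ /SP[x x0 <-] /SP[y y0 <-]; split; last exact: resL_comm.
  apply/SP; exists (x * y); last exact: resL_mul.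
  by rewrite val_mul -[Some 0]vadd0; apply: vadd_le.
- by move=> _ k /SP[x x0 <-]; rewrite (resL_eigen x k) gal_id.
- by have [x x0 xk] := residue_notin_K; exists (resL x) => //; apply/SP; exists x.
move=> _ /SP[x x0 <-]; have [rs [xrs rsP] rsF] := residue_splitting x0.
by exists rs => //; split=> // r /rsP rP; apply/SP.
Qed.

End CrossedProductSubfield.

(** * The compositum as a Galois subfield of A *)

Lemma commutative_aspace_field (F : fieldType) (A : falgType F) (U : {aspace A}) :
  GRing.field_axiom A -> (forall x y, x \in U -> y \in U -> x * y = y * x) ->
  exists (M : fieldExtType F) (j : {lrmorphism M -> A}),
    forall u, u \in U <-> exists y, j y = u.
Proof.
move=> A_unit U_comm.
pose T : falgType F := subvs_of U.
have TC : commutative (@GRing.mul T).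
  by move=> x y; apply: val_inj; apply: U_comm; apply: subvsP.
pose cT : comUnitRingType := HB.pack T (GRing.PzRing_hasCommutativeMul.Build T TC).
have unitT : GRing.ComUnitRing_isField cT.
  constructor=> x x0; apply: (@vsval_unitr _ _ U); apply: A_unit.
  by apply: contraNneq x0 => x0; apply/eqP/val_inj.
pose M : fieldExtType F := HB.pack T cT unitT.
pose j : M -> A := @vsval _ _ U.
have jL : linear j by move=> a x y.
have jM : monoid_morphism j.
  by split=> [|x y //]; exact: skew_field_algid1.
pose jj : {lrmorphism M -> A} :=
  HB.pack j (GRing.isLinear.Build _ _ _ _ j jL) (GRing.isMonoidMorphism.Build _ _ j jM).
exists M, jj.
move=> u; split=> [uU|[y <-]]; last exact: subvsP.
by exists (Subvs uU).
Qed.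

Lemma splitting_field_of_conjugates (F : fieldType) (M : fieldExtType F) (X : seq M) :
  <<1 & X>>%VS = fullv ->
  (forall x, x \in X -> exists2 rs : seq M,
    x \in rs & \prod_(r <- rs) ('X - r%:P) \is a polyOver 1%VS) ->
  splitting_field_axiom M.
Proof.
move=> genX conjX.
have /choice[rs rsP] : forall x, exists rs : seq M, x \in X ->
    x \in rs /\ \prod_(r <- rs) ('X - r%:P) \is a polyOver 1%VS.
  move=> x; have [/conjX[s xs sP]|] := boolP (x \in X); last by exists [::].
  by exists s.
exists (\prod_(x <- X) \prod_(r <- rs x) ('X - r%:P)).
  by rewrite big_seq; apply: rpred_prod => x /rsP[].
exists (flatten [seq rs x | x <- X]).
  by rewrite big_flatten /= big_map eqpxx.
apply/eqP; rewrite eqEsubv subvf -genX.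
apply/Fadjoin_seqP; split; first exact: subv_adjoin_seq.
move=> x xX; apply: seqv_sub_adjoin; apply/flattenP; exists (rs x).
  exact: map_f.
by have [] := rsP x xX.
Qed.

(** The degree of a minimal polynomial divides the dimension, so it is nonzero in [F] and the
    derivative keeps a nonzero leading coefficient. *)
Lemma coprime_dim_separable (F : fieldType) (M : fieldExtType F) :
  (\dim {:M})%:R != 0 :> F -> separable 1 {:M}.
Proof.
move=> dimM; apply/separableP => y _.
have dM : (adjoin_degree 1 y %| \dim {:M})%N.
  have := field_dimS (subvf <<1; y>>%AS).
  by rewrite dim_Fadjoin dimv1 muln1.
rewrite separable_nz_der; apply/eqP => /(congr1 (fun p : {poly M} => p`_(adjoin_degree 1 y).-1)).
rewrite coef_deriv coef0 prednK ?adjoin_degree_gt0//.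
have /monicP := monic_minPoly 1 y; rewrite /lead_coef size_minPoly /= => ->.
move/eqP; rewrite -scaler_nat scaler_eq0 oner_eq0 orbF => /eqP d0.
case/negP: dimM; have /dvdnP[m ->] := dM.
by rewrite natrM d0 mulr0.
Qed.

(** As a field, [U] is generated by [V] and [W], so it is a splitting field once the elements of
    these have their conjugates in [U]. Separability follows from the dimension, a divisor of one
    that is nonzero in [F]. *)
Lemma galois_subfield_of_conjugates (F : fieldType) (A : falgType F)
    (U : {aspace A}) (V W : {vspace A}) :
  GRing.field_axiom A -> (forall x y, x \in U -> y \in U -> x * y = y * x) ->
  (\dim {:A})%:R != 0 :> F ->
  (U <= V * W)%VS -> (V <= U)%VS -> (W <= U)%VS ->
  (forall u, (u \in V) || (u \in W) -> exists2 rs : seq A,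
     u \in rs /\ {subset rs <= U} &
     forall i, (\prod_(r <- rs) ('X - r%:P))`_i \in 1%VS) ->
  exists (M : splittingFieldType F) (j : {lrmorphism M -> A}),
    [/\ galois 1%VS {:M}, (\dim {:M} %| \dim {:A})%N &
        forall u, u \in U <-> exists y, j y = u].
Proof.
move=> A_unit U_comm dimA sUVW sVU sWU conjVW.
have [M [j jU]] := commutative_aspace_field A_unit U_comm.
have jI := fmorph_inj j.
have jE y : linfun j y = j y by rewrite lfunE.
pose V' := (linfun j @^-1: V)%VS; pose W' := (linfun j @^-1: W)%VS.
pose X := vbasis V' ++ vbasis W'.
have genX : <<1 & X>>%VS = fullv.
  apply/eqP; rewrite eqEsubv subvf /=; apply/subvP => y _.
  have sX Y : {subset vbasis Y <= X} -> (Y <= <<1 & X>>)%VS.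
    move=> YX; rewrite -(span_basis (vbasisP Y)); apply/span_subvP => z zY.
    by apply: seqv_sub_adjoin; apply: YX.
  have sV : (V' <= <<1 & X>>)%VS by apply: sX => z zV; rewrite mem_cat zV.
  have sW : (W' <= <<1 & X>>)%VS by apply: sX => z zW; rewrite mem_cat zW orbT.
  have : (V * W <= linfun j @: <<1 & X>>)%VS.
    apply/prodvP => u v uV vW.
    have /jU[z zu] : u \in U by apply: (subvP sVU).
    have /jU[t tv] : v \in U by apply: (subvP sWU).
    rewrite -zu -tv; have -> : j z * j t = linfun j (z * t) by rewrite jE rmorphM.
    rewrite memv_img// rpredM//.
      by apply: (subvP sV); rewrite -memv_preim jE zu.
    by apply: (subvP sW); rewrite -memv_preim jE tv.
  move/(subv_trans sUVW)/subvP/(_ (j y)).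
  case/(_ _)/memv_imgP; first by apply/jU; exists y.
  by move=> z zX; rewrite jE => /jI->.
have j1 (y : M) : j y \in 1%VS -> y \in 1%VS.
  case/vlineP => k; rewrite -(rmorph_alg j) => /jI->.
  by apply/vlineP; exists k.
have splitM : splitting_field_axiom M.
  apply: (splitting_field_of_conjugates genX) => x xX.
  have /conjVW[rs [xrs rsU] rs1] : (j x \in V) || (j x \in W).
    move: xX; rewrite mem_cat => /orP[/vbasis_mem|/vbasis_mem];
    by rewrite -memv_preim jE => ->; rewrite ?orbT.
  have /choice[k kP] : forall r, exists y, r \in U -> j y = r.
    move=> r; have [/jU[y yr]|] := boolP (r \in U); last by exists 0.
    by exists y.
  exists [seq k r | r <- rs].
    by apply/mapP; exists (j x) => //; apply: jI; exact/esym/kP/rsU.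
  rewrite big_map; apply/polyOverP => i; apply: j1.
  suff -> : j (\prod_(r <- rs) ('X - (k r)%:P))`_i =
      (\prod_(r <- rs) ('X - r%:P))`_i by exact: rs1.
  rewrite -[LHS]coef_map rmorph_prod; congr (polyseq _)`_i.
  rewrite big_seq [RHS]big_seq; apply: eq_bigr => r /rsU/kP rU.
  by rewrite -{2}rU; exact: map_polyXsubC.
pose N : splittingFieldType F := HB.pack M (FieldExt_isSplittingField.Build F M splitM).
have dimU : \dim {:M} = \dim U.
  rewrite -(limg_dim_eq (f := linfun j)); last first.
    by rewrite (_ : lker _ = 0%VS) ?capv0//; apply/eqP/lker0P => y z; rewrite !jE => /jI.
  congr (\dim _); apply/vspaceP => u; apply/idP/idP => [/memv_imgP[y _ ->]|/jU[y <-]].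
    by rewrite jE; apply/jU; exists y.
  by rewrite -jE memv_img ?memvf.
have dimM : (\dim {:M} %| \dim {:A})%N.
  by rewrite dimU; apply: (skew_field_dimS A_unit); exact: subvf.
exists N, j; split=> //; apply/and3P; split; first exact: sub1v.
  apply: (@coprime_dim_separable F N); apply: contra_neq dimA => dM.
  by have /dvdnP[m ->] := dimM; rewrite natrM dM mulr0.
exact: normalFieldf.
Qed.

(** The field is the product [U] of the residue algebra [S] and the image [W] of [K]. Its dimension
    divides 64, exceeds 4 since [s0] is outside [K], and has square at most 64 by [galois_dim_le] in
    [A]. *)
Lemma crossed_product_octic (F : fieldType) (A : falgType F) (K : splittingFieldType F)
    (iota : {lrmorphism K -> A}) (G : oag) (D : mn_data iota G) :
  central_division_algebra A -> has_degree A 8 -> 2%:R != 0 :> F ->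
  galois 1%VS {:K} -> \dim {:K} = 4%N ->
  (forall rho : gal_of {:K}, exists c, mn_eps D c = rho) ->
  crossed_product (mn_ring D) ->
  exists (M : splittingFieldType F) (j : {lrmorphism M -> A}),
    [/\ galois 1%VS {:M}, \dim {:M} = 8%N & forall x : K, exists y : M, j y = iota x].
Proof.
move=> A_div A_deg two galK dimK eps_surj [E [L [j0 [j0_center galL j0_max]]]].
have dimK' : (\dim {:K} <= 4)%N by rewrite dimK.
have [S [S1 SM SK [s0 s0S s0K] Sconj]] :=
  residue_algebra A_div A_deg two galK dimK' eps_surj j0_center galL j0_max.
pose W := limg (linfun iota).
have iW k : iota k \in W by rewrite -[iota k]lfunE memv_img ?memvf.
have WP u : u \in W -> exists k, u = iota k.
  by case/memv_imgP=> k _ ->; exists k; rewrite lfunE.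
have W1 : 1 \in W by have := iW 1; rewrite rmorph1.
have SS : (S * S <= S)%VS by apply/prodvP => s t sS tS; case: (SM _ _ sS tS).
have WW : (W * W <= W)%VS.
  by apply/prodvP => _ _ /WP[k ->] /WP[l ->]; have := iW (k * l); rewrite rmorphM.
have WS : (W * S <= S * W)%VS.
  by apply/prodvP => _ s /WP[k ->] sS; rewrite -SK// memv_mul.
(* As [S] and [W] commute elementwise, a product of two elements of [S * W] can be regrouped into
   [S * S] times [W * W]. *)
have UU : is_aspace (S * W)%VS.
  apply/andP; split; first by apply: has_algid1; rewrite -[1]mulr1 memv_mul.
  rewrite prodvA -[(S * W * S)%VS]prodvA.
  apply: subv_trans (prodvSl _ (prodvSr _ WS)) _.
  by rewrite prodvA -prodvA prodvS.
pose U : {aspace A} := ASpace UU.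
have cU x : x \in S \/ x \in W -> (U <= 'C[x])%VS.
  move=> xSW; apply: prodv_sub; apply/subvP => y yS; apply/cent1vP.
    case: xSW => [xS|/WP[k ->]]; last exact: SK.
    by case: (SM _ _ yS xS).
  case: xSW => [xS|/WP[k ->]]; have [l ->] := WP _ yS; first by rewrite SK.
  by rewrite -!rmorphM mulrC.
have cUU x : x \in U -> (U <= 'C[x])%VS.
  move=> xU; apply/subvP => y yU; rewrite cent1vC; apply: (subvP _ x xU).
  apply: prodv_sub; apply/subvP => z zS; rewrite cent1vC; apply: (subvP _ y yU).
    by apply: cU; left.
  by apply: cU; right.
have sSU : (S <= U)%VS by rewrite -[S]prodv1; apply: prodvSr; rewrite -memvE.
have sWU : (W <= U)%VS by rewrite -[W]prod1v; apply: prodvSl; rewrite -memvE.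
have [] := @galois_subfield_of_conjugates F A U S W.
- by case: A_div.
- by move=> x y xU yU; apply/cent1vP; apply: (subvP (cUU y yU)).
- by rewrite A_deg (_ : 8 ^ 2 = 2 ^ 6)%N // natrX expf_neq0.
- exact: subvv.
- by [].
- by [].
- move=> u /orP[/Sconj[rs [urs rsS] rs1]|/WP[k ->]].
    by exists rs => //; split=> // r /rsS; apply: (subvP sSU).
  exists [seq iota ((g : gal_of {:K}) k) | g <- index_enum (gal_of {:K})].
    split; first by apply/mapP; exists 1%g; rewrite ?mem_index_enum ?gal_id.
    by move=> _ /mapP[g _ ->]; apply: (subvP sWU).
  move=> i; have [c cE] : exists c : F, (\prod_(g : gal_of {:K}) ('X - (g k)%:P))`_i = c%:A.
    apply: (gal_invariant galK) => h; rewrite -coef_map rmorph_prod /=.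
    congr (polyseq _)`_i; rewrite [RHS](reindex_inj (@mulIg _ h)) /=.
    by apply: eq_bigr => g _; rewrite map_polyXsubC /= galMf.
  apply/vlineP; exists c; rewrite -(rmorph_alg iota) -cE -coef_map rmorph_prod big_map.
  by congr (polyseq _)`_i; apply: eq_bigr => g _; apply/esym/(map_polyXsubC iota).
move=> M [j [galM dvdM jU]]; exists M, j.
have Kj x : exists y, j y = iota x by apply/jU; apply: (subvP sWU).
have jE y : linfun j y = j y by rewrite lfunE.
split=> //.
have jI := fmorph_inj j.
pose jr : {rmorphism M -> A} := j.
have jF c : jr c%:A = c%:A by exact: lrmorph_scalar.
have leM : (\dim {:M} * \dim {:M} <= 64)%N.
  rewrite -[64%N]/(8 ^ 2)%N -A_deg -[\dim {:A}]card_ord.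
  apply: (galois_dim_le galM (j := jr) _ (central_division_ring A_div) _
    (e := fun i : 'I_(\dim {:A}) => (vbasis {:A})`_i)) => [c d|z zC|d].
  - by rewrite jF -scalerAl -scalerAr mul1r mulr1.
  - by have [c ->] := central_division_center A_div zC; exists c; rewrite jF.
  exists (fun i => coord (vbasis {:A}) i d).
  rewrite {1}(coord_vbasis (memvf d)); apply: eq_bigr => i _.
  by rewrite /= jF -scalerAl mul1r.
have ltM : (4 < \dim {:M})%N.
  have /jU[y0 y0E] : s0 \in U by apply: (subvP sSU).
  have iI := fmorph_inj iota.
  have lk0 (N : fieldExtType F) (f : {lrmorphism N -> A}) : \dim (limg (linfun f)) = \dim {:N}.
    rewrite limg_dim_eq// (_ : lker _ = 0%VS) ?capv0//; apply/eqP/lker0P => y z.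
    by rewrite !lfunE => /fmorph_inj.
  rewrite -dimK -(lk0 K iota) -(lk0 M j) ltn_neqAle.
  have sKM : (limg (linfun iota) <= limg (linfun j))%VS.
    apply/subvP => _ /memv_imgP[k _ ->]; have [y yE] := Kj k.
    by rewrite lfunE /= -yE -jE memv_img ?memvf.
  rewrite dimvS// andbT; apply/eqP => dKM.
  have : s0 \in limg (linfun j) by rewrite -y0E -jE memv_img ?memvf.
  have /eqP <- : limg (linfun iota) == limg (linfun j) by rewrite eqEdim sKM dKM leqnn.
  by case/WP => k s0k; have := s0K k; rewrite s0k eqxx.
have m8 : (\dim {:M} <= 8)%N by rewrite -leq_sqr -mulnn.
move: dvdM ltM m8; rewrite A_deg.
by move: (\dim _) => m; do 9?case: m => [|m] //.
Qed.

Theorem theorem2p7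
    (F : fieldType) (F_global : global_field F)
    (F_char : 2%N \notin [pchar F])
    (A : falgType F) (A_div : central_division_algebra A)
    (A_deg : has_degree A 8)
    (a b : F) (a_neq0 : a != 0) (b_neq0 : b != 0)
    (ab_indep : indep_mod_squares a b)
    (K : splittingFieldType F) (sqrt_a sqrt_b : K)
    (sqrt_aE : sqrt_a ^+ 2 = a%:A) (sqrt_bE : sqrt_b ^+ 2 = b%:A)
    (K_gen : <<1 & [:: sqrt_a; sqrt_b]>>%VS = fullv)
    (iota : {lrmorphism K -> A})
    (ab_form : ~ isometric (diag_form [tuple a; b; a * b])
                           (diag_form [tuple 1; 1; 1]))
    (V1 V2 : oag) (v1 : valuation F V1) (v2 : valuation F V2)
    (v1_nondyadic : nondyadic v1) (v2_nondyadic : nondyadic v2)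
    (v1_ext : extends_to A v1) (v2_ext : extends_to A v2)
    (E1 E2 : {vspace K})
    (E1_inertia : is_inertia_field v1 E1) (E2_inertia : is_inertia_field v2 E2)
    (E1_quad : \dim E1 = 2%N) (E2_quad : \dim E2 = 2%N) (E1_neq_E2 : E1 <> E2)
    (q1 q2 : nat)
    (v1_card : residue_card v1 q1) (v2_card : residue_card v2 q2)
    (q1_mod4 : (q1 <> 1 %[mod 4])%N) (q2_mod4 : (q2 <> 1 %[mod 4])%N)
    (sigma tau : gal_of {:K})
    (sigma_a : sigma sqrt_a = - sqrt_a) (sigma_b : sigma sqrt_b = sqrt_b)
    (tau_a : tau sqrt_a = sqrt_a) (tau_b : tau sqrt_b = - sqrt_b) :
  (~ exists (M : splittingFieldType F) (j : {lrmorphism M -> A}),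
       [/\ galois 1%VS {:M}, \dim {:M} = 8%N &
           forall x : K, exists y : M, j y = iota x])
  /\
  (forall (le : rel (int * int)) (le_order : group_order le)
          (D : mn_data iota (Oag le_order)),
     (forall r s : int,
        mn_eps D (r, s) = (expgz sigma r * expgz tau s)%g) ->
     ~ crossed_product (mn_ring D)).
Proof.
have two := char_neq2 F_char.
have main := @no_galois_octic F A F_global F_char A_div a b K sqrt_a sqrt_b
  sqrt_aE sqrt_bE a_neq0 b_neq0 K_gen sigma tau
  sigma_a sigma_b tau_a tau_b iota ab_form V1 V2 v1 v2
  v1_nondyadic v2_nondyadic v1_ext v2_ext E1 E2 E1_inertia E2_inertia E1_quad E2_quad
  E1_neq_E2 q1 q2 v1_card v2_card q1_mod4 q2_mod4.
split=> // le le_order D epsE crossed; apply: main.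
have twoK := two_ext two K.
have galK := biquad_galois sqrt_aE sqrt_bE twoK K_gen.
have dimK := biquad_dim sqrt_aE sqrt_bE a_neq0 b_neq0 twoK K_gen sigma_a sigma_b tau_a tau_b.
apply: (crossed_product_octic A_div A_deg two galK dimK _ crossed) => rho.
have [] := biquad_gal sqrt_aE sqrt_bE K_gen sigma_a sigma_b tau_a tau_b rho => ->.
- by exists (0, 0); rewrite epsE /= !expg0 mulg1.
- by exists (1, 0); rewrite epsE /= expg0 expg1 mulg1.
- by exists (0, 1); rewrite epsE /= expg0 expg1 mul1g.
by exists (1, 1); rewrite epsE /= !expg1.
Qed.
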